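(* Let $b>0$, let $q_f\in C^\infty[-b,b]$ be complex-valued, and let $f\in C^2[-b,b]$ be a complex-valued solution of $f''-q_f f=0$ with $f(x)\neq 0$ for all $x\in[-b,b]$ and $f(0)=1$. Put $h:=f'(0)\in\mathbb{C}$ and $q_{1/f}:=-q_f+2(f'/f)^2$. Let $\mathbf{K}_f$, $\mathbf{K}_{1/f}$ be the transmutation kernels on $[-b,b]^2$ and $u_n$ ($n\ge 0$) the generalized wave polynomials, all defined in the context. Suppose that the functions $$g_1(x):=\tfrac12\bigl(\mathbf{K}_f(x,x)+\mathbf{K}_f(x,-x)\bigr)=\frac h2+\frac14\int_0^x q_f(s)\,ds,\qquad g_2(x):=\tfrac12\bigl(\mathbf{K}_f(x,x)-\mathbf{K}_f(x,-x)\bigr)=\frac14\int_0^x q_f(s)\,ds$$ admit series expansions, uniformly convergent on $[-b,b]$, $$g_1(x)=c_0u_0(x,x)+\sum_{n=1}^\infty c_n u_{2n-1}(x,x),\qquad g_2(x)=\sum_{n=1}^\infty b_n u_{2n}(x,x),$$ with complex coefficients $c_n$ ($n\ge0$), $b_n$ ($n\ge 1$). Then $$c_n=\frac{\partial_t^n\mathbf{K}_f(0,0)}{n!},\qquad b_n=-\frac{\partial_t^n\mathbf{K}_{1/f}(0,0)}{n!}\qquad\text{if } n \text{ is even},$$ $$c_n=-\frac{\partial_t^n\mathbf{K}_{1/f}(0,0)}{n!},\qquad b_n=\frac{\partial_t^n\mathbf{K}_f(0,0)}{n!}\qquad\text{if } n \text{ is odd},$$ where, for $g\in\{f,1/f\}$,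 with $q_g^{(-1)}(0):=g'(0)$ (so $q_f^{(-1)}(0)=f'(0)$ and $q_{1/f}^{(-1)}(0)=-f'(0)$), $\delta(d)=1$ if $d=0$ and $\delta(d)=0$ otherwise, and the numbers $S^n_{\ell;d;(n_1,\ldots,n_\ell)}$ defined in the context, $$\partial_t^n\mathbf{K}_g(0,0)=\frac1{2^{n+1}}\biggl(q_g^{(n-1)}(0)+\sum_{\ell=1}^{[n/2]}(-1)^\ell\sum_{d=0}^{n-2\ell}\bigl(1+(-1)^n\delta(d)\bigr)q_g^{(d-1)}(0)\sum_{\substack{n_1+\ldots+n_\ell=n-d-2\ell,\\0\le n_1\le\ldots\le n_\ell}}S^n_{\ell;d;(n_1,\ldots,n_\ell)}\prod_{i=1}^\ell q_g^{(n_i)}(0)\biggr).$$ Moreover, for every $(x,t)\in[-b,b]\times[-b,b]$, $$\mathbf{K}_f(x,t)=c_0u_0(x,t)+\sum_{n=1}^\infty\bigl(c_nu_{2n-1}(x,t)+b_nu_{2n}(x,t)\bigr),$$ and the series converges uniformly in $[-b,b]\times[-b,b]$.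
   Context: Transmutation kernels. For a complex-valued $q\in C[-b,b]$ and $h\in\mathbb{C}$, let $\mathbf{H}(u,v;h)$ be the unique solution, on $\{(u,v):|u|\le b,|v|\le b,|u+v|\le b\}$, of the Goursat problem $$\frac{\partial^2\mathbf{H}(u,v;h)}{\partial u\,\partial v}=q(u+v)\mathbf{H}(u,v;h),\qquad \mathbf{H}(u,0;h)=\frac h2+\frac12\int_0^uq(s)\,ds,\qquad \mathbf{H}(0,v;h)=\frac h2,$$ and let $\mathbf{K}(x,t;h)=\mathbf{H}\bigl(\frac{x+t}2,\frac{x-t}2;h\bigr)$ for $(x,t)\in[-b,b]^2$. $\mathbf{K}_f$ is $\mathbf{K}(\cdot,\cdot;f'(0))$ for the potential $q=q_f=f''/f$; $\mathbf{K}_{1/f}$ is $\mathbf{K}(\cdot,\cdot;-f'(0))$ for the potential $q=q_{1/f}=-q_f+2(f'/f)^2$. Generalized wave polynomials. Set $X^{(0)}\equiv\widetilde X^{(0)}\equiv1$ and, for $n\ge1$, $$X^{(n)}(x)=n\int_0^xX^{(n-1)}(s)\bigl(f^2(s)\bigr)^{(-1)^n}ds,\qquad \widetilde X^{(n)}(x)=n\int_0^x\widetilde X^{(n-1)}(s)\bigl(f^2(s)\bigr)^{(-1)^{n-1}}ds.$$ Let $\varphi_k=fX^{(k)}$ for odd $k$ and $\varphi_k=f\widetilde X^{(k)}$ for even $k$. Then $u_0(x,t)=\varphi_0(x)$ and, for $m\ge1$, $$u_{2m-1}(x,t)=\sum_{\text{even }k=0}^m\binom mk\varphi_{m-k}(x)t^k,\qquad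 u_{2m}(x,t)=\sum_{\text{odd }k=1}^m\binom mk\varphi_{m-k}(x)t^k.$$ Numbers $S^n_{\ell;d;(n_1,\ldots,n_\ell)}$. A list $\ell;d;(n_1,\ldots,n_\ell)$ of non-negative integers is admissible for $n$ if $0\le\ell\le n/2$, $0\le d\le n-2\ell$, $0\le n_1\le\ldots\le n_\ell$ and $n_1+\ldots+n_\ell+2\ell+d=n$. $S^n$ is $0$ on non-admissible lists; $S^0_{0;0;()}=\frac12$, $S^n_{0;n;()}=1$ for $n\ge1$; and for lists admissible for $n+1$ ($n\ge 0$), $$S^{n+1}_{\ell;d;(n_1,\ldots,n_\ell)}=\epsilon\,S^n_{\ell;d-1;(n_1,\ldots,n_\ell)}+\sum_{n_k\in\{n_1,\ldots,n_\ell\}}\binom{d+n_k}{n_k}S^n_{\ell-1;d+n_k+1;(n_1,\ldots,n_{k-1},n_{k+1},\ldots,n_\ell)},$$ where $\epsilon=1+(-1)^n$ if $d=1$ and $\epsilon=1$ if $d\ne1$, and the sum runs over the distinct values occurring among $n_1,\ldots,n_\ell$ (each value used once). $[n/2]$ denotes the integer part. *)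

(* Defs.v *)
From Stdlib Require Import Reals List FinFun Sorted Lia PeanoNat Bool.
From Coquelicot Require Export Coquelicot.
Import ListNotations.

Definition Icc (b : R) : R -> Prop := fun x => (- b <= x <= b)%R.

(* Differentiation relative to [I], hence one-sided at the endpoints of an
   interval.  The derivative at [x] depends only on the values of [f] on [I]. *)
Definition is_derive_on (I : R -> Prop) (f : R -> C) (x : R) (l : C) : Prop :=
  filterdiff (K := R_AbsRing) (U := R_NormedModule) (V := C_R_NormedModule)
    f (within I (locally x)) (fun y : R => scal y (l : C_R_NormedModule)).

Definition ex_derive_on (I : R -> Prop) (f : R -> C) (x : R) : Prop :=
  exists l : C, is_derive_on I f x l.

(* Like [RInt], a total operator with an unspecified value where no derivative
   exists. *)
Definition Derive_on (I : R -> Prop) (f : R -> C) (x : R) : C :=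
  iota (T := C_R_CompleteNormedModule) (is_derive_on I f x).

Fixpoint Derive_n_on (I : R -> Prop) (f : R -> C) (n : nat) : R -> C :=
  match n with
  | O => f
  | S n => Derive_on I (Derive_n_on I f n)
  end.

Definition C_n_on (I : R -> Prop) (n : nat) (f : R -> C) : Prop :=
  (forall (k : nat) (x : R),
     (k < n)%nat -> I x -> ex_derive_on I (Derive_n_on I f k) x) /\
  continuous_on I (Derive_n_on I f n).

Definition C_infty_on (I : R -> Prop) (f : R -> C) : Prop :=
  forall n : nat, C_n_on I n f.

Definition CInt (f : R -> C) (a b : R) : C :=
  RInt (V := C_R_CompleteNormedModule) f a b.

Definition Csum (a : nat -> C) (m n : nat) : C := sum_n_m a m n.

Definition converges_uniformly {T : Type} (D : T -> Prop)
    (s : nat -> T -> C) (F : T -> C) : Prop :=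
  forall eps : R, (0 < eps)%R ->
    exists N : nat, forall n : nat, (N <= n)%nat ->
      forall x : T, D x -> (Cmod (s n x - F x) < eps)%R.

Local Open Scope C_scope.

Definition goursat_domain (b u v : R) : Prop :=
  (Rabs u <= b /\ Rabs v <= b /\ Rabs (u + v) <= b)%R.

(* [Hv] is the partial derivative of [H] in [v].  All derivatives are taken
   along the slices of the closed domain. *)
Definition goursat_solution (b : R) (q : R -> C) (h : C) (H : R -> R -> C)
    : Prop :=
  continuous_on (fun p : R * R => goursat_domain b (fst p) (snd p))
    (fun p : R * R => H (fst p) (snd p)) /\
  (exists Hv : R -> R -> C,
     forall u v : R, goursat_domain b u v ->
       is_derive_on (fun y => goursat_domain b u y) (fun y => H u y) v
         (Hv u v) /\
       is_derive_on (fun y => goursat_domain b y v) (fun y => Hv y v) u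
         (q (u + v)%R * H u v)) /\
  (forall u : R, Icc b u -> H u 0%R = h / 2 + / 2 * CInt q 0 u) /\
  (forall v : R, Icc b v -> H 0%R v = h / 2).

(* [K] is, on the square, the kernel K(x,t;h) of the potential [q] *)
Definition transmutation_kernel (b : R) (q : R -> C) (h : C) (K : R -> R -> C)
    : Prop :=
  exists H : R -> R -> C,
    goursat_solution b q h H /\
    forall x t : R, Icc b x -> Icc b t ->
      K x t = H ((x + t) / 2)%R ((x - t) / 2)%R.

Definition q_inv (b : R) (q f : R -> C) (x : R) : C :=
  - q x + 2 * (Derive_on (Icc b) f x / f x) ^ 2.

Fixpoint X_ (f : R -> C) (n : nat) (x : R) : C :=
  match n with
  | O => 1
  | S m =>
      INR n *
      CInt (fun s => X_ f m s *
              (if Nat.even n then f s ^ 2 else / (f s ^ 2))) 0 x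
  end.

Fixpoint Xt_ (f : R -> C) (n : nat) (x : R) : C :=
  match n with
  | O => 1
  | S m =>
      INR n *
      CInt (fun s => Xt_ f m s *
              (if Nat.even m then f s ^ 2 else / (f s ^ 2))) 0 x
  end.

Definition phi (f : R -> C) (k : nat) (x : R) : C :=
  f x * (if Nat.odd k then X_ f k x else Xt_ f k x).

(* For [n = 2m-1] (resp. [n = 2m]) with [m >= 1], [Nat.div2 (S n) = m] and the
   sum runs over the even (resp. odd) [k <= m]. *)
Definition u_ (f : R -> C) (n : nat) (x t : R) : C :=
  match n with
  | O => phi f 0 x
  | S _ =>
      let m := Nat.div2 (S n) in
      Csum (fun k : nat =>
              if Bool.eqb (Nat.even k) (Nat.odd n)
              then Binomial.C m k * phi f (m - k) x * RtoC t ^ k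
              else 0) 0 m
  end.

(* In S^n_{l;d;(n_1,...,n_l)}, a list l;d;(n_1,...,n_l) is represented by [d]
   and [L = [n_1; ...; n_l]]; the entry l is [length L]. *)

Fixpoint nondecreasing (L : list nat) : bool :=
  match L with
  | x :: ((y :: _) as L') => (x <=? y)%nat && nondecreasing L'
  | _ => true
  end.

Definition admissible (n d : nat) (L : list nat) : bool :=
  (2 * length L <=? n)%nat && (d <=? n - 2 * length L)%nat &&
  nondecreasing L && (list_sum L + 2 * length L + d =? n)%nat.

Fixpoint remove_one (a : nat) (L : list nat) : list nat :=
  match L with
  | [] => []
  | x :: L' => if (x =? a)%nat then L' else x :: remove_one a L'
  end.

(* The first term of the recurrence vanishes for [d = 0], the index [d - 1]
   being then negative.  [nodup] selects each occurring value once. *)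
Fixpoint S_ (n d : nat) (L : list nat) : R :=
  (if admissible n d L then
     match n with
     | O => / 2
     | S m =>
         match L with
         | [] => 1
         | _ :: _ =>
             match d with
             | O => 0
             | S d' => (if (d =? 1)%nat then 1 + (-1) ^ m else 1) * S_ m d' L
             end +
             fold_right Rplus 0
               (map (fun k => Binomial.C (d + k) k *
                              S_ m (d + k + 1) (remove_one k L))
                    (nodup Nat.eq_dec L))
         end
     end
   else 0)%R.

(* The tuples lo <= n_1 <= ... <= n_l of sum m *)
Fixpoint tuples_from (lo l m : nat) : list (list nat) :=
  match l with
  | O => if (m =? 0)%nat then [[]] else []
  | S l' =>
      flat_map (fun k => map (cons k) (tuples_from k l' (m - k)))
               (seq lo (S m - lo))
  end.

Lemma in_tuples_from (l lo m : nat) (L : list nat) :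
  In L (tuples_from lo l m) <->
  length L = l /\ list_sum L = m /\
  Sorted le L /\ HdRel le lo L.
Proof.
revert lo m L; induction l as [|l IH]; intros lo m L; cbn [tuples_from].
- destruct (Nat.eqb_spec m 0) as [->|Hm]; simpl; split.
  + intros [<-|[]]; repeat split; constructor.
  + intros [HL _]; left; destruct L; [reflexivity | discriminate].
  + intros [].
  + intros [HL [Hs _]]; destruct L; simpl in *; [lia | discriminate].
- rewrite in_flat_map; split.
  + intros [k [Hk HL]]; apply in_seq in Hk; apply in_map_iff in HL.
    destruct HL as [L' [<- HL']]; apply IH in HL'.
    destruct HL' as [H1 [H2 [H3 H4]]]; simpl.
    repeat split; [lia | lia | constructor; assumption | constructor; lia].
  + intros [H1 [H2 [H3 H4]]]; destruct L as [|k L]; [discriminate|].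
    simpl in H1, H2; inversion H3; inversion H4; subst.
    exists k; split; [apply in_seq; lia|].
    apply in_map; apply IH; repeat split; try assumption; lia.
Qed.

Lemma NoDup_tuples_from (l lo m : nat) : NoDup (tuples_from lo l m).
Proof.
revert lo m; induction l as [|l IH]; intros lo m; cbn [tuples_from].
- destruct (m =? 0)%nat; repeat constructor; intros [].
- generalize (seq_NoDup (S m - lo) lo); generalize (seq lo (S m - lo)).
  intros s Hs; induction Hs as [|k s Hk Hs IHs]; simpl; [constructor|].
  apply NoDup_app; [|assumption|].
  + apply Injective_map_NoDup; [|apply IH].
    intros x y Hxy; injection Hxy; trivial.
  + intros L H1 H2; apply in_map_iff in H1; destruct H1 as [L1 [<- _]].
    apply in_flat_map in H2; destruct H2 as [k' [Hk' H2]].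
    apply in_map_iff in H2; destruct H2 as [L2 [E _]].
    injection E; intros _ ->; contradiction.
Qed.

(* [q_shift b q h d] is q^(d-1)(0), with the convention q^(-1)(0) = h. *)
Definition q_shift (b : R) (q : R -> C) (h : C) (d : nat) : C :=
  match d with
  | O => h
  | S k => Derive_n_on (Icc b) q k 0
  end.

Definition delta (d : nat) : R := if (d =? 0)%nat then 1 else 0.

Definition dtK_formula (b : R) (q : R -> C) (h : C) (n : nat) : C :=
  / (2 ^ S n) *
  (q_shift b q h n +
   Csum (fun l : nat =>
     (-1) ^ l *
     Csum (fun d : nat =>
       (1 + (-1) ^ n * delta d) * q_shift b q h d *
       fold_right Cplus 0
         (map (fun L => S_ n d L *
                 fold_right Cmult 1
                   (map (fun i => Derive_n_on (Icc b) q i 0) L))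
              (tuples_from 0 l (n - d - 2 * l))))
       0 (n - 2 * l))
     1 (Nat.div2 n)).

Definition dtK (b : R) (K : R -> R -> C) (n : nat) : C :=
  Derive_n_on (Icc b) (fun t => K 0%R t) n 0.

(* Main.v *)
Require Import Defs.
From Stdlib Require Import Reals Factorial.
From Stdlib Require Import Lra Lia Bool List Sorted Permutation FinFun.
From Coquelicot Require Import Coquelicot.
Import ListNotations.
Local Open Scope C_scope.

(** Why the theorem is true.

In the characteristic coordinates u = (x+t)/2, v = (x-t)/2, the kernel and every
wave polynomial solve the same equation W_uv = q(u+v) W.  Such a W is determined
by its values on the two axes, that is, on the diagonals t = x and t = -x, and
depends on them continuously in the uniform norm ([goursat_stability]).  As
u_{2n-1} is even and u_{2n} is odd in t, the expansions of g1 and g2 say exactly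
that the partial sums of the double series converge uniformly to the kernel on
both diagonals; hence they do so on the whole square ([expansion_converges]).

At x = 0 all formal powers except the zeroth one vanish, so that u_{2n-1}(0,t) and
u_{2n}(0,t) are t^n or 0 according to the parity of n.  The expansion becomes a
power series of K_f(0,t), with coefficients c_n for n even and b_n for n odd
([partial_sum_x0], [power_series_coefficients]).

The other coefficients are found in the same way from K_{1/f}.  A wave polynomial
u of f and the wave polynomial w of 1/f of the same degree and opposite parity
form a conjugate pair: w_t = u_x - (f'/f) u and u_t = w_x + (f'/f) w.  On the
diagonal this gives (f w)' = f u' - f' u, which after one integration transports
uniform convergence of diagonal traces from f to 1/f ([dual_trace_bound]).  Since
q_{1/f} = q_f - 2 (f'/f)', the limits are the traces of -K_{1/f}, now with the
roles of c_n and b_n exchanged ([inv_traces_bound]); so [expansion_converges]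
applies to 1/f as well.

The formula for the derivatives of K(0,t) at t = 0 comes from the operator
D = d_u - d_v.  It annihilates q(u+v), and by the equation and the Leibniz rule
it maps d_u^d H + (-1)^n d_v^d H to a combination of similar terms with n+1 in
place of n, with products of derivatives of q as coefficients.  Iterating from
H = (H + H)/2 produces the numbers S^n: their recurrence is the rule by which
these coefficients change ([coefficient_recurrence],
[scaled_derivative_derive]).  At the origin the pure derivatives of H are read off
the Goursat data.

All derivatives are taken at interior points.  This suffices because the segment
x = 0, |t| <= b lies in the interior of the domain of H, and because the estimate
on the open square passes to the closed one by continuity along rays. *)


(** * Functions of a real variable with complex values *)

(** Derivatives are taken over the reals: C is a normed module over R here. *)
Definition cder (f : R -> C) (x : R) (l : C) : Prop :=
  is_derive (K := R_AbsRing) (V := C_R_NormedModule) f x l.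

Definition ccont (f : R -> C) (x : R) : Prop :=
  continuous (T := R_UniformSpace) (U := C_UniformSpace) f x.

Definition ccont2 (F : R -> R -> C) (u v : R) : Prop :=
  continuous (T := prod_UniformSpace R_UniformSpace R_UniformSpace)
    (U := C_UniformSpace) (fun p : R * R => F (fst p) (snd p)) (u, v).

Definition cRInt (f : R -> C) (a b : R) (l : C) : Prop :=
  is_RInt (V := C_R_NormedModule) f a b l.

Lemma continuous_C (T : UniformSpace) (f : T -> C) (x : T) :
  continuous (U := C_UniformSpace) f x <->
  continuous (fun y => fst (f y)) x /\ continuous (fun y => snd (f y)) x.
Proof.
split.
- intros H; split.
  + apply (continuous_comp f fst); [exact H|].
    destruct (f x); apply continuous_fst.
  + apply (continuous_comp f snd); [exact H|].
    destruct (f x); apply continuous_snd.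
- intros [H1 H2].
  apply (continuous_ext (fun y => (fst (f y), snd (f y)))).
  { intros y; destruct (f y); reflexivity. }
  apply (continuous_comp_2 (fun y => fst (f y)) (fun y => snd (f y))
           (fun a b => (a, b)) x H1 H2).
  apply (continuous_ext (fun p => p)); [intros [a b]; reflexivity|].
  apply continuous_id.
Qed.

(** Through real and imaginary parts the product and quotient rules, and later
    differentiation under the integral sign, become statements on real functions. *)
Lemma cder_components (f : R -> C) (x : R) (l : C) :
  cder f x l <->
  is_derive (fun y => fst (f y)) x (fst l) /\
  is_derive (fun y => snd (f y)) x (snd l).
Proof.
split.
- intros H; split.
  + apply (filterdiff_comp' f (fst : C_R_NormedModule -> R_NormedModule) x _ fst H).
    apply filterdiff_linear; apply is_linear_fst.
  + apply (filterdiff_comp' f (snd : C_R_NormedModule -> R_NormedModule) x _ snd H).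
    apply filterdiff_linear; apply is_linear_snd.
- intros [H1 H2].
  assert (H := filterdiff_comp'_2 (fun y => fst (f y)) (fun y => snd (f y))
     (fun a b => ((a, b) : C_R_NormedModule)) x _ _ (fun a b => (a, b)) H1 H2).
  unfold is_derive.
  eapply filterdiff_ext_lin.
  + eapply filterdiff_ext; [|apply H].
    * intros y; simpl; destruct (f y); reflexivity.
    * apply (filterdiff_ext (fun p => p)); [intros [a b]; reflexivity|].
      apply (filterdiff_ext_lin _ (fun p => p)); [|intros [a b]; reflexivity].
      apply filterdiff_id.
  + intros y; simpl; destruct l; reflexivity.
Qed.

Lemma cRInt_components (f : R -> C) (a b : R) (l : C) :
  cRInt f a b l <->
  is_RInt (fun y => fst (f y)) a b (fst l) /\
  is_RInt (fun y => snd (f y)) a b (snd l).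
Proof.
split.
- intros H; split.
  + apply (is_RInt_fct_extend_fst (U := R_NormedModule) (V := R_NormedModule) f a b l H).
  + apply (is_RInt_fct_extend_snd (U := R_NormedModule) (V := R_NormedModule) f a b l H).
- intros [H1 H2]; destruct l as [l1 l2].
  apply (is_RInt_fct_extend_pair (U := R_NormedModule) (V := R_NormedModule)); assumption.
Qed.

Lemma cder_continuous (f : R -> C) (x : R) (l : C) : cder f x l -> ccont f x.
Proof.
intros H. apply (ex_derive_continuous (V := C_R_NormedModule)); exists l; exact H.
Qed.

Lemma cder_const (a : C) (x : R) : cder (fun _ => a) x 0.
Proof. apply (is_derive_const (V := C_R_NormedModule)). Qed.

Lemma cder_plus (f g : R -> C) (x : R) (l m : C) :
  cder f x l -> cder g x m -> cder (fun y => f y + g y) x (l + m).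
Proof. apply (is_derive_plus (V := C_R_NormedModule)). Qed.

Lemma cder_opp (f : R -> C) (x : R) (l : C) :
  cder f x l -> cder (fun y => - f y) x (- l).
Proof. apply (is_derive_opp (V := C_R_NormedModule)). Qed.

Lemma cder_minus (f g : R -> C) (x : R) (l m : C) :
  cder f x l -> cder g x m -> cder (fun y => f y - g y) x (l - m).
Proof. apply (is_derive_minus (V := C_R_NormedModule)). Qed.

Lemma is_derive_eq (f : R -> R) (x l m : R) :
  is_derive f x l -> l = m -> is_derive f x m.
Proof. intros H <-; exact H. Qed.

Lemma cder_mult (f g : R -> C) (x : R) (l m : C) :
  cder f x l -> cder g x m ->
  cder (fun y => f y * g y) x (l * g x + f x * m).
Proof.
rewrite !cder_components; intros [F1 F2] [G1 G2]; simpl; split.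
- match goal with |- is_derive _ _ ?l => set (l0 := l) end.
  evar (l1 : R); assert (E : l0 = l1); subst l1; cycle 1.
  + rewrite E.
    eapply (is_derive_ext (fun y => fst (f y) * fst (g y) - snd (f y) * snd (g y))%R).
    { intros; reflexivity. }
    apply (is_derive_minus (V := R_NormedModule));
    apply (is_derive_mult (K := R_AbsRing)); try eassumption; apply Rmult_comm.
  + unfold l0, minus, plus, opp, mult; simpl; ring.
- match goal with |- is_derive _ _ ?l => set (l0 := l) end.
  evar (l1 : R); assert (E : l0 = l1); subst l1; cycle 1.
  + rewrite E.
    eapply (is_derive_ext (fun y => fst (f y) * snd (g y) + snd (f y) * fst (g y))%R).
    { intros; reflexivity. }
    apply (is_derive_plus (V := R_NormedModule));
    apply (is_derive_mult (K := R_AbsRing)); try eassumption; apply Rmult_comm.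
  + unfold l0, minus, plus, opp, mult; simpl; ring.
Qed.

Lemma cder_eq (f : R -> C) (x : R) (l m : C) :
  cder f x l -> l = m -> cder f x m.
Proof. intros H <-; exact H. Qed.

Lemma cder_ext (f g : R -> C) (x : R) (l : C) :
  (forall y, f y = g y) -> cder f x l -> cder g x l.
Proof. apply (is_derive_ext (V := C_R_NormedModule)). Qed.

Lemma cder_ext_loc (f g : R -> C) (x : R) (l : C) :
  locally x (fun y => f y = g y) -> cder f x l -> cder g x l.
Proof. apply (is_derive_ext_loc (V := C_R_NormedModule)). Qed.

Lemma cder_unique (f : R -> C) (x : R) (l m : C) :
  cder f x l -> cder f x m -> l = m.
Proof.
rewrite !cder_components; intros [F1 F2] [G1 G2].
apply is_derive_unique in F1, F2, G1, G2.
destruct l, m; simpl in *; congruence.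
Qed.

Lemma cder_RtoC (g : R -> R) (x r : R) :
  is_derive g x r -> cder (fun y => RtoC (g y)) x (RtoC r).
Proof.
intros H; apply cder_components; simpl; split; [exact H|].
apply (is_derive_const (V := R_NormedModule)).
Qed.

Lemma cder_comp (f : R -> C) (g : R -> R) (x r : R) (l : C) :
  cder f (g x) l -> is_derive g x r -> cder (fun y => f (g y)) x (r * l).
Proof.
intros Hf Hg; eapply cder_eq.
- apply (is_derive_comp (V := C_R_NormedModule) f g); eassumption.
- destruct l; unfold scal; simpl; unfold prod_scal, scal; simpl.
  unfold mult; simpl; apply injective_projections; simpl; ring.
Qed.

Lemma cder_scal (k : C) (f : R -> C) (x : R) (l : C) :
  cder f x l -> cder (fun y => k * f y) x (k * l).
Proof.
intros H; eapply cder_eq; [apply cder_mult; [apply cder_const|exact H]|].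
simpl; ring.
Qed.

Lemma Csum2_neq_0 (z : C) : z <> 0 -> (fst z ^ 2 + snd z ^ 2)%R <> 0%R.
Proof.
intros Hz E; apply Hz; destruct z as [a b]; simpl in E.
assert (a = 0 /\ b = 0)%R as [-> ->] by (split; nra); reflexivity.
Qed.

Lemma is_derive_quotient_norm (g k1 k2 : R -> R) (x g' a b : R) :
  is_derive g x g' -> is_derive k1 x a -> is_derive k2 x b ->
  (k1 x ^ 2 + k2 x ^ 2)%R <> 0%R ->
  is_derive (fun y => g y / (k1 y ^ 2 + k2 y ^ 2))%R x
    ((g' * (k1 x ^ 2 + k2 x ^ 2) - g x * (2 * k1 x * a + 2 * k2 x * b))
       / (k1 x ^ 2 + k2 x ^ 2) ^ 2)%R.
Proof.
intros Hg H1 H2 Hd.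
auto_derive.
- repeat split; try (eexists; eassumption); contradict Hd; rewrite <- Hd; ring.
- replace (Derive (fun y => g y) x) with g'
    by (symmetry; apply is_derive_unique; exact Hg).
  replace (Derive (fun y => k1 y) x) with a
    by (symmetry; apply is_derive_unique; exact H1).
  replace (Derive (fun y => k2 y) x) with b
    by (symmetry; apply is_derive_unique; exact H2).
  field; repeat split; contradict Hd; rewrite <- Hd; ring.
Qed.

Lemma cder_inv (f : R -> C) (x : R) (l : C) :
  cder f x l -> f x <> 0 -> cder (fun y => / f y) x (- l / (f x) ^ 2).
Proof.
rewrite !cder_components; intros [F1 F2] Hn.
assert (Hd := Csum2_neq_0 _ Hn).
assert (Hd2 : (fst (f x ^ 2)%C ^ 2 + snd (f x ^ 2)%C ^ 2)%R <> 0%R).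
{ apply Csum2_neq_0; apply Cpow_nz; exact Hn. }
revert Hd2; destruct l as [l1 l2]; simpl; simpl in Hd, F1, F2; intros Hd2.
split.
- eapply is_derive_eq; [apply (is_derive_quotient_norm (fun y => fst (f y))
    (fun y => fst (f y)) (fun y => snd (f y)) x l1 l1 l2); assumption|].
  field; split;
    [contradict Hd2|contradict Hd]; (eapply eq_trans; [|eassumption]; ring).
- eapply is_derive_eq; [apply (is_derive_quotient_norm (fun y => (- snd (f y))%R)
    (fun y => fst (f y)) (fun y => snd (f y)) x (- l2) l1 l2);
    try assumption; apply (is_derive_opp (V := R_NormedModule) (fun y => snd (f y))); assumption|].
  field; split;
    [contradict Hd2|contradict Hd]; (eapply eq_trans; [|eassumption]; ring).
Qed.

Lemma cder_zero_const (lo hi : R) (f : R -> C) (x y : R) :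
  (forall t, (lo < t < hi)%R -> cder f t (RtoC 0)) ->
  (lo < x < hi)%R -> (lo < y < hi)%R -> f x = f y.
Proof.
intros H Hx Hy.
destruct (Rtotal_order x y) as [L|[->|L]]; [|reflexivity|].
- apply (eq_is_derive (V := C_R_NormedModule)); [|exact L].
  intros t Ht; apply H; lra.
- symmetry; apply (eq_is_derive (V := C_R_NormedModule)); [|exact L].
  intros t Ht; apply H; lra.
Qed.

Section Cont.
Context (T : UniformSpace).
Implicit Types (f g : T -> C) (x : T).

Lemma continuous_Cplus f g x :
  continuous (U := C_UniformSpace) f x -> continuous (U := C_UniformSpace) g x ->
  continuous (U := C_UniformSpace) (fun y => f y + g y) x.
Proof. apply (continuous_plus (V := C_R_NormedModule)). Qed.

Lemma continuous_Copp f x :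
  continuous (U := C_UniformSpace) f x ->
  continuous (U := C_UniformSpace) (fun y => - f y) x.
Proof. apply (continuous_opp (V := C_R_NormedModule)). Qed.

Lemma continuous_Cmult f g x :
  continuous (U := C_UniformSpace) f x -> continuous (U := C_UniformSpace) g x ->
  continuous (U := C_UniformSpace) (fun y => f y * g y) x.
Proof.
rewrite !continuous_C; intros [F1 F2] [G1 G2]; simpl; split.
- apply (continuous_minus (V := R_NormedModule));
  apply (continuous_mult (K := R_AbsRing)); assumption.
- apply (continuous_plus (V := R_NormedModule));
  apply (continuous_mult (K := R_AbsRing)); assumption.
Qed.

Lemma continuous_Cconst (a : C) x :
  continuous (U := C_UniformSpace) (fun _ : T => a) x.
Proof. apply continuous_const. Qed.
End Cont.

Lemma ccont_inv (f : R -> C) (x : R) :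
  ccont f x -> f x <> 0 -> ccont (fun y => / f y) x.
Proof.
unfold ccont; rewrite !continuous_C; intros [F1 F2] Hn; simpl.
assert (Hd := Csum2_neq_0 _ Hn).
assert (D : continuous (fun y : R => / (fst (f y) ^ 2 + snd (f y) ^ 2))%R x).
{ apply continuous_Rinv_comp; [|exact Hd].
  apply (continuous_plus (V := R_NormedModule)); simpl;
  repeat apply (continuous_mult (K := R_AbsRing)); try assumption;
  apply continuous_const. }
split; apply (continuous_mult (K := R_AbsRing)); try assumption.
apply (continuous_opp (V := R_NormedModule)); assumption.
Qed.

Lemma cRInt_correct (f : R -> C) (a b : R) :
  (forall z, (Rmin a b <= z <= Rmax a b)%R -> ccont f z) ->
  cRInt f a b (CInt f a b).
Proof.
intros H. apply (RInt_correct (V := C_R_CompleteNormedModule)).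
apply (ex_RInt_continuous (V := C_R_CompleteNormedModule)); exact H.
Qed.

Lemma cRInt_unique (f : R -> C) (a b : R) (l : C) :
  cRInt f a b l -> CInt f a b = l.
Proof. apply (is_RInt_unique (V := C_R_CompleteNormedModule)). Qed.

Lemma CInt_ext (f g : R -> C) (a b : R) :
  (forall z, (Rmin a b < z < Rmax a b)%R -> f z = g z) ->
  CInt f a b = CInt g a b.
Proof. apply (RInt_ext (V := C_R_CompleteNormedModule)). Qed.

Lemma CInt_point (f : R -> C) (a : R) : CInt f a a = 0.
Proof. apply (RInt_point (V := C_R_CompleteNormedModule)). Qed.

Lemma CInt_derive (f : R -> C) (lo hi a x : R) :
  (forall y, (lo < y < hi)%R -> ccont f y) ->
  (lo < a < hi)%R -> (lo < x < hi)%R ->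
  cder (fun y => CInt f a y) x (f x).
Proof.
intros Hf Ha Hx.
apply (is_derive_RInt (V := C_R_NormedModule) f _ a); [|apply Hf; exact Hx].
assert (Hd : (0 < Rmin (x - lo) (hi - x))%R) by (apply Rmin_pos; lra).
exists (mkposreal _ Hd); intros y Hy.
apply cRInt_correct; intros z Hz; apply Hf.
assert (lo < y < hi)%R.
{ unfold ball in Hy; simpl in Hy; unfold AbsRing_ball, abs, minus, plus, opp in Hy; simpl in Hy.
  apply Rabs_def2 in Hy.
  assert (A := Rmin_l (x - lo) (hi - x)); assert (B := Rmin_r (x - lo) (hi - x)); lra. }
unfold Rmin, Rmax in Hz; destruct (Rle_dec a y); lra.
Qed.

Lemma cRInt_derive (f df : R -> C) (a b : R) :
  (forall x, (Rmin a b <= x <= Rmax a b)%R -> cder f x (df x)) ->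
  (forall x, (Rmin a b <= x <= Rmax a b)%R -> ccont df x) ->
  cRInt df a b (f b - f a).
Proof. apply (is_RInt_derive (V := C_R_CompleteNormedModule)). Qed.

Lemma cRInt_norm_le (f : R -> C) (g : R -> R) (a b : R) (l : C) (m : R) :
  (a <= b)%R -> (forall x, (a <= x <= b)%R -> (Cmod (f x) <= g x)%R) ->
  cRInt f a b l -> is_RInt g a b m -> (Cmod l <= m)%R.
Proof.
intros Hab Hfg Hl Hm. rewrite Cmod_norm.
apply (norm_RInt_le (V := C_R_NormedModule) f g a b); try assumption.
intros x Hx; generalize (Hfg x Hx); rewrite Cmod_norm; trivial.
Qed.

(** * Derivatives relative to an interval *)

Lemma norm_CR (z : C) : norm (V := C_R_NormedModule) z = Cmod z.
Proof. symmetry; apply Cmod_norm. Qed.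

(** The common epsilon form of one-sided and two-sided derivatives, from which they
    can be compared. *)
Lemma filterdiff_C_spec (F : (R -> Prop) -> Prop) {FF : Filter F}
    (f : R -> C) (x : R) (l : C) :
  is_filter_lim (T := R_UniformSpace) F x ->
  (forall z : R, is_filter_lim (T := R_UniformSpace) F z -> z = x) ->
  filterdiff (K := R_AbsRing) (U := R_NormedModule) (V := C_R_NormedModule)
    f F (fun y : R => scal y (l : C_R_NormedModule)) <->
  forall eps : posreal,
    F (fun y : R => (Cmod (f y - f x - RtoC (y - x) * l) <= eps * Rabs (y - x))%R).
Proof.
intros Hx Hz.
assert (E : forall y, norm (V := C_R_NormedModule)
   (minus (minus (f y : C_R_NormedModule) (f x))
     (scal (minus y x : R) (l : C_R_NormedModule)))
   = Cmod (f y - f x - RtoC (y - x) * l)).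
{ intros y; rewrite norm_CR; f_equal; unfold scal, minus, plus, opp; simpl.
  destruct (f y), (f x), l; unfold prod_plus, prod_opp, prod_scal, scal, plus, opp; simpl.
  unfold mult; simpl; apply injective_projections; simpl; ring. }
split.
- intros [_ H] eps; specialize (H x Hx eps); revert H; apply filter_imp.
  intros y; rewrite E; trivial.
- intros H; split; [apply (is_linear_scal_l (K := R_AbsRing) (V := C_R_NormedModule) l)|].
  intros z Hz' eps; rewrite (Hz z Hz'); generalize (H eps); apply filter_imp.
  intros y; rewrite E; trivial.
Qed.

Lemma is_derive_on_spec (I : R -> Prop) (f : R -> C) (x : R) (l : C) :
  I x ->
  is_derive_on I f x l <->
  forall eps : posreal, locally x (fun y : R => I y ->
    (Cmod (f y - f x - RtoC (y - x) * l) <= eps * Rabs (y - x))%R).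
Proof.
intros Ix; unfold is_derive_on.
apply (filterdiff_C_spec (within I (locally x))).
- intros P HP; unfold within; revert HP; apply filter_imp; auto.
- intros z Hz.
  assert (FP : ProperFilter' (within I (locally x))).
  { constructor.
    - intros H. apply (locally_singleton _ _ H Ix).
    - apply within_filter; apply locally_filter. }
  apply (is_filter_lim_unique (K := R_AbsRing) (V := R_NormedModule)
          (F := within I (locally x))).
  + exact Hz.
  + intros P HP; unfold within; revert HP; apply filter_imp; auto.
Qed.

Lemma cder_spec (f : R -> C) (x : R) (l : C) :
  cder f x l <->
  forall eps : posreal, locally x (fun y : R =>
    (Cmod (f y - f x - RtoC (y - x) * l) <= eps * Rabs (y - x))%R).
Proof.
apply (filterdiff_C_spec (locally x)).
- intros P HP; exact HP.
- intros z Hz.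
  apply (is_filter_lim_unique (K := R_AbsRing) (V := R_NormedModule)
          (F := locally x)); [exact Hz|intros P HP; exact HP].
Qed.

(** Inside an interval the relative derivative is the ordinary one; this is how the
    hypotheses enter the calculus on open sets. *)
Lemma is_derive_on_interior (I : R -> Prop) (f : R -> C) (x : R) (l : C) :
  locally x I -> is_derive_on I f x l <-> cder f x l.
Proof.
intros HI; rewrite is_derive_on_spec, cder_spec by exact (locally_singleton _ _ HI).
split; intros H eps; specialize (H eps).
- generalize (filter_and _ _ H HI); apply filter_imp; tauto.
- revert H; apply filter_imp; auto.
Qed.

Lemma cder_derive_on (I : R -> Prop) (f : R -> C) (x : R) (l : C) :
  I x -> cder f x l -> is_derive_on I f x l.
Proof.
intros Ix; rewrite is_derive_on_spec, cder_spec by exact Ix.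
intros H eps; generalize (H eps); apply filter_imp; auto.
Qed.

Lemma is_derive_on_ext (I : R -> Prop) (f g : R -> C) (x : R) (l : C) :
  I x -> (forall y, I y -> f y = g y) ->
  is_derive_on I f x l -> is_derive_on I g x l.
Proof.
intros Ix E; rewrite !is_derive_on_spec by exact Ix.
intros H eps; generalize (H eps); apply filter_imp; intros y Hy Iy.
rewrite <- !E by assumption; auto.
Qed.

(** At an isolated point every number is a relative derivative; limit points are where
    [Derive_on] is meaningful. *)
Definition limit_point (I : R -> Prop) (x : R) : Prop :=
  forall d : posreal, exists y, I y /\ y <> x /\ (Rabs (y - x) < d)%R.

Lemma is_derive_on_unique (I : R -> Prop) (f : R -> C) (x : R) (l m : C) :
  I x -> limit_point I x ->
  is_derive_on I f x l -> is_derive_on I f x m -> l = m.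
Proof.
intros Ix Ax; rewrite !is_derive_on_spec by exact Ix; intros Hl Hm.
assert (Z : Cmod (l - m) = 0%R).
{ destruct (Rle_lt_or_eq_dec _ _ (Cmod_ge_0 (l - m))) as [P|P]; [|auto].
  assert (P4 : (0 < Cmod (l - m) / 4)%R) by lra.
  set (eps := mkposreal _ P4).
  destruct (filter_and _ _ (Hl eps) (Hm eps)) as [d Hd].
  destruct (Ax d) as [y [Iy [Ny Dy]]].
  destruct (Hd y Dy) as [A B]; specialize (A Iy); specialize (B Iy).
  assert (T := Cmod_triangle (f y - f x - RtoC (y - x) * m)
                 (- (f y - f x - RtoC (y - x) * l))).
  rewrite Cmod_opp in T.
  replace (f y - f x - RtoC (y - x) * m + - (f y - f x - RtoC (y - x) * l))
    with (RtoC (y - x) * (l - m)) in T by ring.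
  rewrite Cmod_mult, Cmod_R in T.
  assert (0 < Rabs (y - x))%R by (apply Rabs_pos_lt; lra).
  simpl in A, B; nra. }
apply Cmod_eq_0 in Z. replace l with (m + (l - m)) by ring. rewrite Z; ring.
Qed.

Lemma Derive_on_unique (I : R -> Prop) (f : R -> C) (x : R) (l : C) :
  I x -> limit_point I x -> is_derive_on I f x l -> Derive_on I f x = l.
Proof.
intros Ix Ax H; unfold Derive_on.
apply (iota_unique (V := C_R_CompleteNormedModule)); [|exact H].
intros y Hy; exact (is_derive_on_unique I f x y l Ix Ax Hy H).
Qed.

Lemma Icc_limit_point (b x : R) : (0 < b)%R -> Icc b x -> limit_point (Icc b) x.
Proof.
intros Hb [H1 H2] d; assert (Hd := cond_pos d).
assert (M1 := Rmin_l (d / 2) b); assert (M2 := Rmin_r (d / 2) b).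
assert (M0 : (0 < Rmin (d / 2) b)%R) by (apply Rmin_pos; lra).
destruct (Rle_dec x 0).
- exists (x + Rmin (d / 2) b)%R; unfold Icc; repeat split; try lra.
  rewrite Rabs_pos_eq; lra.
- exists (x - Rmin (d / 2) b)%R; unfold Icc; repeat split; try lra.
  rewrite Rabs_left; lra.
Qed.

Lemma locally_Ioo (lo hi x : R) :
  (lo < x < hi)%R -> locally x (fun y => (lo < y < hi)%R).
Proof.
intros Hx.
assert (Hd : (0 < Rmin (x - lo) (hi - x))%R) by (apply Rmin_pos; lra).
exists (mkposreal _ Hd); intros y Hy.
unfold ball in Hy; simpl in Hy; unfold AbsRing_ball, abs, minus, plus, opp in Hy; simpl in Hy.
apply Rabs_def2 in Hy.
assert (A := Rmin_l (x - lo) (hi - x)); assert (B := Rmin_r (x - lo) (hi - x)); lra.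
Qed.

Lemma locally_Icc (b x : R) : (- b < x < b)%R -> locally x (Icc b).
Proof.
intros Hx; generalize (locally_Ioo _ _ _ Hx); apply filter_imp.
intros y Hy; unfold Icc; lra.
Qed.

(** A sequence whose members are successive derivatives must be the sequence of iterated
    derivatives; this turns an explicit formula for the n-th derivative, guessed for all
    n at once, into a statement on [Derive_n_on]. *)
Lemma Derive_n_on_chain (b : R) (q : R -> C) (Q : nat -> R -> C) :
  (0 < b)%R ->
  (forall x, Icc b x -> Q 0%nat x = q x) ->
  (forall n x, Icc b x -> is_derive_on (Icc b) (Q n) x (Q (S n) x)) ->
  forall n x, Icc b x -> Derive_n_on (Icc b) q n x = Q n x.
Proof.
intros Hb H0 HS; induction n as [|n IH]; intros x Ix; simpl.
- symmetry; apply H0; exact Ix.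
- apply Derive_on_unique; [exact Ix|apply Icc_limit_point; assumption|].
  apply (is_derive_on_ext _ (Q n)); [exact Ix| |apply HS; exact Ix].
  intros y Iy; symmetry; apply IH; exact Iy.
Qed.

Lemma is_derive_on_continuous (I : R -> Prop) (f : R -> C) (x : R) (l : C) :
  I x -> is_derive_on I f x l ->
  filterlim f (within I (locally x)) (locally (T := C_UniformSpace) (f x)).
Proof.
intros Ix H; rewrite is_derive_on_spec in H by exact Ix.
apply (filterlim_locally (U := C_UniformSpace)).
intros eps.
assert (He := cond_pos eps). assert (Hl := Cmod_ge_0 l).
assert (Hd : (0 < eps / (2 + 2 * Cmod l))%R).
{ apply Rdiv_lt_0_compat; lra. }
specialize (H (mkposreal _ Rlt_0_1)).
assert (B : locally x (fun y : R => (Rabs (y - x) < eps / (2 + 2 * Cmod l))%R)).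
{ exists (mkposreal _ Hd); intros y Hy; exact Hy. }
unfold within; generalize (filter_and _ _ H B); apply filter_imp; simpl.
intros y [A D] Iy; specialize (A Iy).
apply (norm_compat1 (V := C_R_NormedModule)).
change (norm (V := C_R_NormedModule) (f y - f x)%C < eps)%R.
rewrite norm_CR.
assert (T := Cmod_triangle (f y - f x - RtoC (y - x) * l) (RtoC (y - x) * l)).
replace (f y - f x - RtoC (y - x) * l + RtoC (y - x) * l) with (f y - f x) in T by ring.
rewrite Cmod_mult, Cmod_R in T.
apply Rle_lt_trans with (Rabs (y - x) * (1 + Cmod l))%R; [lra|].
apply Rmult_lt_compat_r with (r := (1 + Cmod l)%R) in D; [|lra].
replace (eps / (2 + 2 * Cmod l) * (1 + Cmod l))%R with (eps / 2)%R in D by (field; lra).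
lra.
Qed.

Lemma C_infty_on_chain (b : R) (q : R -> C) (Q : nat -> R -> C) :
  (0 < b)%R ->
  (forall x, Icc b x -> Q 0%nat x = q x) ->
  (forall n x, Icc b x -> is_derive_on (Icc b) (Q n) x (Q (S n) x)) ->
  C_infty_on (Icc b) q.
Proof.
intros Hb H0 HS n.
assert (E := Derive_n_on_chain b q Q Hb H0 HS).
assert (D : forall k x, Icc b x ->
   is_derive_on (Icc b) (Derive_n_on (Icc b) q k) x (Q (S k) x)).
{ intros k x Ix; apply (is_derive_on_ext _ (Q k)); [exact Ix| |apply HS; exact Ix].
  intros y Iy; symmetry; apply E; exact Iy. }
split.
- intros k x _ Ix; exists (Q (S k) x); apply D; exact Ix.
- intros x Ix; apply (is_derive_on_continuous _ _ _ _ Ix (D n x Ix)).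
Qed.

Lemma C_n_on_cder (b : R) (n k : nat) (f : R -> C) (x : R) :
  (0 < b)%R -> C_n_on (Icc b) n f -> (k < n)%nat -> (- b < x < b)%R ->
  cder (Derive_n_on (Icc b) f k) x (Derive_n_on (Icc b) f (S k) x).
Proof.
intros Hb [H _] Hk Hx; assert (Ix : Icc b x) by (unfold Icc; lra).
destruct (H k x Hk Ix) as [l Hl].
simpl; rewrite (Derive_on_unique _ _ _ l Ix (Icc_limit_point _ _ Hb Ix) Hl).
apply (is_derive_on_interior (Icc b)); [apply locally_Icc; exact Hx|exact Hl].
Qed.

Lemma C_n_on_continuous (b : R) (n k : nat) (f : R -> C) :
  C_n_on (Icc b) n f -> (k <= n)%nat ->
  continuous_on (U := C_UniformSpace) (Icc b) (Derive_n_on (Icc b) f k).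
Proof.
intros [H Hc] Hk.
destruct (Nat.eq_dec k n) as [->|Hn]; [exact Hc|].
intros x Ix; destruct (H k x ltac:(lia) Ix) as [l Hl].
exact (is_derive_on_continuous _ _ _ _ Ix Hl).
Qed.

(** Composition with [clamp b] extends a function on [-b,b] by constants.  The extension
    is continuous on the whole line and keeps the same set of values, so that a function
    without zeros stays without zeros. *)
Definition clamp (b x : R) : R := Rmax (- b) (Rmin b x).

Lemma clamp_Icc (b x : R) : (0 < b)%R -> Icc b (clamp b x).
Proof.
intros Hb; unfold clamp, Icc, Rmax, Rmin.
destruct (Rle_dec b x), (Rle_dec (- b) b), (Rle_dec (-b) x); lra.
Qed.

Lemma clamp_id (b x : R) : Icc b x -> clamp b x = x.
Proof.
unfold clamp, Icc, Rmax, Rmin; intros.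
destruct (Rle_dec b x), (Rle_dec (- b) b), (Rle_dec (-b) x); lra.
Qed.

Lemma clamp_dist (b x y : R) : (0 < b)%R ->
  (Rabs (clamp b y - clamp b x) <= Rabs (y - x))%R.
Proof.
intros Hb; unfold clamp, Rmax, Rmin.
destruct (Rle_dec b x), (Rle_dec b y), (Rle_dec (- b) b), (Rle_dec (-b) x), (Rle_dec (-b) y);
  unfold Rabs; repeat destruct Rcase_abs; lra.
Qed.

Lemma clamp_continuous (b : R) (f : R -> C) (x : R) :
  (0 < b)%R -> continuous_on (U := C_UniformSpace) (Icc b) f ->
  ccont (fun y => f (clamp b y)) x.
Proof.
intros Hb Hf. unfold ccont, continuous.
eapply filterlim_comp; [|apply Hf; apply clamp_Icc; exact Hb].
intros P [d Hd]; exists d; intros y Hy; apply Hd; [|apply clamp_Icc; exact Hb].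
apply Rle_lt_trans with (2 := Hy); apply clamp_dist; exact Hb.
Qed.

Lemma ccont_bounded (f : R -> C) (a b : R) :
  (forall x, (a <= x <= b)%R -> ccont f x) ->
  exists M : R, forall x, (a <= x <= b)%R -> (Cmod (f x) <= M)%R.
Proof.
intros H; destruct (bounded_continuity (V := C_R_NormedModule) f a b H) as [M HM].
exists M; intros x Hx; rewrite <- norm_CR; apply Rlt_le, HM, Hx.
Qed.

Lemma continuous_on_bounded (b : R) (f : R -> C) :
  (0 < b)%R -> continuous_on (U := C_UniformSpace) (Icc b) f ->
  exists M : R, forall x, Icc b x -> (Cmod (f x) <= M)%R.
Proof.
intros Hb Hf.
destruct (ccont_bounded (fun y => f (clamp b y)) (- b) b) as [M HM].
{ intros x _; apply clamp_continuous; assumption. }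
exists M; intros x Hx; rewrite <- (clamp_id b x Hx) ; apply HM; exact Hx.
Qed.

(** * Integrals depending on a parameter *)

(** The regions on which the Goursat problem is integrated: open, and containing with a
    point the closed characteristic rectangle spanned by it and the origin. *)
Record star_open (D : R -> R -> Prop) : Prop := {
  star_locally : forall u v, D u v -> locally_2d D u v;
  star_rectangle : forall u v s r, D u v ->
    (Rmin 0 u <= s <= Rmax 0 u)%R -> (Rmin 0 v <= r <= Rmax 0 v)%R -> D s r }.

Lemma ccont2_components (F : R -> R -> C) (u v : R) :
  ccont2 F u v <->
  continuity_2d_pt (fun x y => fst (F x y)) u v /\
  continuity_2d_pt (fun x y => snd (F x y)) u v.
Proof.
unfold ccont2; rewrite continuous_C, !continuity_2d_pt_filterlim; reflexivity.
Qed.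

Lemma between_end (a : R) : (Rmin 0 a <= a <= Rmax 0 a)%R.
Proof. split; [apply Rmin_r|apply Rmax_r]. Qed.

Lemma between_0 (a : R) : (Rmin 0 a <= 0 <= Rmax 0 a)%R.
Proof. split; [apply Rmin_l|apply Rmax_l]. Qed.

Lemma continuity_2d_slice (g : R -> R -> R) (u v : R) :
  continuity_2d_pt g u v -> continuous (g u) v.
Proof.
rewrite continuity_2d_pt_filterlim; intros H.
apply (continuous_comp_2 (fun _ : R => u) (fun y : R => y) g);
  [apply continuous_const|apply continuous_id|exact H].
Qed.

Section RealParam.
Context (D : R -> R -> Prop) (SD : star_open D) (g : R -> R -> R).
Hypothesis Hg : forall u v, D u v -> continuity_2d_pt g u v.

Lemma star_slice (u v r : R) :
  D u v -> (Rmin 0 v <= r <= Rmax 0 v)%R -> D u r.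
Proof. intros H Hr; apply (star_rectangle D SD u v u r H); [apply between_end|exact Hr]. Qed.

Lemma star_ex_RInt (u v : R) : D u v -> ex_RInt (g u) 0 v.
Proof.
intros H; apply (ex_RInt_continuous (V := R_CompleteNormedModule)).
intros r Hr; apply continuity_2d_slice, Hg, (star_slice u v); assumption.
Qed.

(** On the compact slice [0,v0] the integrand varies little with u, uniformly; the
    change of the upper bound costs at most |v - v0| times a local bound of g. *)
Lemma continuity_RInt_param (u0 v0 : R) :
  D u0 v0 -> continuity_2d_pt (fun u v => RInt (g u) 0 v) u0 v0.
Proof.
intros H0 eps.
assert (He := cond_pos eps).
assert (HA : (0 <= Rabs v0)%R) by apply Rabs_pos.
assert (He1 : (0 < eps / (2 * (Rabs v0 + 1)))%R) by (apply Rdiv_lt_0_compat; lra).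
destruct (uniform_continuity_2d_1d' g (Rmin 0 v0) (Rmax 0 v0) u0) with
  (eps := mkposreal _ He1) as [d1 U1].
{ intros r Hr; apply Hg, (star_slice u0 v0); assumption. }
destruct (star_locally D SD u0 v0 H0) as [d2 U2].
destruct (Hg u0 v0 H0 (mkposreal _ Rlt_0_1)) as [d3 U3].
set (M := (Rabs (g u0 v0) + 1)%R).
assert (HM : (0 < M)%R) by (unfold M; generalize (Rabs_pos (g u0 v0)); lra).
assert (Hd4 : (0 < eps / (2 * M))%R) by (apply Rdiv_lt_0_compat; lra).
set (d := Rmin (Rmin d1 d2) (Rmin d3 (eps / (2 * M)))).
assert (Hd : (0 < d)%R).
{ unfold d; repeat apply Rmin_pos; try apply cond_pos; exact Hd4. }
assert (L1 : (d <= d1)%R) by (unfold d; eapply Rle_trans; [apply Rmin_l|apply Rmin_l]).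
assert (L2 : (d <= d2)%R) by (unfold d; eapply Rle_trans; [apply Rmin_l|apply Rmin_r]).
assert (L3 : (d <= d3)%R) by (unfold d; eapply Rle_trans; [apply Rmin_r|apply Rmin_l]).
assert (L4 : (d <= eps / (2 * M))%R) by (unfold d; eapply Rle_trans; [apply Rmin_r|apply Rmin_r]).
exists (mkposreal _ Hd); simpl; intros u v Hu Hv.
assert (Dv0 : D u v0).
{ apply U2; [lra|]. rewrite Rminus_diag, Rabs_R0; apply cond_pos. }
assert (Dv : D u v) by (apply U2; lra).
assert (I1 := star_ex_RInt u v0 Dv0).
assert (I2 : ex_RInt (g u) v0 v).
{ apply ex_RInt_Chasles with 0%R; [apply ex_RInt_swap; exact I1|apply star_ex_RInt; exact Dv]. }
assert (I0 := star_ex_RInt u0 v0 H0).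
rewrite <- (RInt_Chasles (V := R_CompleteNormedModule) (g u) 0 v0 v I1 I2).
assert (B1 : (Rabs (RInt (g u) 0 v0 - RInt (g u0) 0 v0)
             <= Rabs v0 * (eps / (2 * (Rabs v0 + 1))))%R).
{ replace (Rabs v0) with (Rabs (v0 - 0)) at 1 by (f_equal; ring).
  apply (norm_RInt_le_const_abs (V := R_NormedModule) (fun r => g u r - g u0 r)%R 0 v0).
  - intros r Hr. apply Rlt_le.
    apply (U1 r u0 r u); try assumption;
    try (generalize (cond_pos d1); lra).
    + apply Rabs_def2 in Hu; lra.
    + rewrite Rminus_diag, Rabs_R0; apply cond_pos.
  - apply (is_RInt_minus (V := R_NormedModule));
    apply (RInt_correct (V := R_CompleteNormedModule)); assumption. }
assert (B2 : (Rabs (RInt (g u) v0 v) <= Rabs (v - v0) * M)%R).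
{ apply (norm_RInt_le_const_abs (V := R_NormedModule) (g u) v0 v).
  - intros r Hr. specialize (U3 u r ltac:(lra)).
    assert (Hr' : (Rabs (r - v0) < d3)%R).
    { apply Rle_lt_trans with (Rabs (v - v0)); [|lra].
      unfold Rmin, Rmax in Hr; destruct (Rle_dec v0 v);
      unfold Rabs; repeat destruct Rcase_abs; lra. }
    specialize (U3 Hr'); simpl in U3; unfold M.
    change (Rabs (g u r) <= Rabs (g u0 v0) + 1)%R.
    assert (T := Rabs_triang_inv (g u r) (g u0 v0)); lra.
  - apply (RInt_correct (V := R_CompleteNormedModule)); exact I2. }
assert (B3 : (Rabs v0 * (eps / (2 * (Rabs v0 + 1))) < eps / 2)%R).
{ apply Rmult_lt_reg_r with (2 * (Rabs v0 + 1))%R; [lra|].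
  field_simplify; lra. }
assert (B4 : (Rabs (v - v0) * M < eps / 2)%R).
{ apply Rlt_le_trans with (eps / (2 * M) * M)%R.
  - apply Rmult_lt_compat_r; lra.
  - right; field; lra. }
change (plus (RInt (g u) 0 v0) (RInt (g u) v0 v)) with (RInt (g u) 0 v0 + RInt (g u) v0 v)%R.
replace (RInt (g u) 0 v0 + RInt (g u) v0 v - RInt (g u0) 0 v0)%R
  with ((RInt (g u) 0 v0 - RInt (g u0) 0 v0) + RInt (g u) v0 v)%R by ring.
eapply Rle_lt_trans; [apply Rabs_triang|]; lra.
Qed.

Lemma is_derive_RInt_star (g1 : R -> R -> R) (u v : R) :
  (forall u v, D u v -> continuity_2d_pt g1 u v) ->
  (forall u v, D u v -> is_derive (fun y => g y v) u (g1 u v)) ->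
  D u v ->
  is_derive (fun y => RInt (g y) 0 v) u (RInt (g1 u) 0 v).
Proof.
intros Hg1 Hd H0.
assert (HL : locally u (fun y => D y v)).
{ destruct (star_locally D SD u v H0) as [d Ud]; exists d; intros y Hy.
  apply Ud; [exact Hy|rewrite Rminus_diag, Rabs_R0; apply cond_pos]. }
assert (E : RInt (fun t => Derive (fun z => g z t) u) 0 v = RInt (g1 u) 0 v).
{ apply (RInt_ext (V := R_CompleteNormedModule)); intros t Ht.
  apply is_derive_unique, Hd, (star_slice u v); [exact H0|lra]. }
rewrite <- E; apply is_derive_RInt_param.
- revert HL; apply filter_imp; intros y Dy t Ht.
  exists (g1 y t); apply Hd, (star_slice y v); assumption.
- intros t Ht; assert (Dt := star_slice u v t H0 Ht).
  apply (continuity_2d_pt_ext_loc g1); [|apply Hg1; exact Dt].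
  destruct (star_locally D SD u t Dt) as [d Ud]; exists d; intros y z Hy Hz.
  symmetry; apply is_derive_unique, Hd, Ud; assumption.
- revert HL; apply filter_imp; intros y Dy; apply star_ex_RInt; exact Dy.
Qed.
End RealParam.

Lemma ccont2_ext_loc (F G : R -> R -> C) (u v : R) :
  locally_2d (fun x y => F x y = G x y) u v -> ccont2 F u v -> ccont2 G u v.
Proof.
intros [d Hd]; rewrite !ccont2_components; intros [H1 H2]; split.
- apply continuity_2d_pt_ext_loc with (2 := H1); exists d; intros x y Hx Hy;
  rewrite (Hd x y Hx Hy); reflexivity.
- apply continuity_2d_pt_ext_loc with (2 := H2); exists d; intros x y Hx Hy;
  rewrite (Hd x y Hx Hy); reflexivity.
Qed.

Section Param.
Context (D : R -> R -> Prop) (SD : star_open D).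

Lemma ccont2_slice (F : R -> R -> C) (u v : R) : ccont2 F u v -> ccont (F u) v.
Proof.
intros H; apply (continuous_comp_2 (fun _ : R => u) (fun y : R => y) F);
  [apply continuous_const|apply continuous_id|exact H].
Qed.

Lemma ccont2_slice_l (F : R -> R -> C) (u v : R) :
  ccont2 F u v -> ccont (fun y => F y v) u.
Proof.
intros H; apply (continuous_comp_2 (fun y : R => y) (fun _ : R => v) F);
  [apply continuous_id|apply continuous_const|exact H].
Qed.

Lemma cRInt_star (G : R -> R -> C) (u v : R) :
  (forall u v, D u v -> ccont2 G u v) -> D u v ->
  cRInt (G u) 0 v (CInt (G u) 0 v).
Proof.
intros HG H; apply cRInt_correct; intros r Hr; apply ccont2_slice, HG.
apply (star_slice D SD u v); assumption.
Qed.

Lemma CInt_star_components (G : R -> R -> C) (u v : R) :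
  (forall u v, D u v -> ccont2 G u v) -> D u v ->
  fst (CInt (G u) 0 v) = RInt (fun r => fst (G u r)) 0 v /\
  snd (CInt (G u) 0 v) = RInt (fun r => snd (G u r)) 0 v.
Proof.
intros HG H; generalize (cRInt_star G u v HG H); rewrite cRInt_components.
intros [H1 H2]; split; symmetry; apply (is_RInt_unique (V := R_CompleteNormedModule)); assumption.
Qed.

Lemma ccont2_CInt_param (G : R -> R -> C) (u v : R) :
  (forall u v, D u v -> ccont2 G u v) -> D u v ->
  ccont2 (fun u v => CInt (G u) 0 v) u v.
Proof.
intros HG H; apply ccont2_components.
destruct (star_locally D SD u v H) as [d Hd].
split.
- apply (continuity_2d_pt_ext_loc (fun u v => RInt (fun r => fst (G u r)) 0 v)).
  + exists d; intros y z Hy Hz; symmetry; apply CInt_star_components; auto.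
  + apply (continuity_RInt_param D SD (fun x y => fst (G x y))); [|exact H].
    intros; apply ccont2_components, HG; assumption.
- apply (continuity_2d_pt_ext_loc (fun u v => RInt (fun r => snd (G u r)) 0 v)).
  + exists d; intros y z Hy Hz; symmetry; apply CInt_star_components; auto.
  + apply (continuity_RInt_param D SD (fun x y => snd (G x y))); [|exact H].
    intros; apply ccont2_components, HG; assumption.
Qed.

Lemma cder_CInt_param (G G1 : R -> R -> C) (u v : R) :
  (forall u v, D u v -> ccont2 G u v) ->
  (forall u v, D u v -> ccont2 G1 u v) ->
  (forall u v, D u v -> cder (fun y => G y v) u (G1 u v)) ->
  D u v ->
  cder (fun y => CInt (G y) 0 v) u (CInt (G1 u) 0 v).
Proof.
intros HG HG1 Hd H; apply cder_components.
assert (HL : locally u (fun y => D y v)).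
{ destruct (star_locally D SD u v H) as [d Ud]; exists d; intros y Hy.
  apply Ud; [exact Hy|rewrite Rminus_diag, Rabs_R0; apply cond_pos]. }
destruct (CInt_star_components G1 u v HG1 H) as [-> ->]; split.
- apply (is_derive_ext_loc (fun y => RInt (fun r => fst (G y r)) 0 v)).
  { revert HL; apply filter_imp; intros y Dy; symmetry; apply CInt_star_components; assumption. }
  apply (is_derive_RInt_star D SD (fun x y => fst (G x y))) with
    (g1 := fun x y => fst (G1 x y)); try exact H; intros.
  + apply ccont2_components, HG; assumption.
  + apply ccont2_components, HG1; assumption.
  + apply (cder_components (fun y => G y v0)), Hd; assumption.
- apply (is_derive_ext_loc (fun y => RInt (fun r => snd (G y r)) 0 v)).
  { revert HL; apply filter_imp; intros y Dy; symmetry; apply CInt_star_components; assumption. }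
  apply (is_derive_RInt_star D SD (fun x y => snd (G x y))) with
    (g1 := fun x y => snd (G1 x y)); try exact H; intros.
  + apply ccont2_components, HG; assumption.
  + apply ccont2_components, HG1; assumption.
  + apply (cder_components (fun y => G y v0)), Hd; assumption.
Qed.

(** Chain rule along u + v = 0, the line x = 0. *)
Lemma cder_antidiagonal (F F1 F2 : R -> R -> C) (t : R) :
  (forall u v, D u v -> ccont2 F1 u v) ->
  (forall u v, D u v -> cder (fun y => F y v) u (F1 u v)) ->
  (forall u v, D u v -> cder (F u) v (F2 u v)) ->
  D (t / 2)%R (- t / 2)%R ->
  cder (fun s => F (s / 2) (- s / 2))%R t
    (/ 2 * (F1 (t / 2)%R (- t / 2)%R - F2 (t / 2)%R (- t / 2)%R)).
Proof.
intros H1 Hd1 Hd2 H0.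
assert (HL : locally (t / 2, - t / 2)%R (fun p : R * R => D (fst p) (snd p))).
{ apply locally_2d_locally; exact (star_locally D SD _ _ H0). }
apply cder_components.
assert (P1 : is_derive (fun s : R => s / 2)%R t (/ 2)%R) by (auto_derive; [trivial|field]).
assert (P2 : is_derive (fun s : R => - s / 2)%R t (- / 2)%R) by (auto_derive; [trivial|field]).
assert (R : forall (g g1 g2 : R -> R -> R),
  (forall u v, D u v -> continuity_2d_pt g1 u v) ->
  (forall u v, D u v -> is_derive (fun y => g y v) u (g1 u v)) ->
  (forall u v, D u v -> is_derive (g u) v (g2 u v)) ->
  is_derive (fun s => g (s / 2) (- s / 2))%R t
    (/ 2 * (g1 (t / 2) (- t / 2) - g2 (t / 2) (- t / 2)))%R).
{ intros g g1 g2 C1 G1 G2.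
  assert (FD := is_derive_filterdiff g (t / 2)%R (- t / 2)%R g1 (g2 (t / 2)%R (- t / 2)%R)).
  specialize (FD ltac:(revert HL; apply filter_imp; intros [x y]; apply G1)
     (G2 _ _ H0) ltac:(apply continuity_2d_pt_filterlim, C1; exact H0)).
  eapply filterdiff_ext_lin.
  - apply (filterdiff_comp'_2 (fun s : R => s / 2)%R (fun s : R => - s / 2)%R g t _ _
        (fun a b => plus (scal a (g1 (t/2) (-t/2)))%R (scal b (g2 (t/2) (-t/2))%R)) P1 P2 FD).
  - intros y; simpl; unfold scal, plus; simpl; unfold mult; simpl; ring. }
split.
- eapply is_derive_eq; [apply (R (fun x y => fst (F x y)) (fun x y => fst (F1 x y)) (fun x y => fst (F2 x y)))|].
  + intros; apply ccont2_components, H1; assumption.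
  + intros; apply (cder_components (fun y => F y v)), Hd1; assumption.
  + intros; apply (cder_components (F u)), Hd2; assumption.
  + simpl; field.
- eapply is_derive_eq; [apply (R (fun x y => snd (F x y)) (fun x y => snd (F1 x y)) (fun x y => snd (F2 x y)))|].
  + intros; apply ccont2_components, H1; assumption.
  + intros; apply (cder_components (fun y => F y v)), Hd1; assumption.
  + intros; apply (cder_components (F u)), Hd2; assumption.
  + simpl; field.
Qed.
End Param.

(** * The Goursat problem and its stability *)

(** By uniform continuity g varies by less than 1 between consecutive points of a fine
    enough subdivision of the segment from the corner (a,c), with a number of points that
    works for all end points. *)
Lemma continuity_2d_bounded (g : R -> R -> R) (a b c d : R) :
  (a <= b)%R -> (c <= d)%R ->
  (forall x y, (a <= x <= b)%R -> (c <= y <= d)%R -> continuity_2d_pt g x y) ->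
  exists N, forall x y, (a <= x <= b)%R -> (c <= y <= d)%R -> (Rabs (g x y) <= N)%R.
Proof.
intros Hab Hcd Hg.
destruct (uniform_continuity_2d g a b c d Hg (mkposreal _ Rlt_0_1)) as [e He].
assert (Hpe := cond_pos e).
set (L := (b - a + (d - c))%R).
assert (HL : (0 <= L)%R) by (unfold L; lra).
destruct (nfloor_ex (L / e)) as [n [_ Hn]].
{ apply Rmult_le_pos; [exact HL|apply Rlt_le, Rinv_0_lt_compat; exact Hpe]. }
set (m := S n); assert (Hm : (0 < INR m)%R) by (apply lt_0_INR; unfold m; lia).
assert (HLm : (L / INR m < e)%R).
{ apply Rmult_lt_reg_r with (INR m); [exact Hm|].
  replace (L / INR m * INR m)%R with L by (field; lra).
  unfold m; rewrite S_INR.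
  apply Rmult_lt_compat_r with (r := e) in Hn; [|exact Hpe].
  replace (L / e * e)%R with L in Hn by (field; lra). lra. }
exists (Rabs (g a c) + INR m)%R; intros x y Hx Hy.
assert (St : forall i, (i <= m)%nat ->
  (Rabs (g (a + INR i / INR m * (x - a)) (c + INR i / INR m * (y - c)))
     <= Rabs (g a c) + INR i)%R).
{ induction i as [|i IH]; intros Hi.
  - simpl; unfold Rdiv; rewrite !Rmult_0_l, !Rplus_0_r; lra.
  - specialize (IH ltac:(lia)).
    assert (T1 : forall j, (j <= m)%nat -> (0 <= INR j / INR m <= 1)%R).
    { intros j Hj; split.
      - apply Rmult_le_pos; [apply pos_INR|apply Rlt_le, Rinv_0_lt_compat; exact Hm].
      - apply Rmult_le_reg_r with (INR m); [exact Hm|].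
        replace (INR j / INR m * INR m)%R with (INR j) by (field; lra).
        rewrite Rmult_1_l; apply le_INR; exact Hj. }
    assert (A := T1 i ltac:(lia)); assert (B := T1 (S i) Hi).
    assert (ES : (INR (S i) / INR m = INR i / INR m + / INR m)%R)
      by (rewrite S_INR; field; lra).
    assert (Hi0 : (0 < / INR m)%R) by (apply Rinv_0_lt_compat; exact Hm).
    assert (D1 : (/ INR m * (x - a) < e)%R).
    { apply Rle_lt_trans with (2 := HLm); unfold Rdiv; rewrite Rmult_comm.
      apply Rmult_le_compat_r; [lra|unfold L; lra]. }
    assert (D2 : (/ INR m * (y - c) < e)%R).
    { apply Rle_lt_trans with (2 := HLm); unfold Rdiv; rewrite Rmult_comm.
      apply Rmult_le_compat_r; [lra|unfold L; lra]. }
    assert (U := He (a + INR i / INR m * (x - a))%R (c + INR i / INR m * (y - c))%R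
                    (a + INR (S i) / INR m * (x - a))%R (c + INR (S i) / INR m * (y - c))%R).
    assert (V : (Rabs (g (a + INR (S i) / INR m * (x - a)) (c + INR (S i) / INR m * (y - c)) -
       g (a + INR i / INR m * (x - a)) (c + INR i / INR m * (y - c))) < 1)%R).
    { apply U; try nra.
      - rewrite ES; match goal with |- (Rabs ?z < _)%R => replace z with (/ INR m * (x - a))%R by ring end.
        rewrite Rabs_pos_eq; [exact D1|nra].
      - rewrite ES; match goal with |- (Rabs ?z < _)%R => replace z with (/ INR m * (y - c))%R by ring end.
        rewrite Rabs_pos_eq; [exact D2|nra]. }
    assert (W := Rabs_triang_inv (g (a + INR (S i) / INR m * (x - a)) (c + INR (S i) / INR m * (y - c)))%R
       (g (a + INR i / INR m * (x - a)) (c + INR i / INR m * (y - c)))%R).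
    rewrite (S_INR i) at 3; lra. }
specialize (St m (le_n _)).
replace (INR m / INR m)%R with 1%R in St by (field; lra).
replace (a + 1 * (x - a))%R with x in St by ring.
replace (c + 1 * (y - c))%R with y in St by ring. exact St.
Qed.

Lemma ccont2_bounded (F : R -> R -> C) (a b c d : R) :
  (a <= b)%R -> (c <= d)%R ->
  (forall x y, (a <= x <= b)%R -> (c <= y <= d)%R -> ccont2 F x y) ->
  exists N, forall x y, (a <= x <= b)%R -> (c <= y <= d)%R -> (Cmod (F x y) <= N)%R.
Proof.
intros Hab Hcd HF.
destruct (continuity_2d_bounded (fun x y => fst (F x y)) a b c d Hab Hcd) as [N1 H1].
{ intros; apply ccont2_components, HF; assumption. }
destruct (continuity_2d_bounded (fun x y => snd (F x y)) a b c d Hab Hcd) as [N2 H2].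
{ intros; apply ccont2_components, HF; assumption. }
exists (sqrt 2 * Rmax N1 N2)%R; intros x y Hx Hy.
eapply Rle_trans; [apply Cmod_2Rmax|].
apply Rmult_le_compat_l; [apply sqrt_pos|].
assert (A1 := H1 x y Hx Hy); assert (A2 := H2 x y Hx Hy).
apply Rmax_lub; (eapply Rle_trans; [eassumption|]); [apply Rmax_l|apply Rmax_r].
Qed.

(** The differential form of the problem, with the derivatives in the order v, then u; the
    boundary values are kept separate. *)
Record goursat_on (D : R -> R -> Prop) (q : R -> C) (W Wv : R -> R -> C) : Prop := {
  goursat_cont : forall u v, D u v -> ccont2 W u v;
  goursat_dv : forall u v, D u v -> cder (W u) v (Wv u v);
  goursat_duv : forall u v, D u v ->
    cder (fun y => Wv y v) u (q (u + v)%R * W u v) }.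

Lemma ccont2_swap (F : R -> R -> C) (u v : R) :
  ccont2 F u v -> ccont2 (fun x y => F y x) v u.
Proof.
intros H.
apply (continuous_comp_2 (U := prod_UniformSpace R_UniformSpace R_UniformSpace)
  (fun p : R * R => snd p) (fun p : R * R => fst p) F (v, u));
  [apply continuous_snd|apply continuous_fst|exact H].
Qed.

Lemma star_open_swap (D : R -> R -> Prop) :
  star_open D -> star_open (fun x y => D y x).
Proof.
intros [H1 H2]; split.
- intros u v H; destruct (H1 _ _ H) as [d Hd]; exists d; auto.
- intros u v s r H Hs Hr; apply (H2 v u r s); assumption.
Qed.

Lemma ccont2_sum_arg (q : R -> C) (u v : R) :
  ccont q (u + v)%R -> ccont2 (fun x y => q (x + y)%R) u v.
Proof.
intros H.
apply (continuous_comp (U := prod_UniformSpace R_UniformSpace R_UniformSpace)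
  (V := R_UniformSpace) (W := C_UniformSpace) (fun p : R * R => (fst p + snd p)%R) q).
- apply (continuous_plus (V := R_NormedModule));
  [apply continuous_fst|apply continuous_snd].
- exact H.
Qed.

Section Goursat.
Context (D : R -> R -> Prop) (SD : star_open D) (q : R -> C).
Hypothesis Hq : forall u v, D u v -> ccont q (u + v)%R.
Context (W Wv : R -> R -> C) (GW : goursat_on D q W Wv).

Lemma goursat_rhs_cont (u v : R) :
  D u v -> ccont2 (fun u v => q (u + v)%R * W u v) u v.
Proof.
intros H; apply continuous_Cmult.
- apply (ccont2_sum_arg q); apply Hq; exact H.
- apply (goursat_cont _ _ _ _ GW); exact H.
Qed.

Definition goursat_inner (u r : R) : C := CInt (fun s => q (s + r)%R * W s r) 0 u.

Lemma goursat_inner_cont (u v : R) : D u v -> ccont2 goursat_inner u v.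
Proof.
intros H; apply (ccont2_swap (fun r u => goursat_inner u r)).
apply (ccont2_CInt_param _ (star_open_swap D SD) (fun r s => q (s + r)%R * W s r)).
- intros x y Hxy; apply (ccont2_swap (fun u v => q (u + v)%R * W u v)).
  apply goursat_rhs_cont; exact Hxy.
- exact H.
Qed.

Lemma goursat_inner_correct (u v : R) : D u v ->
  cRInt (fun s => q (s + v)%R * W s v) 0 u (goursat_inner u v).
Proof.
intros H; apply (cRInt_star _ (star_open_swap D SD) (fun r s => q (s + r)%R * W s r)); [|exact H].
intros x y Hxy; apply (ccont2_swap (fun u v => q (u + v)%R * W u v)).
apply goursat_rhs_cont; exact Hxy.
Qed.

Lemma goursat_inner_eq (u v : R) : D u v -> Wv u v - Wv 0%R v = goursat_inner u v.
Proof.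
intros H; symmetry; apply cRInt_unique.
apply (cRInt_derive (fun y => Wv y v)).
- intros x Hx; apply (goursat_duv _ _ _ _ GW).
  apply (star_rectangle D SD u v); [exact H|exact Hx|apply between_end].
- intros x Hx; apply (ccont2_slice_l (fun s v => q (s + v)%R * W s v)), goursat_rhs_cont.
  apply (star_rectangle D SD u v); [exact H|exact Hx|apply between_end].
Qed.

(** The derivative in v of W(u,v) - W(0,v) is Wv(u,v) - Wv(0,v), the integral of q W over
    [0,u], which is continuous even if Wv(0,v) is not. *)
Lemma goursat_integral (u v : R) : D u v ->
  cRInt (goursat_inner u) 0 v (W u v - W 0%R v - (W u 0%R - W 0%R 0%R)).
Proof.
intros H; apply (cRInt_derive (fun y => W u y - W 0%R y)).
- intros r Hr.
  assert (Hu : D u r) by (apply (star_rectangle D SD u v); [exact H|apply between_end|exact Hr]).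
  assert (H0 : D 0%R r) by (apply (star_rectangle D SD u v); [exact H|apply between_0|exact Hr]).
  rewrite <- goursat_inner_eq by exact Hu.
  apply cder_minus; apply (goursat_dv _ _ _ _ GW); assumption.
- intros r Hr; apply (ccont2_slice goursat_inner), goursat_inner_cont.
  apply (star_rectangle D SD u v); [exact H|apply between_end|exact Hr].
Qed.
End Goursat.

Lemma cRInt_exp_bound (J : R -> C) (v : R) (l : C) (c lam : R) :
  (0 <= c)%R -> (0 < lam)%R -> cRInt J 0 v l ->
  (forall r, (Rmin 0 v <= r <= Rmax 0 v)%R -> (Cmod (J r) <= c * exp (lam * Rabs r))%R) ->
  (Cmod l <= c / lam * exp (lam * Rabs v))%R.
Proof.
intros Hc Hlam HI HJ.
assert (Hcl : (0 <= c / lam)%R).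
{ apply Rmult_le_pos; [exact Hc|apply Rlt_le, Rinv_0_lt_compat; exact Hlam]. }
destruct (Rle_dec 0 v) as [Hv|Hv].
- rewrite Rmin_left, Rmax_right in HJ by exact Hv; rewrite Rabs_pos_eq by exact Hv.
  apply Rle_trans with (c / lam * exp (lam * v) - c / lam * exp (lam * 0))%R.
  + apply (cRInt_norm_le J (fun r => c * exp (lam * r))%R 0 v l); try assumption.
    * intros x Hx; generalize (HJ x Hx); rewrite Rabs_pos_eq by lra; trivial.
    * apply (is_RInt_derive (V := R_CompleteNormedModule) (fun r => c / lam * exp (lam * r))%R).
      -- intros x _; auto_derive; [trivial|field; lra].
      -- intros x _; apply (ex_derive_continuous (V := R_NormedModule)); auto_derive; trivial.
  + rewrite Rmult_0_r, exp_0; lra.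
- assert (Hv' : (v <= 0)%R) by lra.
  rewrite Rmin_right, Rmax_left in HJ by exact Hv'; rewrite (Rabs_left1 v) by exact Hv'.
  rewrite <- Cmod_opp.
  apply Rle_trans with ((- (c / lam)) * exp (- lam * 0) - (- (c / lam)) * exp (- lam * v))%R.
  + apply (cRInt_norm_le J (fun r => c * exp (- lam * r))%R v 0 (- l)); try assumption.
    * intros x Hx; generalize (HJ x Hx); rewrite (Rabs_left1 x) by lra.
      replace (lam * - x)%R with (- lam * x)%R by ring; trivial.
    * apply (is_RInt_swap (V := C_R_NormedModule)); exact HI.
    * apply (is_RInt_derive (V := R_CompleteNormedModule) (fun r => - (c / lam) * exp (- lam * r))%R).
      -- intros x _; auto_derive; [trivial|field; lra].
      -- intros x _; apply (ex_derive_continuous (V := R_NormedModule)); auto_derive; trivial.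
  + rewrite Rmult_0_r, exp_0. replace (- lam * v)%R with (lam * - v)%R by ring. lra.
Qed.

Lemma Cmod_minus_le (a c : C) : (Cmod (a - c) <= Cmod a + Cmod c)%R.
Proof. unfold Cminus; eapply Rle_trans; [apply Cmod_triangle|rewrite Cmod_opp; lra]. Qed.

(** Continuous dependence on the data, by a weighted norm.  If |W| <= L e^(lam (|u|+|v|))
    on a rectangle, the integral equation gives
    |W| <= 3 M + (L/2) e^(lam (|u|+|v|)), as two integrations of the exponential gain
    1/lam^2 and |q| <= lam^2/2.  Starting from any bound N of |W| on the rectangle and
    iterating, L decreases to 6 M; the resulting bound does not depend on N. *)
Lemma goursat_stability (D : R -> R -> Prop) (q : R -> C) (W Wv : R -> R -> C)
    (lam M : R) :
  star_open D -> (forall u v, D u v -> ccont q (u + v)%R) ->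
  goursat_on D q W Wv ->
  (0 < lam)%R ->
  (forall u v, D u v -> (Cmod (q (u + v)%R) <= lam * lam / 2)%R) ->
  (forall u v, D u v -> (Cmod (W u 0%R) <= M)%R /\ (Cmod (W 0%R v) <= M)%R) ->
  forall u v, D u v -> (Cmod (W u v) <= 6 * M * exp (lam * (Rabs u + Rabs v)))%R.
Proof.
intros SD Hq GW Hlam HQ HM u0 v0 H0.
assert (M0 : (0 <= M)%R).
{ apply Rle_trans with (1 := Cmod_ge_0 (W u0 0%R)), (HM u0 v0 H0). }
assert (SR : forall s r, (Rmin 0 u0 <= s <= Rmax 0 u0)%R -> (Rmin 0 v0 <= r <= Rmax 0 v0)%R -> D s r).
{ intros s r Hs Hr; apply (star_rectangle D SD u0 v0); assumption. }
destruct (ccont2_bounded W (Rmin 0 u0) (Rmax 0 u0) (Rmin 0 v0) (Rmax 0 v0)) as [N HN].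
{ apply Rle_trans with 0%R; apply between_0. }
{ apply Rle_trans with 0%R; apply between_0. }
{ intros; apply (goursat_cont _ _ _ _ GW), SR; assumption. }
assert (N0 : (0 <= N)%R).
{ apply Rle_trans with (1 := Cmod_ge_0 (W 0%R 0%R)); apply HN; apply between_0. }
assert (Iter : forall k s r, (Rmin 0 u0 <= s <= Rmax 0 u0)%R ->
   (Rmin 0 v0 <= r <= Rmax 0 v0)%R ->
   (Cmod (W s r) <= (6 * M + N * (/ 2) ^ k) * exp (lam * (Rabs s + Rabs r)))%R).
{ assert (E1 : forall z, (0 <= z)%R -> (1 <= exp (lam * z))%R).
  { intros z Hz; rewrite <- exp_0;
    destruct (Rle_lt_or_eq_dec 0 (lam * z)) as [P|P]; [nra|apply Rlt_le, exp_increasing, P|rewrite <- P; lra]. }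
  induction k as [|k IH]; intros s r Hs Hr.
  - simpl; specialize (E1 (Rabs s + Rabs r)%R ltac:(generalize (Rabs_pos s), (Rabs_pos r); lra)).
    specialize (HN s r Hs Hr); nra.
  - assert (Hsr := SR s r Hs Hr).
    assert (HI := goursat_integral D SD q Hq W Wv GW s r Hsr).
    set (L := (6 * M + N * (/ 2) ^ k)%R) in *.
    assert (L0 : (0 <= L)%R).
    { unfold L; assert (0 <= (/ 2) ^ k)%R by (apply pow_le; lra); nra. }
    assert (B : (Cmod (W s r - W 0%R r - (W s 0%R - W 0%R 0%R))
       <= (L * (lam / 2) * exp (lam * Rabs s)) / lam * exp (lam * Rabs r))%R).
    { assert (Es := exp_pos (lam * Rabs s)).
      apply (cRInt_exp_bound _ _ _ _ _) with (3 := HI); [|exact Hlam|].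
      { apply Rmult_le_pos; [nra|lra]. }
      intros r' Hr'.
      assert (Hsr' : D s r') by (apply (star_rectangle D SD s r s r' Hsr); [apply between_end|exact Hr']).
      assert (Hr2 : (Rmin 0 v0 <= r' <= Rmax 0 v0)%R).
      { clear -Hr Hr'; unfold Rmin, Rmax in *; destruct (Rle_dec 0 v0), (Rle_dec 0 r); lra. }
      assert (HI' := goursat_inner_correct D SD q Hq W Wv GW s r' Hsr').
      replace (L * (lam / 2) * exp (lam * Rabs s) * exp (lam * Rabs r'))%R
        with ((L * (lam * lam / 2) * exp (lam * Rabs r')) / lam * exp (lam * Rabs s))%R
        by (field; lra).
      assert (Er := exp_pos (lam * Rabs r')).
      apply (cRInt_exp_bound _ _ _ _ _) with (3 := HI'); [|exact Hlam|].
      { apply Rmult_le_pos; [|lra]; apply Rmult_le_pos; nra. }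
      intros s' Hs'.
      assert (Hs2 : (Rmin 0 u0 <= s' <= Rmax 0 u0)%R).
      { clear -Hs Hs'; unfold Rmin, Rmax in *; destruct (Rle_dec 0 u0), (Rle_dec 0 s); lra. }
      rewrite Cmod_mult.
      specialize (IH s' r' Hs2 Hr2).
      rewrite Rmult_plus_distr_l, exp_plus in IH.
      replace (L * (lam * lam / 2) * exp (lam * Rabs r') * exp (lam * Rabs s'))%R
        with ((lam * lam / 2) * (L * (exp (lam * Rabs s') * exp (lam * Rabs r'))))%R by ring.
      apply Rmult_le_compat; try apply Cmod_ge_0; [apply HQ, SR; assumption|exact IH]. }
    assert (E : W s r = (W s r - W 0%R r - (W s 0%R - W 0%R 0%R)) + (W 0%R r + (W s 0%R - W 0%R 0%R)))
      by ring.
    rewrite E.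
    eapply Rle_trans; [apply Cmod_triangle|].
    assert (B2 : (Cmod (W 0%R r + (W s 0%R - W 0%R 0%R)) <= 3 * M)%R).
    { eapply Rle_trans; [apply Cmod_triangle|].
      assert (T := Cmod_minus_le (W s 0%R) (W 0%R 0%R)).
      destruct (HM s r Hsr) as [X1 X2].
      destruct (HM 0%R 0%R) as [X3 _]; [apply SR; apply between_0|].
      lra. }
    specialize (E1 (Rabs s + Rabs r)%R ltac:(generalize (Rabs_pos s), (Rabs_pos r); lra)).
    replace (L * (lam / 2) * exp (lam * Rabs s) / lam * exp (lam * Rabs r))%R
      with (L / 2 * exp (lam * (Rabs s + Rabs r)))%R in B
      by (rewrite Rmult_plus_distr_l, exp_plus; field; lra).
    replace (6 * M + N * (/ 2) ^ S k)%R with (3 * M + L / 2)%R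
      by (unfold L; simpl; field).
    nra. }
apply Rnot_lt_le; intros Hlt.
set (e := exp (lam * (Rabs u0 + Rabs v0))) in *.
assert (He : (0 < e)%R) by apply exp_pos.
set (g := (Cmod (W u0 v0) - 6 * M * e)%R).
assert (Hg : (0 < g / (N * e + 1))%R).
{ apply Rdiv_lt_0_compat; [unfold g; lra|nra]. }
destruct (pow_lt_1_zero (/ 2) ltac:(rewrite Rabs_pos_eq; lra) _ Hg) as [k Hk].
specialize (Hk k (le_n _)); rewrite Rabs_pos_eq in Hk by (apply pow_le; lra).
specialize (Iter k u0 v0 (between_end _) (between_end _)); fold e in Iter.
assert (N * e * (/ 2) ^ k < g)%R.
{ apply Rle_lt_trans with ((N * e) * (g / (N * e + 1)))%R.
  - apply Rmult_le_compat_l; [nra|lra].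
  - apply Rmult_lt_reg_r with (N * e + 1)%R; [nra|].
    replace (N * e * (g / (N * e + 1)) * (N * e + 1))%R with (N * e * g)%R by (field; nra).
    assert (0 < g)%R by (unfold g; lra). nra. }
unfold g in *; nra.
Qed.

(** * Wave polynomials *)

Lemma Csum_00 (a : nat -> C) : Csum a 0 0 = a 0%nat.
Proof. apply sum_n_n. Qed.

Lemma Csum_0S (a : nat -> C) (n : nat) : Csum a 0 (S n) = Csum a 0 n + a (S n).
Proof. apply (sum_n_Sm a 0 n); lia. Qed.

Lemma Csum_head (a : nat -> C) (n : nat) :
  Csum a 0 (S n) = a 0%nat + Csum (fun k => a (S k)) 0 n.
Proof.
unfold Csum; rewrite sum_Sn_m by lia; rewrite sum_n_m_S; reflexivity.
Qed.

Lemma Csum_1 (a : nat -> C) (n : nat) : a 0%nat + Csum a 1 n = Csum a 0 n.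
Proof. unfold Csum; rewrite (sum_Sn_m a 0 n) by lia; reflexivity. Qed.

Lemma Csum_ext (a a' : nat -> C) (n : nat) :
  (forall k, (k <= n)%nat -> a k = a' k) -> Csum a 0 n = Csum a' 0 n.
Proof. intros H; apply sum_n_m_ext_loc; intros k [_ Hk]; auto. Qed.

Lemma Csum_mult_l (z : C) (a : nat -> C) (n : nat) :
  z * Csum a 0 n = Csum (fun k => z * a k) 0 n.
Proof.
induction n as [|n IH]; [rewrite !Csum_00; reflexivity|].
rewrite !Csum_0S, <- IH; ring.
Qed.

Lemma Csum_plus (a a' : nat -> C) (n : nat) :
  Csum (fun k => a k + a' k) 0 n = Csum a 0 n + Csum a' 0 n.
Proof.
induction n as [|n IH]; [rewrite !Csum_00; reflexivity|].
rewrite !Csum_0S, IH; ring.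
Qed.

Lemma cder_Csum (F : nat -> R -> C) (F' : nat -> C) (x : R) (n : nat) :
  (forall k, (k <= n)%nat -> cder (F k) x (F' k)) ->
  cder (fun y => Csum (fun k => F k y) 0 n) x (Csum F' 0 n).
Proof.
induction n as [|n IH]; intros H.
- rewrite Csum_00; apply (cder_ext (F 0%nat)).
  + intros y; rewrite Csum_00; reflexivity.
  + apply H; lia.
- rewrite Csum_0S.
  apply (cder_ext (fun y => Csum (fun k => F k y) 0 n + F (S n) y)).
  + intros y; rewrite Csum_0S; reflexivity.
  + apply cder_plus; [apply IH; intros; apply H; lia|apply H; lia].
Qed.

(** The part of the binomial sum of Y_{m-k}(x) t^k, k <= m, that is even ([p = true]) or
    odd ([p = false]) in t. *)
Definition evenodd_part (Y : nat -> R -> C) (p : bool) (m : nat) (x t : R) : C :=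
  Csum (fun k => if Bool.eqb (Nat.even k) p
                 then Binomial.C m k * Y (m - k)%nat x * RtoC t ^ k else 0) 0 m.

Lemma cder_pow (g : R -> R) (y s : R) (k : nat) :
  is_derive g y s ->
  cder (fun z => RtoC (g z) ^ k) y (INR k * RtoC s * RtoC (g y) ^ pred k).
Proof.
intros Hg; induction k as [|k IH].
- eapply cder_eq; [apply (cder_const 1)|]. simpl; ring.
- eapply cder_eq.
  + apply (cder_mult (fun z => RtoC (g z)) (fun z => RtoC (g z) ^ k));
      [apply cder_RtoC; exact Hg|exact IH].
  + rewrite S_INR, RtoC_plus; destruct k; simpl pred; [simpl; ring|].
    rewrite (Cpow_S _ k). ring.
Qed.

Lemma binomial_S_left (m k : nat) : (k <= m)%nat ->
  (Binomial.C (S m) k * INR (S m - k) = INR (S m) * Binomial.C m k)%R.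
Proof.
intros Hk; unfold Binomial.C.
replace (S m - k)%nat with (S (m - k)) by lia.
rewrite (fact_simpl m), (fact_simpl (m - k)), !mult_INR.
field; repeat split; try apply INR_fact_neq_0; apply not_0_INR; lia.
Qed.

Lemma binomial_S_right (m k : nat) : (k <= m)%nat ->
  (Binomial.C (S m) (S k) * INR (S k) = INR (S m) * Binomial.C m k)%R.
Proof.
intros Hk; unfold Binomial.C; simpl (S m - S k)%nat.
rewrite (fact_simpl m), (fact_simpl k), !mult_INR.
field; repeat split; try apply INR_fact_neq_0; apply not_0_INR; lia.
Qed.

(** With Y_k' = k Z_{k-1} w, both partial derivatives of these sums are again such sums, of
    degree m-1: binom(m,k) (m-k) = m binom(m-1,k) for d/dx, which keeps the parity, and
    binom(m,k) k = m binom(m-1,k-1) for d/dt, which reverses it.  The derivative is taken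
    along a curve with x' = 1 and t' = s, so that the characteristic directions and the
    diagonals are covered at once. *)
Lemma cder_evenodd_part (Y Z : nat -> R -> C) (w : R -> C) (p : bool) (m : nat)
    (gx gt : R -> R) (y s : R) :
  cder (Y 0%nat) (gx y) 0 ->
  (forall k, cder (Y (S k)) (gx y) (INR (S k) * (Z k (gx y) * w (gx y)))) ->
  is_derive gx y 1%R -> is_derive gt y s ->
  cder (fun z => evenodd_part Y p m (gx z) (gt z)) y
    (INR m * (w (gx y) * evenodd_part Z p (pred m) (gx y) (gt y)
              + RtoC s * evenodd_part Y (negb p) (pred m) (gx y) (gt y))).
Proof.
intros H0 HS Hx Ht.
assert (HY : forall k, cder (fun z => Y k (gx z)) y
   (INR k * (Z (pred k) (gx y) * w (gx y)))).
{ intros k; eapply cder_eq.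
  - apply (cder_comp (Y k) gx y 1 (INR k * (Z (pred k) (gx y) * w (gx y)))); [|exact Hx].
    destruct k as [|k]; [|apply HS].
    eapply cder_eq; [exact H0|simpl; ring].
  - ring. }
set (T := RtoC (gt y)).
unfold evenodd_part.
eapply cder_eq.
{ apply (cder_Csum (fun k z => if Bool.eqb (Nat.even k) p
     then Binomial.C m k * Y (m - k)%nat (gx z) * RtoC (gt z) ^ k else 0)
   (fun k => if Bool.eqb (Nat.even k) p then
     Binomial.C m k * (INR (m - k) * (Z (pred (m - k)) (gx y) * w (gx y))) * T ^ k
     + Binomial.C m k * Y (m - k)%nat (gx y) * (INR k * s * T ^ pred k) else 0)).
  intros k _; destruct (Bool.eqb (Nat.even k) p); [|apply cder_const].
  apply (cder_mult (fun z => Binomial.C m k * Y (m - k)%nat (gx z)) (fun z => RtoC (gt z) ^ k)).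
  - apply (cder_scal (Binomial.C m k)), HY.
  - apply cder_pow; exact Ht. }
destruct m as [|m].
{ rewrite Csum_00; change (INR (0 - 0)) with 0%R; change (INR 0) with 0%R.
  destruct (Bool.eqb (Nat.even 0) p); ring. }
rewrite (Csum_ext _ (fun k =>
  (if Bool.eqb (Nat.even k) p then
     Binomial.C (S m) k * (INR (S m - k) * (Z (pred (S m - k)) (gx y) * w (gx y))) * T ^ k else 0)
  + (if Bool.eqb (Nat.even k) p then
     Binomial.C (S m) k * Y (S m - k)%nat (gx y) * (INR k * s * T ^ pred k) else 0)))
  by (intros k _; cbv beta; destruct (Bool.eqb (Nat.even k) p); ring).
rewrite Csum_plus, Cmult_plus_distr_l; f_equal.
  (* The last term of the first sum has the factor m - k = 0. *)
- rewrite Csum_0S; change (pred (S m)) with m.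
  replace (S m - S m)%nat with 0%nat by lia.
  match goal with |- _ + ?a = _ => replace a with (RtoC 0)
    by (destruct (Bool.eqb (Nat.even (S m)) p); simpl INR; ring) end.
  rewrite Cplus_0_r, Cmult_assoc, Csum_mult_l; apply Csum_ext; intros k Hk; cbv beta.
  destruct (Bool.eqb (Nat.even k) p); [|ring].
  replace (pred (S m - k)) with (m - k)%nat by lia.
  transitivity (RtoC (Binomial.C (S m) k * INR (S m - k)) * (Z (m - k)%nat (gx y) * w (gx y)) * T ^ k);
    [rewrite RtoC_mult; ring|].
  rewrite binomial_S_left, RtoC_mult by exact Hk; unfold T; ring.
  (* The first term of the second sum has the factor k = 0. *)
- rewrite Csum_head.
  match goal with |- ?a + _ = _ => replace a with (RtoC 0)
    by (destruct (Bool.eqb (Nat.even 0) p); simpl INR; ring) end.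
  rewrite Cplus_0_l, Cmult_assoc, Csum_mult_l; apply Csum_ext; intros k Hk; cbv beta.
  replace (Bool.eqb (Nat.even (S k)) p) with (Bool.eqb (Nat.even k) (negb p))
    by (rewrite Nat.even_succ, <- Nat.negb_even; destruct (Nat.even k), p; reflexivity).
  change (pred (S k)) with k; change (pred (S m)) with m.
  destruct (Bool.eqb (Nat.even k) (negb p)); [|ring].
  replace (S m - S k)%nat with (m - k)%nat by lia.
  transitivity (RtoC (Binomial.C (S m) (S k) * INR (S k)) * Y (m - k)%nat (gx y) * (s * T ^ k));
    [rewrite RtoC_mult; ring|].
  rewrite binomial_S_right, RtoC_mult by exact Hk; unfold T; ring.
Qed.

Lemma evenodd_part_x0 (Y : nat -> R -> C) (p : bool) (m : nat) (t : R) :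
  Y 0%nat 0%R = 1 -> (forall k, Y (S k) 0%R = 0) ->
  evenodd_part Y p m 0 t = if Bool.eqb (Nat.even m) p then RtoC t ^ m else 0.
Proof.
intros H0 HS; unfold evenodd_part.
assert (Z : forall n (a : nat -> C), (forall k, (k <= n)%nat -> a k = 0) -> Csum a 0 n = 0).
{ induction n as [|n IH]; intros a Ha; [rewrite Csum_00; apply Ha; lia|].
  rewrite Csum_0S, IH, Ha by (try lia; intros; apply Ha; lia); ring. }
assert (L : (if Bool.eqb (Nat.even m) p
             then Binomial.C m m * Y (m - m)%nat 0%R * RtoC t ^ m else 0)
            = if Bool.eqb (Nat.even m) p then RtoC t ^ m else 0).
{ rewrite Nat.sub_diag, H0, pascal_step1 by lia. rewrite Nat.sub_diag.
  unfold Binomial.C; simpl fact; rewrite Nat.sub_0_r.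
  replace (INR (fact m) / (INR 1 * INR (fact m)))%R with 1%R
    by (simpl INR; field; apply INR_fact_neq_0).
  destruct (Bool.eqb (Nat.even m) p); ring. }
destruct m as [|m]; [rewrite Csum_00; exact L|].
rewrite Csum_0S, L, Z; [ring|].
intros k Hk; replace (S m - k)%nat with (S (m - k)) by lia; rewrite HS.
destruct (Bool.eqb (Nat.even k) p); ring.
Qed.

Lemma evenodd_part_opp (Y : nat -> R -> C) (p : bool) (m : nat) (x t : R) :
  evenodd_part Y p m x (- t) =
  if p then evenodd_part Y p m x t else - evenodd_part Y p m x t.
Proof.
unfold evenodd_part.
assert (P : forall k, RtoC (- t) ^ k = if Nat.even k then RtoC t ^ k else - RtoC t ^ k).
{ intros k; rewrite RtoC_opp; induction k as [|k IH]; [reflexivity|].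
  rewrite !Cpow_S, IH, Nat.even_succ, <- Nat.negb_even; destruct (Nat.even k); simpl; ring. }
destruct p.
- apply Csum_ext; intros k _; cbv beta; rewrite P; destruct (Nat.even k); reflexivity.
- replace (- Csum _ 0 m) with (- (1) * Csum (fun k => if Bool.eqb (Nat.even k) false
    then Binomial.C m k * Y (m - k)%nat x * RtoC t ^ k else 0) 0 m) by ring.
  rewrite Csum_mult_l; apply Csum_ext; intros k _; cbv beta; rewrite P; destruct (Nat.even k); simpl; ring.
Qed.

(** [phi f k = f * formal_power f k], and the companion powers [dual_power f] are the
    formal powers of 1/f ([formal_power_inv]).  The two families are exchanged by
    differentiation, with weights 1/f^2 and f^2. *)
Definition formal_power (f : R -> C) (k : nat) : R -> C :=
  if Nat.odd k then X_ f k else Xt_ f k.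
Definition dual_power (f : R -> C) (k : nat) : R -> C :=
  if Nat.odd k then Xt_ f k else X_ f k.

Lemma CInt_derive_global (g : R -> C) (x : R) :
  (forall y, ccont g y) -> cder (fun y => CInt g 0 y) x (g x).
Proof.
intros Hg; apply (CInt_derive g (- (Rabs x + 1)) (Rabs x + 1) 0 x).
- intros y _; apply Hg.
- generalize (Rabs_pos x); lra.
- unfold Rabs; destruct (Rcase_abs x); lra.
Qed.

Section FormalPowers.
Context (f : R -> C) (Hf : forall x, ccont f x) (Hn : forall x, f x <> 0).

Lemma weight_continuous (c : bool) (x : R) :
  ccont (fun s => if c then f s ^ 2 else / (f s ^ 2)) x.
Proof.
assert (H2 : ccont (fun s => f s ^ 2) x).
{ apply (continuous_Cmult _ f (fun s => f s ^ 1)); [apply Hf|].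
  apply (continuous_Cmult _ f (fun s => 1)); [apply Hf|apply continuous_Cconst]. }
destruct c; [exact H2|].
apply ccont_inv; [exact H2|apply Cpow_nz, Hn].
Qed.

Lemma X_derive (m : nat) (x : R) :
  cder (X_ f (S m)) x
    (INR (S m) * (X_ f m x * (if Nat.even (S m) then f x ^ 2 else / (f x ^ 2)))).
Proof.
assert (H : forall n y, ccont (X_ f n) y).
{ induction n as [|n IH]; intros y; [apply continuous_Cconst|].
  eapply cder_continuous.
  apply (cder_scal (INR (S n)) (fun x => CInt (fun s => X_ f n s *
              (if Nat.even (S n) then f s ^ 2 else / (f s ^ 2))) 0 x)).
  apply CInt_derive_global; intros z; apply continuous_Cmult; [apply IH|apply weight_continuous]. }
apply (cder_scal (INR (S m)) (fun x => CInt (fun s => X_ f m s *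
              (if Nat.even (S m) then f s ^ 2 else / (f s ^ 2))) 0 x)).
apply (CInt_derive_global (fun s => X_ f m s *
              (if Nat.even (S m) then f s ^ 2 else / (f s ^ 2)))).
intros z; apply continuous_Cmult; [apply H|apply weight_continuous].
Qed.

Lemma Xt_derive (m : nat) (x : R) :
  cder (Xt_ f (S m)) x
    (INR (S m) * (Xt_ f m x * (if Nat.even m then f x ^ 2 else / (f x ^ 2)))).
Proof.
assert (H : forall n y, ccont (Xt_ f n) y).
{ induction n as [|n IH]; intros y; [apply continuous_Cconst|].
  eapply cder_continuous.
  apply (cder_scal (INR (S n)) (fun x => CInt (fun s => Xt_ f n s *
              (if Nat.even n then f s ^ 2 else / (f s ^ 2))) 0 x)).
  apply CInt_derive_global; intros z; apply continuous_Cmult; [apply IH|apply weight_continuous]. }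
apply (cder_scal (INR (S m)) (fun x => CInt (fun s => Xt_ f m s *
              (if Nat.even m then f s ^ 2 else / (f s ^ 2))) 0 x)).
apply (CInt_derive_global (fun s => Xt_ f m s *
              (if Nat.even m then f s ^ 2 else / (f s ^ 2)))).
intros z; apply continuous_Cmult; [apply H|apply weight_continuous].
Qed.

Lemma formal_power_derive (k : nat) (x : R) :
  cder (formal_power f (S k)) x (INR (S k) * (dual_power f k x * / (f x ^ 2))).
Proof.
unfold formal_power, dual_power; rewrite Nat.odd_succ, <- Nat.negb_even.
generalize (X_derive k x) (Xt_derive k x); rewrite Nat.even_succ, <- Nat.negb_even.
destruct (Nat.even k); simpl negb; cbn iota; auto.
Qed.

Lemma dual_power_derive (k : nat) (x : R) :
  cder (dual_power f (S k)) x (INR (S k) * (formal_power f k x * f x ^ 2)).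
Proof.
unfold formal_power, dual_power; rewrite Nat.odd_succ, <- Nat.negb_even.
generalize (X_derive k x) (Xt_derive k x); rewrite Nat.even_succ, <- Nat.negb_even.
destruct (Nat.even k); simpl negb; cbn iota; auto.
Qed.

Lemma formal_power_at0 (k : nat) : formal_power f (S k) 0%R = 0.
Proof.
unfold formal_power; destruct (Nat.odd (S k)); cbn [X_ Xt_]; rewrite CInt_point; ring.
Qed.

Lemma dual_power_at0 (k : nat) : dual_power f (S k) 0%R = 0.
Proof.
unfold dual_power; destruct (Nat.odd (S k)); cbn [X_ Xt_]; rewrite CInt_point; ring.
Qed.
End FormalPowers.

Lemma X_ext (f g : R -> C) (b : R) :
  (forall x, Icc b x -> f x = g x) ->
  forall n x, Icc b x -> X_ f n x = X_ g n x /\ Xt_ f n x = Xt_ g n x.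
Proof.
intros E; induction n as [|n IH]; intros x Hx; [split; reflexivity|].
cbn [X_ Xt_]; split; f_equal; apply CInt_ext; intros z Hz.
- assert (Iz : Icc b z).
  { unfold Icc in *; unfold Rmin, Rmax in Hz; destruct (Rle_dec 0 x); lra. }
  rewrite (proj1 (IH z Iz)), E by exact Iz; reflexivity.
- assert (Iz : Icc b z).
  { unfold Icc in *; unfold Rmin, Rmax in Hz; destruct (Rle_dec 0 x); lra. }
  rewrite (proj2 (IH z Iz)), E by exact Iz; reflexivity.
Qed.

Lemma u_ext (f g : R -> C) (b : R) :
  (forall x, Icc b x -> f x = g x) ->
  forall n x t, Icc b x -> u_ f n x t = u_ g n x t.
Proof.
intros E n x t Hx.
assert (P : forall k, phi f k x = phi g k x).
{ intros k; unfold phi; destruct (X_ext f g b E k x Hx) as [-> ->].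
  rewrite E by exact Hx; reflexivity. }
unfold u_; destruct n; [apply P|].
apply Csum_ext; intros k _; cbv beta; rewrite P; reflexivity.
Qed.

Lemma X_inv (f : R -> C) (Hn : forall x, f x <> 0) (n : nat) (x : R) :
  X_ (fun y => / f y) n x = Xt_ f n x /\ Xt_ (fun y => / f y) n x = X_ f n x.
Proof.
revert x; induction n as [|n IH]; intros x; [split; reflexivity|].
cbn [X_ Xt_]; rewrite Nat.even_succ, <- Nat.negb_even; split; f_equal;
  apply CInt_ext; intros z _; rewrite ?(proj1 (IH z)), ?(proj2 (IH z)); f_equal;
  destruct (Nat.even n); simpl; field; apply Hn.
Qed.

Lemma formal_power_inv (f : R -> C) (Hn : forall x, f x <> 0) (k : nat) (x : R) :
  formal_power (fun y => / f y) k x = dual_power f k x.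
Proof.
unfold formal_power, dual_power; destruct (Nat.odd k); apply X_inv; exact Hn.
Qed.

(** For m >= 1 these are u_{2m-1} ([p = true]) and u_{2m} ([p = false]).  For m = 0 they are
    u_0 and the function 0, so that the double series can start at n = 0. *)
Definition wave (f : R -> C) (p : bool) (m : nat) (x t : R) : C :=
  f x * evenodd_part (formal_power f) p m x t.

Lemma u_wave_gen (f : R -> C) (n : nat) (x t : R) :
  u_ f (S n) x t = wave f (Nat.odd (S n)) (Nat.div2 (S (S n))) x t.
Proof.
unfold u_, wave, evenodd_part; cbv zeta; rewrite Csum_mult_l; apply Csum_ext; intros k _.
destruct (Bool.eqb (Nat.even k) (Nat.odd (S n))); [|ring].
unfold phi, formal_power.
destruct (Nat.odd (Nat.div2 (S (S n)) - k)); ring.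
Qed.

Lemma u_wave_true (f : R -> C) (n : nat) (x t : R) :
  (1 <= n)%nat -> u_ f (2 * n - 1) x t = wave f true n x t.
Proof.
intros Hn; destruct n as [|n]; [lia|].
replace (2 * S n - 1)%nat with (S (2 * n)) by lia.
rewrite u_wave_gen, Nat.odd_succ, Nat.even_even.
replace (S (S (2 * n))) with (2 * S n)%nat by lia; rewrite Nat.div2_double; reflexivity.
Qed.

Lemma u_wave_false (f : R -> C) (n : nat) (x t : R) :
  (1 <= n)%nat -> u_ f (2 * n) x t = wave f false n x t.
Proof.
intros Hn; destruct n as [|n]; [lia|].
replace (2 * S n)%nat with (S (S (2 * n))) by lia.
rewrite u_wave_gen, Nat.odd_succ, Nat.even_succ, Nat.odd_even.
replace (S (S (S (2 * n)))) with (S (2 * S n)) by lia.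
rewrite Nat.div2_succ_double; reflexivity.
Qed.

Lemma u_wave_0 (f : R -> C) (x t : R) : u_ f 0 x t = wave f true 0 x t.
Proof.
unfold u_, wave, evenodd_part; rewrite Csum_00; unfold phi, formal_power, Binomial.C; simpl.
replace (1 / (1 * 1))%R with 1%R by field. ring.
Qed.

Lemma wave_false_0 (f : R -> C) (x t : R) : wave f false 0 x t = 0.
Proof. unfold wave, evenodd_part; rewrite Csum_00; simpl; ring. Qed.

(** * Convergence of the expansion on the square *)

(** The open square |x| < b, |t| < b in characteristic coordinates. *)
Definition diamond (b u v : R) : Prop := (Rabs u + Rabs v < b)%R.
(** The interior of the domain of the Goursat problem. *)
Definition hexagon (b u v : R) : Prop :=
  (Rabs u < b /\ Rabs v < b /\ Rabs (u + v) < b)%R.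

Lemma between_abs (u s : R) : (Rmin 0 u <= s <= Rmax 0 u)%R -> (Rabs s <= Rabs u)%R.
Proof.
intros Hs; unfold Rmin, Rmax in Hs; destruct (Rle_dec 0 u);
  unfold Rabs; repeat destruct Rcase_abs; lra.
Qed.

Lemma diamond_star (b : R) : star_open (diamond b).
Proof.
split.
- intros u v H; unfold diamond in H.
  assert (Hd : (0 < (b - (Rabs u + Rabs v)) / 2)%R) by lra.
  exists (mkposreal _ Hd); simpl; intros x y Hx Hy; unfold diamond.
  assert (T1 := Rabs_triang_inv x u); assert (T2 := Rabs_triang_inv y v); lra.
- intros u v s r H Hs Hr; unfold diamond in *.
  apply between_abs in Hs, Hr; lra.
Qed.

Lemma hexagon_star (b : R) : star_open (hexagon b).
Proof.
split.
- intros u v [H1 [H2 H3]].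
  set (e := Rmin (Rmin (b - Rabs u) (b - Rabs v)) ((b - Rabs (u + v)) / 2)).
  assert (Hd : (0 < e)%R) by (unfold e; repeat apply Rmin_pos; lra).
  assert (L1 : (e <= b - Rabs u)%R) by (unfold e; eapply Rle_trans; apply Rmin_l).
  assert (L2 : (e <= b - Rabs v)%R)
    by (unfold e; eapply Rle_trans; [apply Rmin_l|apply Rmin_r]).
  assert (L3 : (e <= (b - Rabs (u + v)) / 2)%R) by (unfold e; apply Rmin_r).
  exists (mkposreal _ Hd); simpl; intros x y Hx Hy; unfold hexagon.
  assert (T1 := Rabs_triang_inv x u); assert (T2 := Rabs_triang_inv y v).
  assert (T3 := Rabs_triang_inv (x + y) (u + v)).
  assert (T4 := Rabs_triang (x - u) (y - v)).
  replace (x + y - (u + v))%R with (x - u + (y - v))%R in T3 by ring.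
  repeat split; lra.
- intros u v s r [H1 [H2 H3]] Hs Hr; unfold hexagon.
  unfold Rmin, Rmax in Hs, Hr; destruct (Rle_dec 0 u), (Rle_dec 0 v);
    repeat split; apply Rabs_def1; apply Rabs_def2 in H1, H2, H3; lra.
Qed.

Lemma diamond_hexagon (b u v : R) : diamond b u v -> hexagon b u v.
Proof.
unfold diamond, hexagon; intros H.
assert (T := Rabs_triang u v); assert (T1 := Rabs_pos u); assert (T2 := Rabs_pos v).
repeat split; lra.
Qed.

Lemma Rabs_open (b x : R) : (Rabs x < b)%R <-> (- b < x < b)%R.
Proof.
split; [intros H; apply Rabs_def2 in H; lra|intros [H1 H2]; apply Rabs_def1; lra].
Qed.

Lemma hexagon_domain (b u v : R) : hexagon b u v -> goursat_domain b u v.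
Proof. unfold hexagon, goursat_domain; intros [H1 [H2 H3]]; repeat split; lra. Qed.

Lemma locally_2d_slice_r (D : R -> R -> Prop) (u v : R) :
  locally_2d D u v -> locally v (D u).
Proof.
intros [d Hd]; exists d; intros y Hy; apply Hd; [|exact Hy].
rewrite Rminus_diag, Rabs_R0; apply cond_pos.
Qed.

Lemma locally_2d_slice_l (D : R -> R -> Prop) (u v : R) :
  locally_2d D u v -> locally u (fun y => D y v).
Proof.
intros [d Hd]; exists d; intros y Hy; apply Hd; [exact Hy|].
rewrite Rminus_diag, Rabs_R0; apply cond_pos.
Qed.

(** Inside the hexagon all slices are two-sided; H(0,v) is constant, hence Hv(0,v) = 0. *)
Lemma goursat_solution_interior (b : R) (q : R -> C) (h : C) (H : R -> R -> C) :
  (0 < b)%R -> goursat_solution b q h H ->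
  exists Hv, goursat_on (hexagon b) q H Hv /\
    (forall v, (Rabs v < b)%R -> Hv 0%R v = 0).
Proof.
intros Hb [Hc [[Hv HD] [_ H0]]]; exists Hv.
assert (DV : forall u v, hexagon b u v -> cder (H u) v (Hv u v)).
{ intros u v Huv.
  apply (is_derive_on_interior (fun y => goursat_domain b u y)).
  - apply locally_2d_slice_r; destruct (star_locally _ (hexagon_star b) u v Huv) as [d Hd].
    exists d; intros; apply hexagon_domain; auto.
  - apply HD, hexagon_domain, Huv. }
split; [split|].
- intros u v Huv; unfold ccont2, continuous.
  intros P HP; generalize (Hc (u, v) (hexagon_domain _ _ _ Huv) P HP).
  unfold within, filtermap; intros W.
  assert (L : locally (u, v) (fun p : R * R => goursat_domain b (fst p) (snd p))).
  { apply locally_2d_locally; destruct (star_locally _ (hexagon_star b) u v Huv) as [d Hd].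
    exists d; intros; apply hexagon_domain; auto. }
  generalize (filter_and _ _ L W); apply filter_imp; intros x [X1 X2]; auto.
- exact DV.
- intros u v Huv.
  apply (is_derive_on_interior (fun y => goursat_domain b y v)).
  + apply locally_2d_slice_l; destruct (star_locally _ (hexagon_star b) u v Huv) as [d Hd].
    exists d; intros; apply hexagon_domain; auto.
  + apply HD, hexagon_domain, Huv.
- intros v Hvb.
  apply (cder_unique (H 0%R) v); [apply DV|].
  + unfold hexagon; rewrite Rplus_0_l, Rabs_R0; lra.
  + apply (cder_ext_loc (fun _ => h / 2)); [|apply cder_const].
    assert (Hvb' := proj1 (Rabs_open b v) Hvb).
    generalize (locally_Icc b v Hvb'); apply filter_imp; intros y Hy; symmetry; apply H0, Hy.
Qed.

Lemma goursat_on_plus (D : R -> R -> Prop) (q : R -> C) (W1 V1 W2 V2 : R -> R -> C) :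
  goursat_on D q W1 V1 -> goursat_on D q W2 V2 ->
  goursat_on D q (fun u v => W1 u v + W2 u v) (fun u v => V1 u v + V2 u v).
Proof.
intros [A1 A2 A3] [B1 B2 B3]; split; intros u v Huv.
- apply continuous_Cplus; [apply A1|apply B1]; exact Huv.
- apply cder_plus; [apply A2|apply B2]; exact Huv.
- eapply cder_eq; [apply cder_plus; [apply A3|apply B3]; exact Huv|ring].
Qed.

Lemma goursat_on_scal (D : R -> R -> Prop) (q : R -> C) (k : C) (W V : R -> R -> C) :
  goursat_on D q W V ->
  goursat_on D q (fun u v => k * W u v) (fun u v => k * V u v).
Proof.
intros [A1 A2 A3]; split; intros u v Huv.
- apply continuous_Cmult; [apply continuous_Cconst|apply A1; exact Huv].
- apply cder_scal, A2; exact Huv.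
- eapply cder_eq; [apply cder_scal, A3; exact Huv|ring].
Qed.

Lemma goursat_on_ext (D : R -> R -> Prop) (q : R -> C) (W1 W2 V1 V2 : R -> R -> C) :
  (forall u v, W1 u v = W2 u v) -> (forall u v, V1 u v = V2 u v) ->
  goursat_on D q W1 V1 -> goursat_on D q W2 V2.
Proof.
intros EW EV [A1 A2 A3]; split; intros u v Huv.
- apply (ccont2_ext_loc W1); [|apply A1; exact Huv].
  apply locally_2d_forall; exact EW.
- rewrite <- EV; apply (cder_ext (W1 u)); [apply EW|apply A2; exact Huv].
- rewrite <- EW; apply (cder_ext (fun y => V1 y v)); [intros; apply EV|apply A3; exact Huv].
Qed.

Lemma goursat_on_Csum (D : R -> R -> Prop) (q : R -> C) (W V : nat -> R -> R -> C) (N : nat) :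
  (forall n, goursat_on D q (W n) (V n)) ->
  goursat_on D q (fun u v => Csum (fun n => W n u v) 0 N)
                 (fun u v => Csum (fun n => V n u v) 0 N).
Proof.
intros H; induction N as [|N IH].
- apply (goursat_on_ext D q (W 0%nat) _ (V 0%nat)); [| |apply H];
  intros; rewrite Csum_00; reflexivity.
- eapply goursat_on_ext; [| |apply goursat_on_plus; [exact IH|apply (H (S N))]];
  intros; rewrite Csum_0S; reflexivity.
Qed.

Lemma continuous_Cpow (T : UniformSpace) (g : T -> R) (x : T) (k : nat) :
  continuous g x -> continuous (U := C_UniformSpace) (fun y => RtoC (g y) ^ k) x.
Proof.
intros Hg; induction k as [|k IH]; [apply continuous_Cconst|].
apply (continuous_Cmult _ (fun y => RtoC (g y))); [|exact IH].
apply continuous_C; split; [exact Hg|apply continuous_const].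
Qed.

Lemma continuous_Csum (T : UniformSpace) (F : nat -> T -> C) (x : T) (n : nat) :
  (forall k, (k <= n)%nat -> continuous (U := C_UniformSpace) (F k) x) ->
  continuous (U := C_UniformSpace) (fun y => Csum (fun k => F k y) 0 n) x.
Proof.
induction n as [|n IH]; intros H.
- apply (continuous_ext (F 0%nat)); [intros y; rewrite Csum_00; reflexivity|apply H; lia].
- apply (continuous_ext (fun y => Csum (fun k => F k y) 0 n + F (S n) y)).
  + intros y; rewrite Csum_0S; reflexivity.
  + apply continuous_Cplus; [apply IH; intros; apply H; lia|apply H; lia].
Qed.

Section Wave.
Context (f : R -> C) (Hf : forall x, ccont f x) (Hn : forall x, f x <> 0).

Lemma formal_power_cont (k : nat) (x : R) : ccont (formal_power f k) x.
Proof.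
destruct k; [apply continuous_Cconst|].
eapply cder_continuous, formal_power_derive; assumption.
Qed.

Lemma wave_cont (T : UniformSpace) (gx gt : T -> R) (p : bool) (m : nat) (z : T) :
  continuous gx z -> continuous gt z ->
  continuous (U := C_UniformSpace) (fun y => wave f p m (gx y) (gt y)) z.
Proof.
intros Hx Ht; unfold wave, evenodd_part.
apply continuous_Cmult.
- apply (continuous_comp gx f); [exact Hx|apply Hf].
- apply (continuous_Csum T (fun k y => if Bool.eqb (Nat.even k) p
   then Binomial.C m k * formal_power f (m - k) (gx y) * RtoC (gt y) ^ k else 0)).
  intros k _; destruct (Bool.eqb (Nat.even k) p); [|apply continuous_Cconst].
  apply continuous_Cmult; [|apply continuous_Cpow; exact Ht].
  apply continuous_Cmult; [apply continuous_Cconst|].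
  apply (continuous_comp gx (formal_power f (m - k))); [exact Hx|apply formal_power_cont].
Qed.

Context (b : R) (q f1 : R -> C).
Hypothesis Hf1 : forall x, (- b < x < b)%R -> cder f x (f1 x).
Hypothesis Hf2 : forall x, (- b < x < b)%R -> cder f1 x (q x * f x).

Notation Y := (formal_power f).
Notation Z := (dual_power f).

Lemma cder_Y (p : bool) (m : nat) (gx gt : R -> R) (y s : R) :
  is_derive gx y 1%R -> is_derive gt y s ->
  cder (fun z => evenodd_part Y p m (gx z) (gt z)) y
    (INR m * (/ (f (gx y) ^ 2) * evenodd_part Z p (pred m) (gx y) (gt y)
              + RtoC s * evenodd_part Y (negb p) (pred m) (gx y) (gt y))).
Proof.
intros Hx Ht.
apply (cder_evenodd_part Y Z (fun x => / (f x ^ 2))); try assumption.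
- apply (cder_ext (fun _ => 1)); [reflexivity|apply cder_const].
- intros k; apply formal_power_derive; assumption.
Qed.

Lemma cder_Z (p : bool) (m : nat) (gx gt : R -> R) (y s : R) :
  is_derive gx y 1%R -> is_derive gt y s ->
  cder (fun z => evenodd_part Z p m (gx z) (gt z)) y
    (INR m * (f (gx y) ^ 2 * evenodd_part Y p (pred m) (gx y) (gt y)
              + RtoC s * evenodd_part Z (negb p) (pred m) (gx y) (gt y))).
Proof.
intros Hx Ht.
apply (cder_evenodd_part Z Y (fun x => f x ^ 2)); try assumption.
- apply (cder_ext (fun _ => 1)); [reflexivity|apply cder_const].
- intros k; apply dual_power_derive; assumption.
Qed.

(** The v-derivative of a wave polynomial, by [cder_Y] with slope t' = -1. *)
Definition wave_v (p : bool) (m : nat) (u v : R) : C :=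
  f1 (u + v)%R * evenodd_part Y p m (u + v) (u - v) +
  INR m * (/ f (u + v)%R * evenodd_part Z p (pred m) (u + v) (u - v)
           - f (u + v)%R * evenodd_part Y (negb p) (pred m) (u + v) (u - v)).

(** Differentiating once more, now with slope t' = 1, the terms in [dual_power] and those
    of the opposite parity cancel; what remains is f'' = q f times the same sum. *)
Lemma wave_goursat (p : bool) (m : nat) :
  goursat_on (diamond b) q (fun u v => wave f p m (u + v) (u - v)) (wave_v p m).
Proof.
assert (Dx : forall u v, diamond b u v -> (- b < u + v < b)%R).
{ intros u v H; apply Rabs_open, (diamond_hexagon b u v H). }
split; intros u v H.
- unfold ccont2; apply (wave_cont (prod_UniformSpace R_UniformSpace R_UniformSpace)
    (fun p => fst p + snd p)%R (fun p => fst p - snd p)%R).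
  + apply (continuous_plus (V := R_NormedModule)); [apply continuous_fst|apply continuous_snd].
  + apply (continuous_minus (V := R_NormedModule)); [apply continuous_fst|apply continuous_snd].
- assert (P1 : is_derive (fun y => u + y)%R v 1%R) by (auto_derive; [trivial|ring]).
  assert (P2 : is_derive (fun y => u - y)%R v (- (1))%R) by (auto_derive; [trivial|ring]).
  eapply cder_eq.
  + apply (cder_mult (fun y => f (u + y)%R) (fun y => evenodd_part Y p m (u + y) (u - y))).
    * apply (cder_comp f (fun y => u + y)%R v 1 (f1 (u + v)%R)); [apply Hf1, Dx, H|exact P1].
    * apply (cder_Y p m (fun y => u + y)%R (fun y => u - y)%R v (- (1))); assumption.
  + cbv beta; unfold wave_v; rewrite RtoC_opp; field; apply Hn.
- assert (P1 : is_derive (fun y => y + v)%R u 1%R) by (auto_derive; [trivial|ring]).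
  assert (P2 : is_derive (fun y => y - v)%R u 1%R) by (auto_derive; [trivial|ring]).
  unfold wave_v.
  assert (Cf : cder (fun y => f (y + v)%R) u (1%R * f1 (u + v)%R)).
  { apply (cder_comp f (fun y => y + v)%R u 1 (f1 (u + v)%R)); [apply Hf1, Dx, H|exact P1]. }
  eapply cder_eq.
  + apply (cder_plus (fun y => f1 (y + v)%R * evenodd_part Y p m (y + v) (y - v))
      (fun y => INR m * (/ f (y + v)%R * evenodd_part Z p (pred m) (y + v) (y - v)
           - f (y + v)%R * evenodd_part Y (negb p) (pred m) (y + v) (y - v)))).
    * apply (cder_mult (fun y => f1 (y + v)%R) (fun y => evenodd_part Y p m (y + v) (y - v))).
      -- apply (cder_comp f1 (fun y => y + v)%R u 1 (q (u + v)%R * f (u + v)%R)); [apply Hf2, Dx, H|exact P1].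
      -- apply (cder_Y p m (fun y => y + v)%R (fun y => y - v)%R u 1); assumption.
    * apply cder_scal.
      apply (cder_minus (fun y => / f (y + v)%R * evenodd_part Z p (pred m) (y + v) (y - v))
         (fun y => f (y + v)%R * evenodd_part Y (negb p) (pred m) (y + v) (y - v))).
      -- apply (cder_mult (fun y => / f (y + v)%R) (fun y => evenodd_part Z p (pred m) (y + v) (y - v))).
         ++ apply (cder_inv (fun y => f (y + v)%R)); [exact Cf|apply Hn].
         ++ apply (cder_Z p (pred m) (fun y => y + v)%R (fun y => y - v)%R u 1); assumption.
      -- apply (cder_mult (fun y => f (y + v)%R) (fun y => evenodd_part Y (negb p) (pred m) (y + v) (y - v))).
         ++ exact Cf.
         ++ apply (cder_Y (negb p) (pred m) (fun y => y + v)%R (fun y => y - v)%R u 1); assumption.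
  + cbv beta; unfold wave; rewrite negb_involutive; field; apply Hn.
Qed.
End Wave.

Definition partial_sum (f : R -> C) (c d : nat -> C) (N : nat) (x t : R) : C :=
  Csum (fun n => c n * wave f true n x t + d n * wave f false n x t) 0 N.

Lemma partial_sum_cont (f : R -> C) (Hf : forall x, ccont f x) (Hn : forall x, f x <> 0)
    (c d : nat -> C) (N : nat) (T : UniformSpace) (gx gt : T -> R) (z : T) :
  continuous gx z -> continuous gt z ->
  continuous (U := C_UniformSpace) (fun y => partial_sum f c d N (gx y) (gt y)) z.
Proof.
intros Hx Ht; unfold partial_sum.
apply (continuous_Csum T (fun n y => c n * wave f true n (gx y) (gt y) + d n * wave f false n (gx y) (gt y))).
intros k _; apply continuous_Cplus; apply continuous_Cmult;
  try apply continuous_Cconst; apply wave_cont; assumption.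
Qed.

Section Core.
Context (b : R) (q f f1 : R -> C) (h : C) (K : R -> R -> C) (c d : nat -> C) (Q : R).
Hypothesis Hb : (0 < b)%R.
Hypothesis Hf : forall x, ccont f x.
Hypothesis Hn : forall x, f x <> 0.
Hypothesis Hf1 : forall x, (- b < x < b)%R -> cder f x (f1 x).
Hypothesis Hf2 : forall x, (- b < x < b)%R -> cder f1 x (q x * f x).
Hypothesis Hq : forall x, (- b < x < b)%R -> ccont q x.
Hypothesis HQ : forall x, (- b < x < b)%R -> (Cmod (q x) <= Q)%R.
Hypothesis HK : transmutation_kernel b q h K.

Lemma stability_open (N : nat) (M : R) :
  (forall x, (- b < x < b)%R -> (Cmod (partial_sum f c d N x x - K x x) <= M)%R) ->
  (forall x, (- b < x < b)%R -> (Cmod (partial_sum f c d N x (- x) - K x (- x)%R) <= M)%R) ->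
  forall x t, (- b < x < b)%R -> (- b < t < b)%R ->
  (Cmod (partial_sum f c d N x t - K x t) <= 6 * M * exp ((Q + 2) * b))%R.
Proof.
intros H1 H2 x t Hx Ht.
destruct HK as [H [HG KH]].
destruct (goursat_solution_interior b q h H Hb HG) as [Hv [GH _]].
assert (Q0 : (0 <= Q)%R).
{ eapply Rle_trans; [apply Cmod_ge_0|apply (HQ 0%R); lra]. }
assert (M0 : (0 <= M)%R).
{ eapply Rle_trans; [apply Cmod_ge_0|apply (H1 0%R); lra]. }
assert (G : exists V, goursat_on (diamond b) q
   (fun u v => partial_sum f c d N (u + v) (u - v) + - (1) * H u v) V).
{ eexists; apply goursat_on_plus.
  - unfold partial_sum.
    apply (goursat_on_Csum (diamond b) q
      (fun n u v => c n * wave f true n (u + v) (u - v) + d n * wave f false n (u + v) (u - v))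
      (fun n u v => c n * wave_v f f1 true n u v + d n * wave_v f f1 false n u v)).
    intros n; apply goursat_on_plus; apply goursat_on_scal; apply wave_goursat; assumption.
  - apply goursat_on_scal.
    destruct GH as [A1 A2 A3]; split; intros; [apply A1|apply A2|apply A3];
    apply diamond_hexagon; assumption. }
destruct G as [V G].
assert (Dx : forall u v, diamond b u v -> (- b < u + v < b)%R).
{ intros u v Hd; apply Rabs_open, (diamond_hexagon b u v Hd). }
assert (Da : forall u v, diamond b u v -> (- b < u < b)%R /\ (- b < v < b)%R).
{ intros u v Hd; destruct (diamond_hexagon b u v Hd) as [Hu [Hw _]]; split; apply Rabs_open; assumption. }
assert (S := goursat_stability (diamond b) q _ V (Q + 2) M (diamond_star b)
   (fun u v Hd => Hq _ (Dx u v Hd)) G ltac:(lra)).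
assert (Hxt : diamond b ((x + t) / 2) ((x - t) / 2)).
{ unfold diamond; unfold Rabs; repeat destruct Rcase_abs; lra. }
(* lam = Q + 2 satisfies Q <= lam^2/2. *)
assert (SQ : forall u v : R, diamond b u v -> (Cmod (q (u + v)%R) <= (Q + 2) * (Q + 2) / 2)%R).
{ intros u v Hd; eapply Rle_trans; [apply HQ, Dx, Hd|nra]. }
assert (ST : forall u v : R, diamond b u v ->
  (Cmod (partial_sum f c d N (u + 0) (u - 0) + - (1) * H u 0%R) <= M)%R /\
  (Cmod (partial_sum f c d N (0 + v) (0 - v) + - (1) * H 0%R v) <= M)%R).
{ intros u v Hd; destruct (Da u v Hd) as [Hu Hw]; split.
  - rewrite Rplus_0_r, Rminus_0_r.
    replace (_ + - (1) * H u 0%R) with (partial_sum f c d N u u - K u u); [apply H1, Hu|].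
    rewrite KH by (unfold Icc; lra).
    replace ((u + u) / 2)%R with u by field; replace ((u - u) / 2)%R with 0%R by field; ring.
  - rewrite Rplus_0_l; replace (0 - v)%R with (- v)%R by ring.
    replace (_ + - (1) * H 0%R v) with (partial_sum f c d N v (- v) - K v (- v)%R); [apply H2, Hw|].
    rewrite KH by (unfold Icc; lra).
    replace ((v + - v) / 2)%R with 0%R by field; replace ((v - - v) / 2)%R with v by field; ring. }
specialize (S SQ ST _ _ Hxt); cbv beta in S.
replace ((x + t) / 2 + (x - t) / 2)%R with x in S by field.
replace ((x + t) / 2 - (x - t) / 2)%R with t in S by field.
rewrite KH by (unfold Icc; lra).
replace (partial_sum f c d N x t - H ((x + t) / 2)%R ((x - t) / 2)%R)
  with (partial_sum f c d N x t + - (1) * H ((x + t) / 2)%R ((x - t) / 2)%R) by ring.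
eapply Rle_trans; [exact S|].
apply Rmult_le_compat_l; [lra|].
assert (Le : ((Q + 2) * (Rabs ((x + t) / 2) + Rabs ((x - t) / 2)) <= (Q + 2) * b)%R).
{ apply Rmult_le_compat_l; [lra|unfold diamond in Hxt; lra]. }
destruct Le as [Le|Le]; [apply Rlt_le, exp_increasing, Le|rewrite Le; lra].
Qed.

(** Boundary points of the square are approached from the interior, along the ray from the
    origin. *)
Lemma kernel_continuous_ray (x t : R) :
  Icc b x -> Icc b t ->
  filterlim (fun s : R => K (s * x)%R (s * t)%R)
    (within (fun s => 0 <= s <= 1)%R (locally 1%R)) (locally (T := C_UniformSpace) (K x t)).
Proof.
intros Hx Ht.
destruct HK as [H [[Hc _] KH]].
assert (In : forall s, (0 <= s <= 1)%R -> Icc b (s * x) /\ Icc b (s * t)).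
{ intros s Hs; unfold Icc in *; split; nra. }
rewrite (KH x t Hx Ht).
apply (filterlim_within_ext _ (fun s : R => H ((s * x + s * t) / 2)%R ((s * x - s * t) / 2)%R)).
{ intros s Hs; symmetry; apply KH; apply In; exact Hs. }
apply (filterlim_comp R (R * R) C
  (fun s => ((s * x + s * t) / 2, (s * x - s * t) / 2)%R)
  (fun p => H (fst p) (snd p)) _
  (within (fun p => goursat_domain b (fst p) (snd p)) (locally ((x + t) / 2, (x - t) / 2)%R))).
- intros P HP; unfold within in *.
  assert (CC : continuous (T := R_UniformSpace) (U := prod_UniformSpace R_UniformSpace R_UniformSpace)
     (fun s => ((s * x + s * t) / 2, (s * x - s * t) / 2)%R) 1%R).
  { apply (continuous_comp_2 (fun s => (s * x + s * t) / 2)%R (fun s => (s * x - s * t) / 2)%R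
      (fun a b => (a, b)) 1%R).
    - apply (ex_derive_continuous (V := R_NormedModule)); auto_derive; trivial.
    - apply (ex_derive_continuous (V := R_NormedModule)); auto_derive; trivial.
    - apply (continuous_ext (fun p => p)); [intros [a e]; reflexivity|apply continuous_id]. }
  assert (E : ((1 * x + 1 * t) / 2, (1 * x - 1 * t) / 2)%R = ((x + t) / 2, (x - t) / 2)%R)
    by (f_equal; field).
  unfold continuous in CC; rewrite E in CC.
  generalize (CC _ HP); unfold filtermap; apply filter_imp; intros s Hs Is; apply Hs.
  destruct (In s Is) as [I1 I2]; unfold Icc in I1, I2; simpl.
  repeat split; apply Rabs_le; lra.
- apply (Hc ((x + t) / 2, (x - t) / 2)%R); simpl.
  unfold Icc in Hx, Ht; repeat split; apply Rabs_le; lra.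
Qed.

Lemma stability_closed (N : nat) (B : R) :
  (forall x t, (- b < x < b)%R -> (- b < t < b)%R ->
     (Cmod (partial_sum f c d N x t - K x t) <= B)%R) ->
  forall x t, Icc b x -> Icc b t -> (Cmod (partial_sum f c d N x t - K x t) <= B)%R.
Proof.
intros HB x t Hx Ht; apply Rnot_lt_le; intros Hlt.
set (g := fun s : R => partial_sum f c d N (s * x)%R (s * t)%R - K (s * x)%R (s * t)%R).
assert (G : filterlim g (within (fun s => 0 <= s <= 1)%R (locally 1%R))
   (locally (T := C_UniformSpace) (partial_sum f c d N x t - K x t))).
{ apply (filterlim_comp_2 (H := locally (T := C_R_NormedModule) (- K x t))
    (G := locally (T := C_R_NormedModule) (partial_sum f c d N x t))
    (fun s : R => (partial_sum f c d N (s * x)%R (s * t)%R : C_R_NormedModule))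
    (fun s : R => (- K (s * x)%R (s * t)%R : C_R_NormedModule)) (fun a e => plus a e)).
  - eapply filterlim_filter_le_1; [apply filter_le_within|].
    assert (E : partial_sum f c d N x t = partial_sum f c d N (1 * x) (1 * t)) by (rewrite !Rmult_1_l; reflexivity).
    rewrite E.
    apply (partial_sum_cont f Hf Hn c d N R_UniformSpace (fun s => s * x)%R (fun s => s * t)%R 1%R);
    apply (ex_derive_continuous (V := R_NormedModule)); auto_derive; trivial.
  - eapply filterlim_comp; [apply kernel_continuous_ray; assumption|].
    apply (filterlim_opp (V := C_R_NormedModule)).
  - apply (filterlim_plus (V := C_R_NormedModule)). }
set (z := partial_sum f c d N x t - K x t) in *.
assert (GG := proj1 (filterlim_locally (U := C_UniformSpace) g z) G).
assert (NF := norm_factor_gt_0 (V := C_R_NormedModule)).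
set (k := @norm_factor R_AbsRing C_R_NormedModule) in *.
assert (Hs : (0 < (Cmod z - B) / k)%R) by (apply Rdiv_lt_0_compat; lra).
destruct (GG (mkposreal _ Hs)) as [e Hge].
set (s := Rmax 0 (1 - e / 2)).
assert (Hpe := cond_pos e).
assert (Ps : (0 <= s < 1 /\ 1 - e / 2 <= s)%R).
{ unfold s, Rmax; destruct (Rle_dec 0 (1 - e / 2)); lra. }
assert (Bs : ball 1%R e s).
{ unfold ball; simpl; unfold AbsRing_ball, abs, minus, plus, opp; simpl.
  rewrite Rabs_left; lra. }
specialize (Hge s Bs ltac:(lra)).
apply (norm_compat2 (V := C_R_NormedModule)) in Hge.
assert (L : (Cmod (g s - z) < (Cmod z - B))%R).
{ rewrite <- norm_CR.
  eapply Rlt_le_trans; [exact Hge|].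
  fold k; simpl; right; field; lra. }
assert (Gs : (Cmod (g s) <= B)%R).
{ apply HB; unfold Icc in *; nra. }
assert (T := Cmod_minus_le (g s) (g s - z)).
replace (g s - (g s - z)) with z in T by ring. lra.
Qed.

(** The partial sums minus the kernel solve one and the same Goursat problem, so that
    smallness on the two diagonals propagates to the square. *)
Theorem expansion_converges :
  (forall eps : R, (0 < eps)%R -> exists N0 : nat, forall N, (N0 <= N)%nat ->
     forall x, (- b < x < b)%R ->
       (Cmod (partial_sum f c d N x x - K x x) < eps)%R /\
       (Cmod (partial_sum f c d N x (- x) - K x (- x)%R) < eps)%R) ->
  converges_uniformly (fun p : R * R => Icc b (fst p) /\ Icc b (snd p))
    (fun N p => partial_sum f c d N (fst p) (snd p)) (fun p => K (fst p) (snd p)).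
Proof.
intros HT eps Heps.
(* 7 in place of the constant 6 of the estimate makes the final bound strict. *)
set (A := (7 * exp ((Q + 2) * b))%R).
assert (HA : (0 < A)%R) by (unfold A; generalize (exp_pos ((Q + 2) * b)); lra).
assert (He : (0 < eps / A)%R) by (apply Rdiv_lt_0_compat; assumption).
destruct (HT _ He) as [N0 HN]; exists N0; intros N HNN [x t] [Hx Ht]; simpl in *.
apply Rle_lt_trans with (6 * (eps / A) * exp ((Q + 2) * b))%R.
- apply (stability_closed N); [|exact Hx|exact Ht].
  apply stability_open; intros y Hy; apply Rlt_le, (HN N HNN y Hy).
- apply Rlt_le_trans with (eps / A * A)%R; [|right; field; lra].
  unfold A at 3; assert (E := exp_pos ((Q + 2) * b)); nra.
Qed.
End Core.

(** * Taylor coefficients, and the passage from f to 1/f *)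

Lemma Csum_components (a : nat -> C) (N : nat) :
  fst (Csum a 0 N) = sum_n (fun n => fst (a n)) N /\
  snd (Csum a 0 N) = sum_n (fun n => snd (a n)) N.
Proof.
induction N as [|N [IH1 IH2]]; [rewrite Csum_00, !sum_O; split; reflexivity|].
rewrite Csum_0S, !sum_Sn, <- IH1, <- IH2; split; reflexivity.
Qed.

(** Convergence at b/2 forces a positive radius of convergence, within which the series
    may be differentiated term by term. *)
Lemma real_power_series_coefficients (b : R) (a : nat -> R) (A : nat -> R -> R) :
  (0 < b)%R ->
  (forall t, (- b < t < b)%R ->
     is_lim_seq (fun N => sum_n (fun n => a n * t ^ n)%R N) (A 0%nat t)) ->
  (forall n t, (- b < t < b)%R -> is_derive (A n) t (A (S n) t)) ->
  forall n, A n 0%R = (a n * INR (fact n))%R.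
Proof.
intros Hb HA HD n.
assert (PS : forall t, (- b < t < b)%R -> is_pseries a t (A 0%nat t)).
{ intros t Ht; apply is_pseries_R; exact (HA t Ht). }
assert (CV : Rbar_lt 0 (CV_radius a)).
{ apply Rbar_lt_le_trans with (Rabs (b / 2)).
  - simpl; rewrite Rabs_pos_eq; lra.
  - apply Rbar_not_lt_le; intros H.
    apply (CV_disk_outside a (b / 2) H).
    apply ex_series_lim_0; exists (A 0%nat (b / 2)%R).
    apply is_pseries_R, PS; lra. }
rewrite <- Derive_n_coef by exact CV.
assert (DA : forall k t, (- b < t < b)%R -> Derive_n (A 0%nat) k t = A k t).
{ induction k as [|k IH]; intros t Ht; [reflexivity|simpl].
  apply is_derive_unique.
  apply (is_derive_ext_loc (A k)); [|apply HD; exact Ht].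
  generalize (locally_Ioo _ _ _ Ht); apply filter_imp; intros y Hy; symmetry; apply IH, Hy. }
rewrite <- DA by lra.
apply Derive_n_ext_loc.
assert (H0 : (- b < 0 < b)%R) by lra.
generalize (locally_Ioo _ _ _ H0); apply filter_imp; intros y Hy; symmetry.
apply is_pseries_unique, PS, Hy.
Qed.

Lemma power_series_coefficients (b : R) (a : nat -> C) (A : nat -> R -> C) :
  (0 < b)%R ->
  (forall t, (- b < t < b)%R -> forall eps, (0 < eps)%R -> exists N0, forall N, (N0 <= N)%nat ->
     (Cmod (Csum (fun n => (a n * RtoC t ^ n)%C) 0 N - A 0%nat t) < eps)%R) ->
  (forall n t, (- b < t < b)%R -> cder (A n) t (A (S n) t)) ->
  forall n, a n = A n 0%R / INR (fact n).
Proof.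
intros Hb HA HD n.
assert (F := INR_fact_neq_0 n).
assert (PF : forall t k, fst (a k * RtoC t ^ k) = (fst (a k) * t ^ k)%R /\
                         snd (a k * RtoC t ^ k) = (snd (a k) * t ^ k)%R).
{ intros t k; rewrite <- RtoC_pow; simpl; split; ring. }
assert (R1 : A n 0%R = a n * INR (fact n)).
{ apply injective_projections; simpl; rewrite ?Rmult_0_r, ?Rminus_0_r, ?Rplus_0_l, ?Rplus_0_r.
  - apply (real_power_series_coefficients b (fun n => fst (a n)) (fun n t => fst (A n t)) Hb).
    + intros t Ht; apply is_lim_seq_spec; intros eps.
      destruct (HA t Ht eps (cond_pos eps)) as [N0 HN]; exists N0; intros N HNN.
      eapply Rle_lt_trans; [|exact (HN N HNN)].
      eapply Rle_trans; [|apply Rmax_Cmod]; eapply Rle_trans; [|apply Rmax_l].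
      unfold Cminus, Cplus, Copp; cbn [fst snd]; rewrite (proj1 (Csum_components _ _)).
      right; apply (f_equal (fun z => Rabs (z - _))), (sum_n_ext (G := R_AbelianMonoid)); intros k; symmetry; apply PF.
    + intros k t Ht; apply (cder_components (A k)), HD, Ht.
  - apply (real_power_series_coefficients b (fun n => snd (a n)) (fun n t => snd (A n t)) Hb).
    + intros t Ht; apply is_lim_seq_spec; intros eps.
      destruct (HA t Ht eps (cond_pos eps)) as [N0 HN]; exists N0; intros N HNN.
      eapply Rle_lt_trans; [|exact (HN N HNN)].
      eapply Rle_trans; [|apply Rmax_Cmod]; eapply Rle_trans; [|apply Rmax_r].
      unfold Cminus, Cplus, Copp; cbn [fst snd]; rewrite (proj2 (Csum_components _ _)).
      right; apply (f_equal (fun z => Rabs (z - _))), (sum_n_ext (G := R_AbelianMonoid)); intros k; symmetry; apply PF.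
    + intros k t Ht; apply (cder_components (A k)), HD, Ht. }
rewrite R1; field; intros E; apply F; apply RtoC_inj; exact E.
Qed.

Lemma partial_sum_x0 (f : R -> C) (c d : nat -> C) (N : nat) (t : R) :
  f 0%R = 1 ->
  partial_sum f c d N 0 t =
  Csum (fun n => (if Nat.even n then c n else d n) * RtoC t ^ n) 0 N.
Proof.
intros H0; apply Csum_ext; intros n _; cbv beta; unfold wave.
rewrite !evenodd_part_x0 by (try reflexivity; intros; apply formal_power_at0).
rewrite H0; destruct (Nat.even n); simpl; ring.
Qed.

Lemma kernel_traces (b : R) (q : R -> C) (h : C) (K : R -> R -> C) (x : R) :
  transmutation_kernel b q h K -> Icc b x ->
  K x x = h / 2 + / 2 * CInt q 0 x /\ K x (- x)%R = h / 2.
Proof.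
intros [H [[_ [_ [H1 H2]]] KH]] Hx.
assert (Hx' : Icc b (- x)%R) by (unfold Icc in *; lra).
rewrite !KH by assumption; split.
- replace ((x + x) / 2)%R with x by field; replace ((x - x) / 2)%R with 0%R by field; apply H1, Hx.
- replace ((x + - x) / 2)%R with 0%R by field; replace ((x - - x) / 2)%R with x by field; apply H2, Hx.
Qed.

Lemma cRInt_const_bound (J : R -> C) (x : R) (l : C) (M : R) :
  (forall r, (Rmin 0 x <= r <= Rmax 0 x)%R -> (Cmod (J r) <= M)%R) ->
  cRInt J 0 x l -> (Cmod l <= Rabs x * M)%R.
Proof.
intros HJ HI; rewrite <- norm_CR; replace (Rabs x) with (Rabs (x - 0)) by (f_equal; ring).
apply (norm_RInt_le_const_abs (V := C_R_NormedModule) J 0 x); [|exact HI].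
intros r Hr; rewrite norm_CR; apply HJ, Hr.
Qed.

Section Transfer.
Context (b : R) (f f1 : R -> C) (F F1 : R).
Hypothesis Hb : (0 < b)%R.
Hypothesis Hf1 : forall x, (- b < x < b)%R -> cder f x (f1 x).
Hypothesis Cf1 : forall x, (- b < x < b)%R -> ccont f1 x.
Hypothesis BF : forall x, (- b < x < b)%R -> (Cmod (f x) <= F)%R.
Hypothesis BF1 : forall x, (- b < x < b)%R -> (Cmod (f1 x) <= F1)%R.

(** (P - f p)' = -2 f' p, where p' no longer occurs; hence a bound of p alone bounds P.
    This is why uniform convergence of the traces, without their derivatives, is enough. *)
Lemma transfer_bound (p p' P : R -> C) (e : R) :
  (forall x, (- b < x < b)%R -> cder p x (p' x)) ->
  (forall x, (- b < x < b)%R -> cder P x (f x * p' x - f1 x * p x)) ->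
  P 0%R = 0 ->
  (forall x, (- b < x < b)%R -> (Cmod (p x) <= e)%R) ->
  forall x, (- b < x < b)%R -> (Cmod (P x) <= (2 * F + 2 * F1 * b) * e)%R.
Proof.
intros Hp HP P0 He x Hx.
assert (Iz : forall r, (Rmin 0 x <= r <= Rmax 0 x)%R -> (- b < r < b)%R).
{ intros r Hr; unfold Rmin, Rmax in Hr; destruct (Rle_dec 0 x); lra. }
assert (I : cRInt (fun x => - (2) * (f1 x * p x)) 0 x
   ((P x - f x * p x) - (P 0%R - f 0%R * p 0%R))).
{ apply (cRInt_derive (fun x => P x - f x * p x)).
  - intros r Hr; eapply cder_eq.
    + apply cder_minus; [apply HP, Iz, Hr|].
      apply cder_mult; [apply Hf1, Iz, Hr|apply Hp, Iz, Hr].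
    + cbv beta; ring.
  - intros r Hr; apply continuous_Cmult; [apply continuous_Cconst|].
    apply continuous_Cmult; [apply Cf1, Iz, Hr|].
    eapply cder_continuous, Hp, Iz, Hr. }
assert (F0 : (0 <= F)%R) by (eapply Rle_trans; [apply Cmod_ge_0|apply (BF 0%R); lra]).
assert (F10 : (0 <= F1)%R) by (eapply Rle_trans; [apply Cmod_ge_0|apply (BF1 0%R); lra]).
assert (e0 : (0 <= e)%R) by (eapply Rle_trans; [apply Cmod_ge_0|apply (He 0%R); lra]).
assert (B : (Cmod ((P x - f x * p x) - (P 0%R - f 0%R * p 0%R)) <= Rabs x * (2 * (F1 * e)))%R).
{ apply (cRInt_const_bound _ x _ _) with (2 := I).
  intros r Hr; rewrite !Cmod_mult, Cmod_opp, Cmod_R, Rabs_pos_eq by lra.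
  apply Rmult_le_compat_l; [lra|apply Rmult_le_compat; try apply Cmod_ge_0].
  - apply BF1, Iz, Hr.
  - apply He, Iz, Hr. }
assert (Bx : (Rabs x <= b)%R) by (apply Rabs_le; lra).
assert (B1 : (Cmod (f x * p x) <= F * e)%R).
{ rewrite Cmod_mult; apply Rmult_le_compat; try apply Cmod_ge_0; [apply BF|apply He]; exact Hx. }
assert (B2 : (Cmod (f 0%R * p 0%R) <= F * e)%R).
{ rewrite Cmod_mult; apply Rmult_le_compat; try apply Cmod_ge_0; [apply BF|apply He]; lra. }
rewrite P0 in B.
replace (P x) with ((P x - f x * p x - (0 - f 0%R * p 0%R)) + (f x * p x - f 0%R * p 0%R)) by ring.
eapply Rle_trans; [apply Cmod_triangle|].
assert (B3 := Cmod_minus_le (f x * p x) (f 0%R * p 0%R)).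
assert (B4 : (Rabs x * (2 * (F1 * e)) <= b * (2 * (F1 * e)))%R).
{ apply Rmult_le_compat_r; [nra|exact Bx]. }
nra.
Qed.
End Transfer.

Lemma wave_inv (f : R -> C) (Hn : forall x, f x <> 0) (p : bool) (m : nat) (x t : R) :
  wave (fun y => / f y) p m x t = / f x * evenodd_part (dual_power f) p m x t.
Proof.
unfold wave, evenodd_part; f_equal; apply Csum_ext; intros k _; cbv beta.
rewrite formal_power_inv by exact Hn; reflexivity.
Qed.

(** The even or odd part of a partial sum on the diagonal t = x, and (up to the factor 1/f)
    the corresponding sum for 1/f. *)
Definition trace (f : R -> C) (p : bool) (c : nat -> C) (N : nat) (x : R) : C :=
  Csum (fun n => c n * wave f p n x x) 0 N.
Definition dual_trace (f : R -> C) (p : bool) (c : nat -> C) (N : nat) (x : R) : C :=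
  Csum (fun n => c n * evenodd_part (dual_power f) p n x x) 0 N.

Lemma wave_opp (f : R -> C) (p : bool) (m : nat) (x t : R) :
  wave f p m x (- t) = if p then wave f p m x t else - wave f p m x t.
Proof. unfold wave; rewrite evenodd_part_opp; destruct p; ring. Qed.

Lemma partial_sum_diag (f : R -> C) (c d : nat -> C) (N : nat) (x : R) :
  partial_sum f c d N x x = trace f true c N x + trace f false d N x.
Proof. unfold partial_sum, trace; rewrite <- Csum_plus; reflexivity. Qed.

Lemma partial_sum_antidiag (f : R -> C) (c d : nat -> C) (N : nat) (x : R) :
  partial_sum f c d N x (- x) = trace f true c N x - trace f false d N x.
Proof.
unfold partial_sum, trace.
replace (_ - _) with (Csum (fun n => c n * wave f true n x x) 0 N +
  - (1) * Csum (fun n => d n * wave f false n x x) 0 N) by ring.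
rewrite Csum_mult_l, <- Csum_plus; apply Csum_ext; intros k _; cbv beta.
rewrite !wave_opp; ring.
Qed.

Lemma trace_inv (f : R -> C) (Hn : forall x, f x <> 0) (p : bool) (c : nat -> C) (N : nat) (x : R) :
  trace (fun y => / f y) p (fun n => - c n) N x = - (/ f x * dual_trace f p c N x).
Proof.
unfold trace, dual_trace.
replace (- (/ f x * Csum (fun n => c n * evenodd_part (dual_power f) p n x x) 0 N))
  with ((- / f x) * Csum (fun n => c n * evenodd_part (dual_power f) p n x x) 0 N) by ring.
rewrite Csum_mult_l; apply Csum_ext; intros k _; cbv beta.
rewrite wave_inv by exact Hn; ring.
Qed.

Lemma dual_trace_0 (f : R -> C) (p : bool) (c : nat -> C) (N : nat) :
  dual_trace f p c N 0 = if p then c 0%nat else 0.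
Proof.
unfold dual_trace.
assert (Z : forall n, evenodd_part (dual_power f) p n 0 0 =
  match n with O => if p then 1 else 0 | S _ => 0 end).
{ intros n; rewrite evenodd_part_x0 by (try reflexivity; intros; apply dual_power_at0).
  destruct n; [destruct p; reflexivity|]. rewrite Cpow_S.
  destruct (Bool.eqb (Nat.even (S n)) p); ring. }
induction N as [|N IH].
- rewrite Csum_00, Z; destruct p; ring.
- rewrite Csum_0S, IH, Z; ring.
Qed.

Lemma trace_0 (f : R -> C) (p : bool) (c : nat -> C) (N : nat) :
  f 0%R = 1 -> trace f p c N 0 = if p then c 0%nat else 0.
Proof.
intros H0; unfold trace.
assert (Z : forall n, wave f p n 0 0 =
  match n with O => if p then 1 else 0 | S _ => 0 end).
{ intros n; unfold wave; rewrite evenodd_part_x0 by (try reflexivity; intros; apply formal_power_at0).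
  rewrite H0; destruct n; [destruct p; simpl; ring|]. rewrite Cpow_S.
  destruct (Bool.eqb (Nat.even (S n)) p); ring. }
induction N as [|N IH].
- rewrite Csum_00, Z; destruct p; ring.
- rewrite Csum_0S, IH, Z; ring.
Qed.

(** The conjugacy of the wave polynomials of f and 1/f, restricted to the diagonal. *)
Lemma trace_derive (f : R -> C) (f1 : R -> C) (Hf : forall x, ccont f x) (Hn : forall x, f x <> 0)
    (p : bool) (c : nat -> C) (N : nat) (x : R) :
  cder f x (f1 x) ->
  exists l, cder (trace f p c N) x l /\
    cder (dual_trace f (negb p) c N) x (f x * l - f1 x * trace f p c N x).
Proof.
intros Hd.
set (E' := fun n => INR n * (/ (f x ^ 2) * evenodd_part (dual_power f) p (pred n) x x
              + RtoC 1 * evenodd_part (formal_power f) (negb p) (pred n) x x)).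
assert (P1 : is_derive (fun y : R => y) x 1%R) by (auto_derive; [trivial|ring]).
exists (Csum (fun n => c n * (f1 x * evenodd_part (formal_power f) p n x x + f x * E' n)) 0 N).
split.
- unfold trace; apply (cder_Csum (fun n x => c n * wave f p n x x)).
  intros n _; apply cder_scal.
  apply (cder_mult f (fun y => evenodd_part (formal_power f) p n y y)); [exact Hd|].
  apply (cder_Y f Hf Hn p n (fun y => y) (fun y => y) x 1); assumption.
- unfold dual_trace; eapply cder_eq.
  + apply (cder_Csum (fun n x => c n * evenodd_part (dual_power f) (negb p) n x x)).
    intros n _; apply cder_scal.
    apply (cder_Z f Hf Hn (negb p) n (fun y => y) (fun y => y) x 1); assumption.
  + cbv beta; unfold trace.
    replace (f x * _ - f1 x * _) with
      (f x * Csum (fun n => c n * (f1 x * evenodd_part (formal_power f) p n x x + f x * E' n)) 0 N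
       + (- f1 x) * Csum (fun n => c n * wave f p n x x) 0 N) by ring.
    rewrite !Csum_mult_l, <- Csum_plus; apply Csum_ext; intros n _; cbv beta.
    unfold E', wave; rewrite negb_involutive; field; apply Hn.
Qed.

Section Darboux.
Context (b : R) (q f f1 : R -> C) (F F1 G : R).
Hypothesis Hb : (0 < b)%R.
Hypothesis Hf : forall x, ccont f x.
Hypothesis Hn : forall x, f x <> 0.
Hypothesis H0 : f 0%R = 1.
Hypothesis Hf1 : forall x, (- b < x < b)%R -> cder f x (f1 x).
Hypothesis Hf2 : forall x, (- b < x < b)%R -> cder f1 x (q x * f x).
Hypothesis Hq : forall x, (- b < x < b)%R -> ccont q x.
Hypothesis BF : forall x, (- b < x < b)%R -> (Cmod (f x) <= F)%R.
Hypothesis BF1 : forall x, (- b < x < b)%R -> (Cmod (f1 x) <= F1)%R.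
Hypothesis BG : forall x, (- b < x < b)%R -> (Cmod (/ f x) <= G)%R.

(** Applied to p = trace - g and P = dual trace - L, where L is the solution of the same
    relation L' = f g' - f' g for the limit g. *)
Lemma dual_trace_bound (p : bool) (c : nat -> C) (N : nat) (g g' L : R -> C) (e : R) :
  (forall x, (- b < x < b)%R -> cder g x (g' x)) ->
  (forall x, (- b < x < b)%R -> cder L x (f x * g' x - f1 x * g x)) ->
  L 0%R = (if p then 0 else c 0%nat) ->
  (forall x, (- b < x < b)%R -> (Cmod (trace f p c N x - g x) <= e)%R) ->
  forall x, (- b < x < b)%R ->
    (Cmod (dual_trace f (negb p) c N x - L x) <= (2 * F + 2 * F1 * b) * e)%R.
Proof.
intros Hg HL L0 He x Hx.
assert (Ex : forall y, exists l, (- b < y < b)%R -> cder (trace f p c N) y l /\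
    cder (dual_trace f (negb p) c N) y (f y * l - f1 y * trace f p c N y)).
{ intros y; destruct (Rlt_dec (- b) y); [|exists 0; intros; lra].
  destruct (Rlt_dec y b); [|exists 0; intros; lra].
  destruct (trace_derive f f1 Hf Hn p c N y) as [l Hl]; [apply Hf1; lra|].
  exists l; intros _; exact Hl. }
(* A choice of the derivative of the trace that is a function of the point. *)
set (T' := fun y => iota (T := C_R_CompleteNormedModule) (fun l => cder (trace f p c N) y l)).
assert (HT : forall y, (- b < y < b)%R -> cder (trace f p c N) y (T' y) /\
    cder (dual_trace f (negb p) c N) y (f y * T' y - f1 y * trace f p c N y)).
{ intros y Hy; destruct (Ex y) as [l Hl]; destruct (Hl Hy) as [A B].
  replace (T' y) with l; [split; assumption|].
  symmetry; apply (iota_unique (V := C_R_CompleteNormedModule)); [|exact A].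
  intros z Hz; exact (cder_unique _ _ _ _ Hz A). }
apply (transfer_bound b f f1 F F1 Hb Hf1 ltac:(intros; eapply cder_continuous, Hf2; assumption) BF BF1
   (fun y => trace f p c N y - g y) (fun y => T' y - g' y)
   (fun y => dual_trace f (negb p) c N y - L y) e); try assumption.
- intros y Hy; apply cder_minus; [apply HT|apply Hg]; exact Hy.
- intros y Hy; eapply cder_eq; [apply cder_minus; [apply HT|apply HL]; exact Hy|]. cbv beta; ring.
- rewrite dual_trace_0, L0; destruct p; simpl; ring.
Qed.

Lemma log_derivative_derive (x : R) : (- b < x < b)%R ->
  cder (fun y => f1 y / f y) x (q x - (f1 x / f x) ^ 2).
Proof.
intros Hx; eapply cder_eq.
- apply (cder_mult f1 (fun y => / f y)); [apply Hf2, Hx|].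
  apply cder_inv; [apply Hf1, Hx|apply Hn].
- field; apply Hn.
Qed.

Context (qi : R -> C).
Hypothesis Hqi : forall x, (- b < x < b)%R -> qi x = - q x + 2 * (f1 x / f x) ^ 2.

Lemma inv_potential_cont (x : R) : (- b < x < b)%R -> ccont qi x.
Proof.
intros Hx.
unfold ccont; apply (continuous_ext_loc (U := C_UniformSpace) _ (fun x => - q x + 2 * (f1 x / f x) ^ 2)).
- generalize (locally_Ioo _ _ _ Hx); apply filter_imp; intros y Hy; symmetry; apply Hqi, Hy.
- assert (P : ccont (fun y => f1 y / f y) x) by (eapply cder_continuous, log_derivative_derive, Hx).
  apply continuous_Cplus; [apply continuous_Copp, Hq, Hx|].
  apply continuous_Cmult; [apply continuous_Cconst|].
  apply (continuous_Cmult _ (fun y => f1 y / f y) (fun y => (f1 y / f y) ^ 1)); [exact P|].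
  apply (continuous_Cmult _ (fun y => f1 y / f y) (fun y => 1)); [exact P|apply continuous_Cconst].
Qed.

Lemma inv_solution (x : R) : (- b < x < b)%R ->
  cder (fun y => / f y) x (- f1 x / f x ^ 2) /\
  cder (fun y => - f1 y / f y ^ 2) x (qi x * / f x).
Proof.
intros Hx; split; [apply cder_inv; [apply Hf1, Hx|apply Hn]|].
eapply cder_eq.
- apply (cder_mult (fun y => - f1 y) (fun y => / f y ^ 2)).
  + apply cder_opp, Hf2, Hx.
  + apply cder_inv; [|apply Cpow_nz, Hn].
    apply (cder_mult f (fun y => f y ^ 1)); [apply Hf1, Hx|].
    apply (cder_mult f (fun y => 1)); [apply Hf1, Hx|apply cder_const].
- rewrite Hqi by exact Hx; simpl; field; apply Hn.
Qed.

Lemma CInt_q_derive (r : R -> C) (x : R) :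
  (forall x, (- b < x < b)%R -> ccont r x) -> (- b < x < b)%R ->
  cder (fun y => CInt r 0 y) x (r x).
Proof. intros Hr Hx; apply (CInt_derive r (- b) b); [exact Hr|lra|exact Hx]. Qed.

(** q_{1/f} = q_f - 2 (f'/f)'. *)
Lemma CInt_inv_potential (x : R) : (- b < x < b)%R ->
  CInt qi 0 x = CInt q 0 x - 2 * (f1 x / f x - f1 0%R).
Proof.
intros Hx.
assert (E : (fun y => CInt qi 0 y - (CInt q 0 y - 2 * (f1 y / f y))) x
  = (fun y => CInt qi 0 y - (CInt q 0 y - 2 * (f1 y / f y))) 0%R).
{ apply (cder_zero_const (- b) b (fun y => CInt qi 0 y - (CInt q 0 y - 2 * (f1 y / f y))) x 0);
    [|exact Hx|lra].
  intros t Ht; eapply cder_eq.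
  - apply cder_minus; [apply CInt_q_derive; [apply inv_potential_cont|exact Ht]|].
    apply cder_minus; [apply CInt_q_derive; [exact Hq|exact Ht]|].
    apply cder_scal, log_derivative_derive, Ht.
  - rewrite Hqi by exact Ht; ring. }
cbv beta in E; rewrite !CInt_point, H0 in E.
replace (CInt qi 0 x) with ((CInt qi 0 x - (CInt q 0 x - 2 * (f1 x / f x))) + (CInt q 0 x - 2 * (f1 x / f x))) by ring.
rewrite E; field; apply Hn.
Qed.

Context (h : C) (Ki : R -> R -> C) (c d : nat -> C).
Hypothesis Hh : h = f1 0%R.
Hypothesis HKi : transmutation_kernel b qi (- h) Ki.
Hypothesis Hd0 : d 0%nat = h / 2.

Ltac nonzero := repeat split; first [apply Hn | intros EE; apply RtoC_inj in EE; lra].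

(** The limits of the dual traces are L1 and L2 below, and -(L2 + L1)/f, -(L2 - L1)/f are
    the traces of K_{1/f}.  The series for 1/f starts with the constant term d 0 = h/2,
    inherited from the value c_0 = h/2 of the trace at the origin; d 0 multiplies the
    function 0 in the series for f. *)
Lemma inv_traces_bound (N : nat) (e : R) :
  (forall x, (- b < x < b)%R ->
     (Cmod (trace f true c N x - (h / 2 + / 4 * CInt q 0 x)) <= e)%R) ->
  (forall x, (- b < x < b)%R ->
     (Cmod (trace f false d N x - / 4 * CInt q 0 x) <= e)%R) ->
  forall x, (- b < x < b)%R ->
    let A := (2 * G * (2 * F + 2 * F1 * b) * e)%R in
    (Cmod (partial_sum (fun y => / f y)%C (fun n => - d n)%C (fun n => - c n)%C N x x - Ki x x) <= A)%R /\
    (Cmod (partial_sum (fun y => / f y)%C (fun n => - d n)%C (fun n => - c n)%C N x (- x) - Ki x (- x)%R) <= A)%R.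
Proof.
intros H1 H2 x Hx A.
assert (Dq : forall y, (- b < y < b)%R -> cder (fun y => / 4 * CInt q 0 y) y (/ 4 * q y)).
{ intros y Hy; apply cder_scal, CInt_q_derive; assumption. }
(* With G' = q/4 and f'' = q f, f'/2 - f G is a primitive of f G' - f' G; the term
   -f h/2 of L1 accounts for the constant h/2 in g1 = h/2 + G. *)
set (L1 := fun y : R => (/ 2 * (f1 y - f y * h) - f y * (/ 4 * CInt q 0 y))%C).
set (L2 := fun y : R => (/ 2 * f1 y - f y * (/ 4 * CInt q 0 y))%C).
assert (B1 : (Cmod (dual_trace f false c N x - L1 x) <= (2 * F + 2 * F1 * b) * e)%R).
{ apply (dual_trace_bound true c N (fun y => h / 2 + / 4 * CInt q 0 y) (fun y => / 4 * q y) L1 e); try assumption.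
  - intros y Hy; eapply cder_eq; [apply cder_plus; [apply cder_const|apply Dq, Hy]|]. ring.
  - intros y Hy; eapply cder_eq.
    + apply (cder_minus (fun y => / 2 * (f1 y - f y * h)) (fun y => f y * (/ 4 * CInt q 0 y))).
      * apply cder_scal, cder_minus; [apply Hf2, Hy|].
        apply (cder_mult f (fun _ => h)); [apply Hf1, Hy|apply cder_const].
      * apply cder_mult; [apply Hf1, Hy|apply Dq, Hy].
    + cbv beta; field; nonzero.
  - unfold L1; rewrite CInt_point, H0, Hh; ring. }
assert (B2 : (Cmod (dual_trace f true d N x - L2 x) <= (2 * F + 2 * F1 * b) * e)%R).
{ apply (dual_trace_bound false d N (fun y => / 4 * CInt q 0 y) (fun y => / 4 * q y) L2 e); try assumption.
  - intros y Hy; eapply cder_eq.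
    + apply (cder_minus (fun y => / 2 * f1 y) (fun y => f y * (/ 4 * CInt q 0 y))).
      * apply cder_scal, Hf2, Hy.
      * apply cder_mult; [apply Hf1, Hy|apply Dq, Hy].
    + cbv beta; field; nonzero.
  - unfold L2; rewrite CInt_point, Hd0, Hh; field; nonzero. }
assert (Ix : Icc b x) by (unfold Icc; lra).
destruct (kernel_traces b qi (- h) Ki x HKi Ix) as [K1 K2].
assert (E1 : Ki x x = - (/ f x * (L2 x + L1 x))).
{ rewrite K1, CInt_inv_potential by exact Hx; rewrite <- Hh; unfold L1, L2.
  field; nonzero. }
assert (E2 : Ki x (- x)%R = - (/ f x * (L2 x - L1 x))).
{ rewrite K2; unfold L1, L2.
  field; nonzero. }
rewrite partial_sum_diag, partial_sum_antidiag, !trace_inv by exact Hn.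
rewrite E1, E2.
assert (G0 : (0 <= G)%R) by (eapply Rle_trans; [apply Cmod_ge_0|apply (BG x Hx)]).
set (D1 := dual_trace f false c N x - L1 x) in *.
set (D2 := dual_trace f true d N x - L2 x) in *.
assert (BGx := BG x Hx).
assert (P1 := Cmod_ge_0 D1); assert (P2 := Cmod_ge_0 D2); assert (P3 := Cmod_ge_0 (/ f x)).
split.
- replace (_ - _) with (- (/ f x * (D2 + D1))) by (unfold D1, D2; ring).
  rewrite Cmod_opp, Cmod_mult.
  assert (T := Cmod_triangle D2 D1); unfold A.
  apply Rle_trans with (G * (2 * ((2 * F + 2 * F1 * b) * e)))%R; [|right; ring].
  apply Rmult_le_compat; try apply Cmod_ge_0; lra.
- replace (_ - _) with (- (/ f x * (D2 - D1))) by (unfold D1, D2; ring).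
  rewrite Cmod_opp, Cmod_mult.
  assert (T := Cmod_minus_le D2 D1); unfold A.
  apply Rle_trans with (G * (2 * ((2 * F + 2 * F1 * b) * e)))%R; [|right; ring].
  apply Rmult_le_compat; try apply Cmod_ge_0; lra.
Qed.
End Darboux.

(** * Smoothness of the kernel on the line x = 0 *)

Lemma Binomial_C_0 (n : nat) : Binomial.C n 0 = 1%R.
Proof.
unfold Binomial.C; rewrite Nat.sub_0_r; change (INR (fact 0)) with 1%R.
field; apply INR_fact_neq_0.
Qed.

Lemma Binomial_C_n (n : nat) : Binomial.C n n = 1%R.
Proof.
unfold Binomial.C; rewrite Nat.sub_diag; change (INR (fact 0)) with 1%R.
field; apply INR_fact_neq_0.
Qed.

(** The inductive step of the Leibniz rule for the k-th derivative of a product: Pascal's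
    rule. *)
Lemma leibniz_sum (P U : nat -> C) (k : nat) :
  Csum (fun j => Binomial.C k j * (P (S j) * U (k - j)%nat + P j * U (S (k - j)))) 0 k =
  Csum (fun j => Binomial.C (S k) j * P j * U (S k - j)%nat) 0 (S k).
Proof.
rewrite (Csum_ext _ (fun j => Binomial.C k j * P (S j) * U (k - j)%nat +
   Binomial.C k j * P j * U (S (k - j)))) by (intros; ring).
rewrite Csum_plus, Csum_head, Binomial_C_0, Nat.sub_0_r.
destruct k as [|k].
{ rewrite !Csum_00, Nat.sub_0_r, !Binomial_C_n; cbn [Nat.sub]; ring. }
rewrite Csum_0S, (Csum_head _ k), Csum_0S, !Binomial_C_0, !Binomial_C_n, !Nat.sub_0_r, !Nat.sub_diag.
assert (E : Csum (fun j => Binomial.C (S (S k)) (S j) * P (S j) * U (S (S k) - S j)%nat) 0 k =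
  Csum (fun j => Binomial.C (S k) j * P (S j) * U (S k - j)%nat) 0 k +
  Csum (fun j => Binomial.C (S k) (S j) * P (S j) * U (S (S k - S j))) 0 k).
{ rewrite <- Csum_plus; apply Csum_ext; intros j Hj; cbv beta.
  rewrite <- pascal by lia.
  replace (S (S k) - S j)%nat with (S k - j)%nat by lia.
  replace (S (S k - S j))%nat with (S k - j)%nat by lia.
  rewrite RtoC_plus; ring. }
rewrite E; ring.
Qed.

Lemma limit_point_True (x : R) : limit_point (fun _ => True) x.
Proof.
intros d; exists (x + d / 2)%R; assert (H := cond_pos d); repeat split; [lra|].
replace (x + d / 2 - x)%R with (d / 2)%R by ring; rewrite Rabs_pos_eq; lra.
Qed.

Lemma Derive_on_cder (g : R -> C) (x : R) (l : C) :
  cder g x l -> Derive_on (fun _ => True) g x = l.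
Proof.
intros H; apply Derive_on_unique; [trivial|apply limit_point_True|].
apply cder_derive_on; [trivial|exact H].
Qed.

Lemma cder_sum_arg (g : R -> C) (u r : R) (l : C) :
  cder g (u + r)%R l -> cder (fun y => g (y + r)%R) u l.
Proof.
intros H; eapply cder_eq.
- apply (cder_comp g (fun y => y + r)%R u 1 l H); auto_derive; [trivial|ring].
- ring.
Qed.

Lemma hexagon_sum (b u v : R) : hexagon b u v -> (- b < u + v < b)%R.
Proof. intros [_ [_ H]]; apply Rabs_open, H. Qed.

Section Smooth.
Context (b : R) (Qs a : nat -> R -> C) (W W1 : R -> R -> C).
Hypothesis HQ : forall n x, (- b < x < b)%R -> cder (Qs n) x (Qs (S n) x).
Hypothesis Ha : forall n x, (- b < x < b)%R -> cder (a n) x (a (S n) x).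
Hypothesis HW : forall u v, hexagon b u v -> ccont2 W u v.
Hypothesis HWd : forall u v, hexagon b u v -> cder (fun y => W y v) u (W1 u v).
Hypothesis HW1 : forall u v, hexagon b u v ->
  W1 u v = a 0%nat u + CInt (fun r => Qs 0%nat (u + r)%R * W u r) 0 v.

Definition leibniz (U : nat -> R -> R -> C) (d : nat) (u v : R) : C :=
  Csum (fun j => Binomial.C d j * Qs j (u + v)%R * U (d - j)%nat u v) 0 d.

Definition iterated (d : nat) (u v : R) : C :=
  Derive_n_on (fun _ => True) (fun y => W y v) d u.

Lemma leibniz_cont (U : nat -> R -> R -> C) (d : nat) (u v : R) :
  (forall k, (k <= d)%nat -> ccont2 (U k) u v) -> hexagon b u v ->
  ccont2 (leibniz U d) u v.
Proof.
intros HU H.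
apply (continuous_Csum _ (fun j (p : R * R) => Binomial.C d j * Qs j (fst p + snd p)%R * U (d - j)%nat (fst p) (snd p))).
intros j Hj; apply continuous_Cmult; [apply continuous_Cmult|].
- apply continuous_Cconst.
- apply (ccont2_sum_arg (Qs j)); eapply cder_continuous, HQ, hexagon_sum, H.
- apply (HU (d - j)%nat); lia.
Qed.

Lemma leibniz_derive (U : nat -> R -> R -> C) (d : nat) (u v : R) :
  (forall k, (k <= d)%nat -> cder (fun y => U k y v) u (U (S k) u v)) -> hexagon b u v ->
  cder (fun y => leibniz U d y v) u (leibniz U (S d) u v).
Proof.
intros HU H; unfold leibniz; rewrite <- (leibniz_sum (fun j => Qs j (u + v)%R) (fun j => U j u v)).
apply (cder_Csum (fun j y => Binomial.C d j * Qs j (y + v)%R * U (d - j)%nat y v)).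
intros j Hj; eapply cder_eq.
- apply (cder_mult (fun y => Binomial.C d j * Qs j (y + v)%R) (fun y => U (d - j)%nat y v)).
  + apply (cder_scal (Binomial.C d j)), cder_sum_arg, HQ, hexagon_sum, H.
  + apply HU; lia.
- cbv beta; ring.
Qed.

Lemma cont_fst (g : R -> C) (u v : R) : ccont g u -> ccont2 (fun x _ => g x) u v.
Proof.
intros H; apply (continuous_comp (fun p : R * R => fst p) g); [apply continuous_fst|exact H].
Qed.

(** From U_{k+1} = a_k + int_0^v d_u^k (q W), the derivative of order k+2 exists: the
    integrand is a Leibniz sum of derivatives of W of order at most k, all of which are
    already known to be differentiable. *)
Lemma iterated_spec (d : nat) :
  (forall k u v, (k <= d)%nat -> hexagon b u v -> ccont2 (iterated k) u v) /\
  (forall k u v, (k < d)%nat -> hexagon b u v ->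
     cder (fun y => iterated k y v) u (iterated (S k) u v)) /\
  (forall k u v, (k < d)%nat -> hexagon b u v ->
     iterated (S k) u v = a k u + CInt (leibniz iterated k u) 0 v).
Proof.
assert (SH := hexagon_star b).
assert (Hex : forall u v, hexagon b u v -> (- b < u < b)%R).
{ intros u v [H _]; apply Rabs_open, H. }
induction d as [|d [IC [ID IF]]].
{ split; [|split; intros; lia].
  intros k u v Hk H; replace k with 0%nat by lia; apply HW, H. }
assert (LC : forall u v, hexagon b u v -> ccont2 (leibniz iterated d) u v).
{ intros u v H; apply leibniz_cont; [intros; apply IC; assumption|exact H]. }
assert (DD : forall u v, hexagon b u v ->
   cder (fun y => iterated d y v) u (a d u + CInt (leibniz iterated d u) 0 v)).
{ intros u v H; destruct d as [|d].
  - eapply cder_eq; [apply HWd, H|].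
    rewrite HW1 by exact H; f_equal; apply CInt_ext; intros r _; unfold leibniz.
    rewrite Csum_00, Binomial_C_0; change (iterated (0 - 0) u r) with (W u r); ring.
  - apply (cder_ext_loc (fun y => a d y + CInt (leibniz iterated d y) 0 v)).
    + generalize (locally_2d_slice_l _ _ _ (star_locally _ SH u v H)); apply filter_imp.
      intros y Hy; symmetry; apply IF; [lia|exact Hy].
    + apply cder_plus; [apply Ha, (Hex u v H)|].
      apply (cder_CInt_param (hexagon b) SH (leibniz iterated d) (leibniz iterated (S d))); try assumption.
      * intros x y Hxy; apply leibniz_cont; [intros; apply IC; [lia|exact Hxy]|exact Hxy].
      * intros x y Hxy; apply leibniz_derive; [intros; apply ID; [lia|exact Hxy]|exact Hxy]. }
assert (EE : forall u v, hexagon b u v ->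
   iterated (S d) u v = a d u + CInt (leibniz iterated d u) 0 v).
{ intros u v H; apply (Derive_on_cder (fun y => iterated d y v)), DD, H. }
split; [|split].
- intros k u v Hk H; destruct (Nat.eq_dec k (S d)) as [->|Nk]; [|apply IC; [lia|exact H]].
  apply (ccont2_ext_loc (fun u v => a d u + CInt (leibniz iterated d u) 0 v)).
  + destruct (star_locally _ SH u v H) as [e He]; exists e; intros x y Hx Hy; symmetry.
    apply EE, He; assumption.
  + apply continuous_Cplus.
    * apply (cont_fst (a d)); eapply cder_continuous, Ha, (Hex u v H).
    * apply (ccont2_CInt_param (hexagon b) SH (leibniz iterated d)); assumption.
- intros k u v Hk H; destruct (Nat.eq_dec k d) as [->|Nk]; [|apply ID; [lia|exact H]].
  rewrite EE by exact H; apply DD, H.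
- intros k u v Hk H; destruct (Nat.eq_dec k d) as [->|Nk]; [apply EE, H|apply IF; [lia|exact H]].
Qed.

Lemma iterated_smooth :
  (forall d u v, hexagon b u v -> ccont2 (iterated d) u v) /\
  (forall d u v, hexagon b u v -> cder (fun y => iterated d y v) u (iterated (S d) u v)) /\
  (forall d u v, hexagon b u v -> cder (iterated (S d) u) v (leibniz iterated d u v)) /\
  (forall d u v, hexagon b u v -> iterated (S d) u 0%R = a d u).
Proof.
assert (SH := hexagon_star b).
split; [|split; [|split]].
- intros d u v H; apply (proj1 (iterated_spec d)); [lia|exact H].
- intros d u v H; apply (proj1 (proj2 (iterated_spec (S d)))); [lia|exact H].
- intros d u v H.
  apply (cder_ext_loc (fun y => a d u + CInt (leibniz iterated d u) 0 y)).
  + generalize (locally_2d_slice_r _ _ _ (star_locally _ SH u v H)); apply filter_imp.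
    intros y Hy; symmetry; apply (proj2 (proj2 (iterated_spec (S d)))); [lia|exact Hy].
  + eapply cder_eq; [apply cder_plus; [apply cder_const|]|apply Cplus_0_l].
    apply (is_derive_RInt (V := C_R_NormedModule) (leibniz iterated d u) _ 0%R).
    * generalize (locally_2d_slice_r _ _ _ (star_locally _ SH u v H)); apply filter_imp.
      intros y Hy; apply (cRInt_star (hexagon b) SH (leibniz iterated d)); [|exact Hy].
      intros x z Hxz; apply leibniz_cont; [|exact Hxz].
      intros k _; apply (proj1 (iterated_spec k)); [lia|exact Hxz].
    * apply (ccont2_slice (leibniz iterated d)), leibniz_cont; [|exact H].
      intros k _; apply (proj1 (iterated_spec k)); [lia|exact H].
- intros d u v H.
  rewrite (proj2 (proj2 (iterated_spec (S d))) d u 0%R); [|lia|].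
  + rewrite CInt_point; ring.
  + apply (star_rectangle _ SH u v); [exact H|apply between_end|apply between_0].
Qed.
End Smooth.

(** The pure derivatives A_d = d_u^d H and B_d = d_v^d H on the line x = 0 form a closed
    system of differential equations in t.  The potential enters through the values of
    its derivatives at 0, since u + v = 0 on this line. *)
Theorem kernel_antidiagonal (b : R) (q : R -> C) (h : C) (K : R -> R -> C) (Qs : nat -> R -> C) :
  (0 < b)%R ->
  (forall x, (- b < x < b)%R -> Qs 0%nat x = q x) ->
  (forall n x, (- b < x < b)%R -> cder (Qs n) x (Qs (S n) x)) ->
  transmutation_kernel b q h K ->
  exists A B : nat -> R -> C,
    (forall t, Icc b t -> A 0%nat t = K 0%R t) /\
    (forall t, B 0%nat t = A 0%nat t) /\
    (forall t, Icc b t -> cder (A 0%nat) t (/ 2 * (A 1%nat t - B 1%nat t))) /\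
    (forall d t, Icc b t -> cder (A (S d)) t (/ 2 * (A (S (S d)) t -
       Csum (fun j => Binomial.C d j * Qs j 0%R * A (d - j)%nat t) 0 d))) /\
    (forall d t, Icc b t -> cder (B (S d)) t (/ 2 * (
       Csum (fun j => Binomial.C d j * Qs j 0%R * B (d - j)%nat t) 0 d - B (S (S d)) t))) /\
    A 0%nat 0%R = h / 2 /\ (forall d, A (S d) 0%R = / 2 * Qs d 0%R) /\
    (forall d, B (S d) 0%R = 0).
Proof.
intros Hb HQ0 HQ [H [HG KH]].
destruct (goursat_solution_interior b q h H Hb HG) as [Hv [GH Hv0]].
destruct HG as [_ [_ [HGu HGv]]].
assert (SH := hexagon_star b).
assert (Hex1 : forall u v, hexagon b u v -> (- b < u < b)%R /\ (- b < v < b)%R).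
{ intros u v [H1 [H2 _]]; split; apply Rabs_open; assumption. }
assert (Hexs : forall u v, hexagon b u v -> hexagon b v u).
{ intros u v [H1 [H2 H3]]; rewrite Rplus_comm in H3; repeat split; assumption. }
assert (Cq : forall x, (- b < x < b)%R -> ccont q x).
{ intros x Hx; eapply cder_continuous, (cder_ext_loc (Qs 0%nat)); [|apply HQ, Hx].
  generalize (locally_Ioo _ _ _ Hx); apply filter_imp; exact HQ0. }
assert (Cqs : forall u v, hexagon b u v -> ccont q (u + v)%R).
{ intros u v Huv; apply Cq, hexagon_sum, Huv. }
set (J := goursat_inner q H).
assert (HvJ : forall u v, hexagon b u v -> Hv u v = J u v).
{ intros u v Huv; unfold J; rewrite <- (goursat_inner_eq (hexagon b) SH q Cqs H Hv GH u v Huv).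
  rewrite Hv0; [ring|apply Huv]. }
assert (HJ : forall u v, hexagon b u v -> H u v = H u 0%R + CInt (J u) 0 v).
{ intros u v Huv; unfold J.
  rewrite (cRInt_unique _ _ _ _ (goursat_integral (hexagon b) SH q Cqs H Hv GH u v Huv)).
  rewrite !HGv by (destruct (Hex1 u v Huv); unfold Icc; lra). ring. }
(* d_u H has the integral representation needed for [iterated_smooth], by
     differentiating the double integral equation under the integral sign. *)
set (W1 := fun u v => / 2 * Qs 0%nat u + CInt (fun r => Qs 0%nat (u + r)%R * H u r) 0 v).
assert (D1 : forall u v, hexagon b u v -> cder (fun y => H y v) u (W1 u v)).
{ intros u v Huv; destruct (Hex1 u v Huv) as [Hu Hw].
  apply (cder_ext_loc (fun y => (h / 2 + / 2 * CInt q 0 y) + CInt (J y) 0 v)).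
  { generalize (filter_and _ _ (locally_Ioo _ _ _ Hu)
      (locally_2d_slice_l _ _ _ (star_locally _ SH u v Huv))); apply filter_imp.
    intros y [Hy1 Hy2]; rewrite (HJ y v Hy2), HGu by (unfold Icc; lra); reflexivity. }
  eapply cder_eq.
  - apply cder_plus.
    + apply cder_plus; [apply cder_const|].
      apply cder_scal, (CInt_derive q (- b) b); [exact Cq|lra|exact Hu].
    + apply (cder_CInt_param (hexagon b) SH J (fun u r => q (u + r)%R * H u r)); [| | |exact Huv].
      * intros x y; apply (goursat_inner_cont (hexagon b) SH q Cqs H Hv GH).
      * apply (goursat_rhs_cont (hexagon b) q Cqs H Hv GH).
      * intros x y Hxy; apply (cder_ext_loc (fun z => Hv z y)); [|apply (goursat_duv _ _ _ _ GH), Hxy].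
        generalize (locally_2d_slice_l _ _ _ (star_locally _ SH x y Hxy)); apply filter_imp.
        intros z Hz; apply HvJ, Hz.
  - unfold W1; rewrite HQ0 by exact Hu; rewrite Cplus_0_l; f_equal.
    apply CInt_ext; intros r Hr; rewrite HQ0; [reflexivity|].
    apply hexagon_sum, (star_rectangle _ SH u v); [exact Huv|apply between_end|lra]. }
destruct (iterated_smooth b Qs (fun n u => / 2 * Qs n u) H W1 HQ
   ltac:(intros; apply cder_scal, HQ; assumption) (goursat_cont _ _ _ _ GH) D1
   ltac:(reflexivity)) as [UC [UD [UL U0]]].
set (U := iterated H) in *.
(* The derivatives in v are those in the first variable of the transpose of H, whose
     datum on the axis is constant. *)
set (Ht := fun x y => H y x); set (V1 := fun x y => Hv y x).
assert (HV1 : forall x y, hexagon b x y ->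
  V1 x y = 0 + CInt (fun r => Qs 0%nat (x + r)%R * Ht x r) 0 y).
{ intros x y Hxy; unfold V1; rewrite HvJ by (apply Hexs, Hxy).
  rewrite Cplus_0_l; unfold J, goursat_inner, Ht; apply CInt_ext; intros r Hr.
  rewrite Rplus_comm, HQ0; [reflexivity|].
  apply hexagon_sum, (star_rectangle _ SH x y); [exact Hxy|apply between_end|lra]. }
assert (HtC : forall x y, hexagon b x y -> ccont2 Ht x y).
{ intros x y Hxy; apply (ccont2_swap H), (goursat_cont _ _ _ _ GH), Hexs, Hxy. }
assert (HtD : forall x y, hexagon b x y -> cder (fun z => Ht z y) x (V1 x y)).
{ intros x y Hxy; apply (goursat_dv _ _ _ _ GH), Hexs, Hxy. }
destruct (iterated_smooth b Qs (fun _ _ => 0) Ht V1 HQ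
   (fun _ x _ => cder_const 0 x) HtC HtD HV1) as [VC [VD [VL V0]]].
set (V := iterated Ht) in *.
assert (HT : forall t, Icc b t -> hexagon b (t / 2) (- t / 2)).
{ intros t [T1 T2]; unfold hexagon; repeat split; apply Rabs_open; lra. }
exists (fun d t => U d (t / 2)%R (- t / 2)%R), (fun d t => V d (- t / 2)%R (t / 2)%R).
assert (E0 : forall t, (t / 2 + - t / 2 = 0)%R) by (intros; field).
assert (E0' : forall t, (- t / 2 + t / 2 = 0)%R) by (intros; field).
assert (H00 : hexagon b 0 0).
{ unfold hexagon; rewrite Rplus_0_r, Rabs_R0; auto. }
assert (Z1 : (- 0 / 2 = 0)%R) by field. assert (Z2 : (0 / 2 = 0)%R) by field.
split; [|split; [|split; [|split; [|split; [|split; [|split]]]]]].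
- intros t It; rewrite KH by (unfold Icc in *; lra).
  unfold U, iterated; cbn [Derive_n_on]; f_equal; field.
- reflexivity.
- intros t It.
  apply (cder_antidiagonal (hexagon b) SH (U 0%nat) (U 1%nat) (fun u v => V 1%nat v u));
    [apply UC|apply UD| |apply HT, It].
  intros u v Huv; apply (VD 0%nat v u), Hexs, Huv.
- intros d t It.
  eapply cder_eq; [apply (cder_antidiagonal (hexagon b) SH (U (S d)) (U (S (S d))) (leibniz Qs U d));
    [apply UC|apply UD|apply UL|apply HT, It]|].
  unfold leibniz; rewrite E0; reflexivity.
- intros d t It.
  eapply cder_eq; [apply (cder_antidiagonal (hexagon b) SH (fun u v => V (S d) v u)
     (fun u v => leibniz Qs V d v u) (fun u v => V (S (S d)) v u)); [| | |apply HT, It]|].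
  + intros u v Huv; apply (ccont2_swap (leibniz Qs V d)), (leibniz_cont b Qs HQ); [|apply Hexs, Huv].
    intros; apply VC, Hexs, Huv.
  + intros u v Huv; apply VL, Hexs, Huv.
  + intros u v Huv; apply VD, Hexs, Huv.
  + unfold leibniz; rewrite E0'; reflexivity.
- cbv beta; rewrite Z1, Z2; apply HGv; unfold Icc; lra.
- intros d; cbv beta; rewrite Z1, Z2; apply (U0 d 0%R 0%R H00).
- intros d; cbv beta; rewrite Z1, Z2; apply (V0 d 0%R 0%R H00).
Qed.

(** * The recurrence for the numbers S *)

Definition lsum {A : Type} (F : A -> C) (l : list A) : C :=
  fold_right Cplus 0 (map F l).

Lemma lsum_cons {A} (F : A -> C) (a : A) (l : list A) :
  lsum F (a :: l) = F a + lsum F l.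
Proof. reflexivity. Qed.

Lemma lsum_app {A} (F : A -> C) (l l' : list A) :
  lsum F (l ++ l') = lsum F l + lsum F l'.
Proof.
induction l as [|a l IH]; simpl app; [unfold lsum at 2; simpl; ring|].
rewrite !lsum_cons, IH; ring.
Qed.

Lemma lsum_ext {A} (F G : A -> C) (l : list A) :
  (forall a, In a l -> F a = G a) -> lsum F l = lsum G l.
Proof.
induction l as [|a l IH]; intros H; [reflexivity|].
rewrite !lsum_cons, IH, H; [reflexivity|left; reflexivity|intros; apply H; right; assumption].
Qed.

Lemma lsum_scal {A} (k : C) (F : A -> C) (l : list A) :
  k * lsum F l = lsum (fun a => k * F a) l.
Proof.
induction l as [|a l IH]; [unfold lsum; simpl; ring|].
rewrite !lsum_cons, <- IH; ring.
Qed.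

Lemma lsum_plus {A} (F G : A -> C) (l : list A) :
  lsum (fun a => F a + G a) l = lsum F l + lsum G l.
Proof.
induction l as [|a l IH]; [unfold lsum; simpl; ring|].
rewrite !lsum_cons, IH; ring.
Qed.

Lemma lsum_minus {A} (F G : A -> C) (l : list A) :
  lsum (fun a => F a - G a) l = lsum F l - lsum G l.
Proof.
induction l as [|a l IH]; [unfold lsum; simpl; ring|].
rewrite !lsum_cons, IH; ring.
Qed.

Lemma lsum_map {A B} (F : B -> C) (g : A -> B) (l : list A) :
  lsum F (map g l) = lsum (fun a => F (g a)) l.
Proof. unfold lsum; rewrite map_map; reflexivity. Qed.

Lemma lsum_flat_map {A B} (F : B -> C) (g : A -> list B) (l : list A) :
  lsum F (flat_map g l) = lsum (fun a => lsum F (g a)) l.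
Proof.
induction l as [|a l IH]; [reflexivity|].
simpl flat_map; rewrite lsum_app, IH; reflexivity.
Qed.

Lemma lsum_perm {A} (F : A -> C) (l l' : list A) :
  Permutation l l' -> lsum F l = lsum F l'.
Proof.
induction 1; rewrite ?lsum_cons; [reflexivity|congruence|ring|congruence].
Qed.

Lemma Csum_lsum (a : nat -> C) (n : nat) : Csum a 0 n = lsum a (seq 0 (S n)).
Proof.
induction n as [|n IH]; [rewrite Csum_00; unfold lsum; simpl; ring|].
rewrite Csum_0S, IH, (seq_S (S n) 0), lsum_app; unfold lsum at 3; simpl; ring.
Qed.

Definition pairs {A B : Type} (la : list A) (lb : A -> list B) : list (A * B) :=
  flat_map (fun a => map (pair a) (lb a)) la.

Lemma in_pairs {A B} (la : list A) (lb : A -> list B) (a : A) (b : B) :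
  In (a, b) (pairs la lb) <-> In a la /\ In b (lb a).
Proof.
unfold pairs; rewrite in_flat_map; split.
- intros [x [Hx H]]; apply in_map_iff in H; destruct H as [y [E Hy]].
  injection E; intros -> ->; auto.
- intros [Ha Hb]; exists a; split; [exact Ha|apply in_map; exact Hb].
Qed.

Lemma NoDup_pairs {A B} (la : list A) (lb : A -> list B) :
  NoDup la -> (forall a, In a la -> NoDup (lb a)) -> NoDup (pairs la lb).
Proof.
induction 1 as [|a la Ha Hla IH]; intros Hb; [constructor|].
unfold pairs; simpl; apply NoDup_app.
- apply Injective_map_NoDup; [intros x y E; injection E; auto|apply Hb; left; reflexivity].
- apply IH; intros; apply Hb; right; assumption.
- intros [x y] H1 H2; apply in_map_iff in H1; destruct H1 as [z [E _]].
  injection E; intros _ <-; apply (in_pairs la lb) in H2; tauto.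
Qed.

Lemma lsum_pairs {A B} (F : A -> B -> C) (la : list A) (lb : A -> list B) :
  lsum (fun a => lsum (F a) (lb a)) la = lsum (fun p => F (fst p) (snd p)) (pairs la lb).
Proof.
unfold pairs; rewrite lsum_flat_map; apply lsum_ext; intros a _.
rewrite lsum_map; reflexivity.
Qed.

Lemma lsum_bij {A B} (l : list A) (l' : list B) (f : A -> B) (g : B -> A) (F : A -> C) :
  NoDup l -> NoDup l' ->
  (forall a, In a l -> In (f a) l' /\ g (f a) = a) ->
  (forall b, In b l' -> In (g b) l /\ f (g b) = b) ->
  lsum F l = lsum (fun b => F (g b)) l'.
Proof.
intros N N' Hf Hg; rewrite <- (lsum_map F g); apply lsum_perm, NoDup_Permutation.
- exact N.
- apply Injective_map_NoDup_in; [|exact N'].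
  intros x y Hx Hy E; rewrite <- (proj2 (Hg x Hx)), <- (proj2 (Hg y Hy)), E; reflexivity.
- intros x; rewrite in_map_iff; split.
  + intros Hx; exists (f x); destruct (Hf x Hx); auto.
  + intros [y [<- Hy]]; apply Hg, Hy.
Qed.

(** Double sums are compared through bijections of their index pairs. *)
Lemma lsum_lsum_bij {A B A' B' : Type} (la : list A) (lb : A -> list B)
    (la' : list A') (lb' : A' -> list B') (f : A -> B -> A' * B') (g : A' -> B' -> A * B)
    (F : A -> B -> C) (G : A' -> B' -> C) :
  NoDup la -> (forall a, In a la -> NoDup (lb a)) ->
  NoDup la' -> (forall a, In a la' -> NoDup (lb' a)) ->
  (forall a b, In a la -> In b (lb a) ->
     In (fst (f a b)) la' /\ In (snd (f a b)) (lb' (fst (f a b))) /\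
     g (fst (f a b)) (snd (f a b)) = (a, b)) ->
  (forall a b, In a la' -> In b (lb' a) ->
     In (fst (g a b)) la /\ In (snd (g a b)) (lb (fst (g a b))) /\
     f (fst (g a b)) (snd (g a b)) = (a, b) /\ F (fst (g a b)) (snd (g a b)) = G a b) ->
  lsum (fun a => lsum (F a) (lb a)) la = lsum (fun a => lsum (G a) (lb' a)) la'.
Proof.
intros N1 N2 N3 N4 Hf Hg; rewrite !lsum_pairs.
rewrite (lsum_bij (pairs la lb) (pairs la' lb') (fun p => f (fst p) (snd p))
   (fun p => g (fst p) (snd p))).
- apply lsum_ext; intros [a b] H; apply in_pairs in H; destruct H as [Ha Hb]; simpl.
  apply Hg; assumption.
- apply NoDup_pairs; assumption.
- apply NoDup_pairs; assumption.
- intros [a b] H; apply in_pairs in H; destruct H as [Ha Hb]; simpl.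
  destruct (Hf a b Ha Hb) as [H1 [H2 H3]]; split; [|exact H3].
  destruct (f a b); apply in_pairs; auto.
- intros [a b] H; apply in_pairs in H; destruct H as [Ha Hb]; simpl.
  destruct (Hg a b Ha Hb) as [H1 [H2 [H3 _]]]; split; [|exact H3].
  destruct (g a b); apply in_pairs; auto.
Qed.

Definition weight (L : list nat) : nat := (list_sum L + 2 * length L)%nat.

(** The lists of the sum for fixed n and d, all lengths together: an admissible list
    for n and d is a nondecreasing one with weight n - d. *)
Definition weighted_lists (m : nat) : list (list nat) :=
  flat_map (fun l => tuples_from 0 l (m - 2 * l)) (seq 0 (S (Nat.div2 m))).

Lemma div2_le_iff (l m : nat) : (l <= Nat.div2 m <-> 2 * l <= m)%nat.
Proof.
assert (H := Nat.div2_odd m); destruct (Nat.odd m); simpl Nat.b2n in H; lia.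
Qed.

Lemma in_weighted_lists (m : nat) (L : list nat) :
  In L (weighted_lists m) <-> Sorted le L /\ weight L = m.
Proof.
unfold weighted_lists, weight; rewrite in_flat_map; split.
- intros [l [Hl H]]; apply in_seq in Hl; apply in_tuples_from in H.
  destruct H as [H1 [H2 [H3 _]]]; split; [exact H3|].
  assert (2 * l <= m)%nat by (apply div2_le_iff; lia). lia.
- intros [H1 H2]; exists (length L); split.
  + apply in_seq; assert (length L <= Nat.div2 m)%nat by (apply div2_le_iff; lia); lia.
  + apply in_tuples_from; repeat split; [lia|exact H1|].
    destruct L; constructor; lia.
Qed.

Lemma NoDup_weighted_lists (m : nat) : NoDup (weighted_lists m).
Proof.
unfold weighted_lists.
generalize (seq_NoDup (S (Nat.div2 m)) 0); generalize (seq 0 (S (Nat.div2 m))).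
intros s Hs; induction Hs as [|l s Hl Hs IH]; simpl; [constructor|].
apply NoDup_app; [apply NoDup_tuples_from|exact IH|].
intros L H1 H2; apply in_tuples_from in H1; destruct H1 as [H1 _].
apply in_flat_map in H2; destruct H2 as [l' [Hl' H2]].
apply in_tuples_from in H2; destruct H2 as [H2 _]; congruence.
Qed.

Fixpoint insert (k : nat) (L : list nat) : list nat :=
  match L with
  | [] => [k]
  | x :: L' => if (k <=? x)%nat then k :: x :: L' else x :: insert k L'
  end.

Lemma le_trans_rel : Relations_1.Transitive (U := nat) le.
Proof. intros x y z; apply Nat.le_trans. Qed.

Lemma remove_one_insert (k : nat) (L : list nat) : remove_one k (insert k L) = L.
Proof.
induction L as [|x L IH]; simpl; [rewrite Nat.eqb_refl; reflexivity|].
destruct (Nat.leb_spec k x); simpl.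
- rewrite Nat.eqb_refl; reflexivity.
- destruct (Nat.eqb_spec x k); [lia|rewrite IH; reflexivity].
Qed.

Lemma insert_remove_one (k : nat) (L : list nat) :
  StronglySorted le L -> In k L -> insert k (remove_one k L) = L.
Proof.
induction 1 as [|x L HL IH Hx]; intros Hk; [destruct Hk|].
simpl; destruct (Nat.eqb_spec x k) as [->|Nk].
- destruct L as [|y L]; simpl; [reflexivity|].
  inversion Hx; subst; destruct (Nat.leb_spec k y); [reflexivity|lia].
- destruct Hk as [Hk|Hk]; [contradiction|].
  rewrite Forall_forall in Hx; specialize (Hx k Hk).
  simpl; destruct (Nat.leb_spec k x); [lia|].
  rewrite IH by exact Hk; reflexivity.
Qed.

Lemma in_insert (k : nat) (L : list nat) (y : nat) :
  In y (insert k L) <-> y = k \/ In y L.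
Proof.
induction L as [|x L IH]; simpl; [intuition auto|].
destruct (k <=? x)%nat; simpl; [intuition auto|rewrite IH; intuition auto].
Qed.

Lemma in_remove_one (k : nat) (L : list nat) (y : nat) :
  In y (remove_one k L) -> In y L.
Proof.
induction L as [|x L IH]; simpl; [tauto|].
destruct (x =? k)%nat; simpl; intuition auto.
Qed.

Lemma insert_sorted (k : nat) (L : list nat) :
  StronglySorted le L -> StronglySorted le (insert k L).
Proof.
induction 1 as [|x L HL IH Hx]; simpl; [repeat constructor|].
rewrite Forall_forall in Hx.
destruct (Nat.leb_spec k x).
- constructor; [constructor; [exact HL|apply Forall_forall; exact Hx]|].
  apply Forall_forall; intros y [<-|Hy]; [assumption|specialize (Hx y Hy); lia].
- constructor; [exact IH|]; apply Forall_forall; intros y Hy.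
  apply in_insert in Hy; destruct Hy as [->|Hy]; [lia|apply Hx, Hy].
Qed.

Lemma remove_one_sorted (k : nat) (L : list nat) :
  StronglySorted le L -> StronglySorted le (remove_one k L).
Proof.
induction 1 as [|x L HL IH Hx]; simpl; [constructor|].
destruct (x =? k)%nat; [exact HL|].
constructor; [exact IH|]; apply Forall_forall; intros y Hy.
rewrite Forall_forall in Hx; apply Hx, (in_remove_one k L y Hy).
Qed.

Lemma insert_weight (k : nat) (L : list nat) : weight (insert k L) = (weight L + k + 2)%nat.
Proof.
unfold weight; induction L as [|x L IH]; simpl; [lia|].
destruct (k <=? x)%nat; simpl; [lia|].
simpl in IH; lia.
Qed.

Lemma insert_length (k : nat) (L : list nat) : length (insert k L) = S (length L).
Proof.
induction L as [|x L IH]; simpl; [reflexivity|].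
destruct (k <=? x)%nat; simpl; [reflexivity|rewrite IH; reflexivity].
Qed.

Definition monomial (Qc : nat -> C) (L : list nat) : C :=
  fold_right Cmult 1 (map Qc L).

Lemma insert_monomial (Qc : nat -> C) (k : nat) (L : list nat) :
  monomial Qc (insert k L) = Qc k * monomial Qc L.
Proof.
unfold monomial; induction L as [|x L IH]; simpl; [reflexivity|].
destruct (k <=? x)%nat; simpl; [reflexivity|]. rewrite IH; ring.
Qed.

Lemma nondecreasing_sorted (L : list nat) : Sorted le L -> nondecreasing L = true.
Proof.
induction 1 as [|x L HL IH Hx]; [reflexivity|].
destruct L as [|y L]; [reflexivity|].
change (nondecreasing (x :: y :: L)) with ((x <=? y)%nat && nondecreasing (y :: L))%bool.
rewrite IH, andb_true_r; inversion Hx; apply Nat.leb_le; assumption.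
Qed.

Lemma admissible_true (n d : nat) (L : list nat) :
  Sorted le L -> (weight L + d)%nat = n -> admissible n d L = true.
Proof.
unfold weight, admissible; intros HL HW; rewrite nondecreasing_sorted by exact HL.
repeat (apply andb_true_intro; split); try reflexivity;
  try (apply Nat.leb_le; lia); apply Nat.eqb_eq; lia.
Qed.

(** The factor epsilon of the recurrence. *)
Definition parity_factor (n d : nat) : C := if (d =? 1)%nat then 1 + (-1) ^ n else 1.

(** On nondecreasing lists of the right weight the admissibility test succeeds.  For the
    empty list the recurrence reproduces the prescribed value 1: when n = 0 the factor
    1 + (-1)^0 = 2 compensates the initial value 1/2. *)
Lemma S_recurrence (n d : nat) (L : list nat) :
  Sorted le L -> (weight L + d)%nat = S n ->
  RtoC (S_ (S n) d L) =
  (match d with O => 0 | S d' => parity_factor n d * S_ n d' L end) +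
  lsum (fun k => Binomial.C (d + k) k * S_ n (d + k + 1) (remove_one k L))
       (nodup Nat.eq_dec L).
Proof.
intros HL HW.
assert (FR : forall (F : nat -> R) (l : list nat),
  RtoC (fold_right Rplus 0%R (map F l)) = lsum (fun k => RtoC (F k)) l).
{ intros F l; induction l as [|x l IH]; [reflexivity|].
  rewrite lsum_cons, <- IH; simpl; apply RtoC_plus. }
assert (EP : forall (d : nat) x, RtoC ((if (d =? 1)%nat then 1 + (-1) ^ n else 1) * x)%R
   = parity_factor n d * RtoC x).
{ intros e x; unfold parity_factor; rewrite RtoC_mult; destruct (e =? 1)%nat; [|reflexivity].
  rewrite RtoC_plus, RtoC_pow; reflexivity. }
cbn [S_]; rewrite (admissible_true (S n) d L HL HW).
destruct L as [|x L].
- unfold weight in HW; simpl in HW; subst d; simpl nodup.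
  change (lsum _ []) with (RtoC 0); rewrite Cplus_0_r.
  destruct n as [|n].
  + unfold parity_factor; simpl.
    rewrite <- RtoC_plus, <- RtoC_mult; f_equal; field.
  + change (S_ (S n) (S n) []) with (if admissible (S n) (S n) [] then 1 else 0)%R.
    rewrite admissible_true by (constructor || reflexivity).
    unfold parity_factor; simpl; ring.
- rewrite RtoC_plus; f_equal.
  + destruct d as [|d]; [reflexivity|apply EP].
  + rewrite FR; apply lsum_ext; intros k _; apply RtoC_mult.
Qed.

Section Coefficients.
Context (Qc : nat -> C).

(** The total coefficient of d_u^d H + (-1)^n d_v^d H in D^n H. *)
Definition coefficient (n d : nat) : C :=
  lsum (fun L => (-1) ^ length L * S_ n d L * monomial Qc L) (weighted_lists (n - d)).

(** The sum over lists L of weight n+1-d and distinct entries k of L is, through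
    L -> (k, L without k), a sum over k and lists of weight n-d-k-1; the missing entry
    contributes the factor Q_k and, with the length, a sign. *)
Lemma coefficient_recurrence (n d : nat) : (d <= S n)%nat ->
  coefficient (S n) d =
  (match d with O => 0 | S d' => parity_factor n d * coefficient n d' end) -
  lsum (fun k => Binomial.C (d + k) k * Qc k * coefficient n (d + k + 1)) (seq 0 (n - d)).
Proof.
intros Hd; unfold coefficient at 1.
rewrite (lsum_ext _ (fun L =>
   (match d with O => 0 | S d' => parity_factor n d * ((-1) ^ length L * S_ n d' L * monomial Qc L) end) +
   lsum (fun k => (-1) ^ length L * monomial Qc L *
     (Binomial.C (d + k) k * S_ n (d + k + 1) (remove_one k L))) (nodup Nat.eq_dec L))).
2:{ intros L HL; apply in_weighted_lists in HL; destruct HL as [HL HW].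
    rewrite S_recurrence by (try exact HL; lia).
    rewrite <- lsum_scal; destruct d; ring. }
rewrite lsum_plus; unfold Cminus; f_equal.
- destruct d as [|d'].
  + assert (Z : forall l : list (list nat), lsum (fun _ => RtoC 0) l = 0).
    { induction l as [|x l IH]; [reflexivity|rewrite lsum_cons, IH; ring]. }
    apply Z.
  + rewrite <- lsum_scal; reflexivity.
- replace (- lsum _ _) with (- (1) * lsum (fun k => Binomial.C (d + k) k * Qc k *
    coefficient n (d + k + 1)) (seq 0 (n - d))) by ring.
  rewrite lsum_scal.
  rewrite (lsum_ext (fun a => - (1) * _) (fun k => lsum (fun L =>
     - (1) * (Binomial.C (d + k) k * Qc k * ((-1) ^ length L * S_ n (d + k + 1) L * monomial Qc L)))
     (weighted_lists (n - (d + k + 1)))))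
    by (intros k _; unfold coefficient; rewrite !lsum_scal; reflexivity).
  apply (lsum_lsum_bij _ _ _ _ (fun L k => (k, remove_one k L)) (fun k L => (insert k L, k))).
  + apply NoDup_weighted_lists.
  + intros L _; apply NoDup_nodup.
  + apply seq_NoDup.
  + intros k _; apply NoDup_weighted_lists.
  + intros L k HL Hk; cbn [fst snd]; apply nodup_In in Hk.
    apply in_weighted_lists in HL; destruct HL as [HL HW].
    apply (Sorted_StronglySorted le_trans_rel) in HL.
    assert (E := insert_remove_one k L HL Hk).
    assert (W := insert_weight k (remove_one k L)); rewrite E in W.
    split; [apply in_seq; lia|split; [|rewrite E; reflexivity]].
    apply in_weighted_lists; split; [apply StronglySorted_Sorted, remove_one_sorted, HL|lia].
  + intros k L Hk HL; cbn [fst snd]; apply in_seq in Hk.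
    apply in_weighted_lists in HL; destruct HL as [HL HW].
    apply (Sorted_StronglySorted le_trans_rel) in HL.
    split; [|split; [|split]].
    * apply in_weighted_lists; split; [apply StronglySorted_Sorted, insert_sorted, HL|].
      rewrite insert_weight; lia.
    * apply nodup_In, in_insert; left; reflexivity.
    * rewrite remove_one_insert; reflexivity.
    * rewrite insert_length, insert_monomial, remove_one_insert, Cpow_S. 
      replace (RtoC (-1)) with (- RtoC 1) by (rewrite <- RtoC_opp; f_equal; lra). ring.
Qed.
End Coefficients.

(** * The derivatives of the kernel at the origin *)

Lemma cder_lsum {A : Type} (F : A -> R -> C) (F' : A -> C) (x : R) (l : list A) :
  (forall a, In a l -> cder (F a) x (F' a)) ->
  cder (fun y => lsum (fun a => F a y) l) x (lsum F' l).
Proof.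
induction l as [|a l IH]; intros H; [exact (cder_const 0 x)|].
apply (cder_plus (F a) (fun y => lsum (fun a => F a y) l)).
- apply H; left; reflexivity.
- apply IH; intros; apply H; right; assumption.
Qed.

Section Antidiagonal.
Context (b : R) (Qc : nat -> C) (A B : nat -> R -> C).
Hypothesis HAB : forall t, B 0%nat t = A 0%nat t.
Hypothesis HA0 : forall t, Icc b t -> cder (A 0%nat) t (/ 2 * (A 1%nat t - B 1%nat t)).
Hypothesis HA : forall d t, Icc b t -> cder (A (S d)) t (/ 2 * (A (S (S d)) t -
  Csum (fun j => Binomial.C d j * Qc j * A (d - j)%nat t) 0 d)).
Hypothesis HB : forall d t, Icc b t -> cder (B (S d)) t (/ 2 * (
  Csum (fun j => Binomial.C d j * Qc j * B (d - j)%nat t) 0 d - B (S (S d)) t)).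

Definition mixed (n d : nat) (t : R) : C := A d t + (-1) ^ n * B d t.

(** The Leibniz sums in the derivatives of A_d and of B_d have opposite signs, so that they
    combine with the same alternating sign (-1)^(n+1).  For d = 0 both terms coincide and
    the sum is 2 A_0 or 0; this is the factor epsilon. *)
Lemma mixed_derive (n d : nat) (t : R) : Icc b t ->
  cder (mixed n d) t (/ 2 * (parity_factor n (S d) * mixed (S n) (S d) t -
    lsum (fun j => Binomial.C (d - 1) j * Qc j * mixed (S n) (d - 1 - j) t) (seq 0 d))).
Proof.
intros It; assert (P : RtoC (-1) = - RtoC 1) by (rewrite <- RtoC_opp; f_equal; lra).
destruct d as [|d].
- apply (cder_ext (fun y => (1 + (-1) ^ n) * A 0%nat y)).
  { intros y; unfold mixed; rewrite HAB; ring. }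
  eapply cder_eq; [apply cder_scal, HA0, It|].
  unfold parity_factor, mixed, lsum; cbn [seq map fold_right Nat.eqb]; rewrite Cpow_S, P.
  assert (S2 : (- RtoC 1) ^ n * (- RtoC 1) ^ n = 1).
  { clear; induction n as [|n IH]; [simpl; ring|].
    rewrite Cpow_S; transitivity ((- RtoC 1) ^ n * (- RtoC 1) ^ n); [ring|exact IH]. }
  set (s := (- RtoC 1) ^ n) in *.
  replace ((1 + s) * (A 1%nat t + - RtoC 1 * s * B 1%nat t) - 0)
    with (A 1%nat t + s * A 1%nat t - s * B 1%nat t - s * s * B 1%nat t) by ring.
  rewrite S2; ring.
- eapply cder_eq.
  { apply (cder_plus (A (S d)) (fun y => (-1) ^ n * B (S d) y)); [apply HA, It|apply cder_scal, HB, It]. }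
  unfold parity_factor; cbn [Nat.eqb]; replace (S d - 1)%nat with d by lia.
  rewrite !Csum_lsum; unfold mixed.
  rewrite (lsum_ext (fun j => Binomial.C d j * Qc j * (A (d - j)%nat t + (-1) ^ S n * B (d - j)%nat t))
     (fun j => Binomial.C d j * Qc j * A (d - j)%nat t +
               (-1) ^ S n * (Binomial.C d j * Qc j * B (d - j)%nat t)))
    by (intros; ring).
  rewrite lsum_plus, <- lsum_scal, Cpow_S, P; ring.
Qed.

(** D^n H on the line x = 0; as t = u - v, this is 2^n times the n-th t-derivative. *)
Definition scaled_derivative (n : nat) (t : R) : C :=
  lsum (fun d => coefficient Qc n d * mixed n d t) (seq 0 (S n)).

Lemma scaled_derivative_derive (n : nat) (t : R) : Icc b t ->
  cder (scaled_derivative n) t (/ 2 * scaled_derivative (S n) t).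
Proof.
intros It; unfold scaled_derivative; eapply cder_eq.
{ apply cder_lsum; intros d _; apply cder_scal, mixed_derive, It. }
rewrite (lsum_ext _ (fun d => / 2 * (coefficient Qc n d * (parity_factor n (S d) * mixed (S n) (S d) t) -
   lsum (fun j => coefficient Qc n d * (Binomial.C (d - 1) j * Qc j * mixed (S n) (d - 1 - j) t)) (seq 0 d))))
  by (intros; rewrite <- lsum_scal; ring).
rewrite <- lsum_scal, lsum_minus; f_equal.
rewrite (lsum_ext (fun d => coefficient Qc (S n) d * mixed (S n) d t)
  (fun d => match d with O => 0 | S d' => parity_factor n d * coefficient Qc n d' end * mixed (S n) d t -
    lsum (fun k => Binomial.C (d + k) k * Qc k * coefficient Qc n (d + k + 1) * mixed (S n) d t)
      (seq 0 (n - d)))).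
2:{ intros d Hd; apply in_seq in Hd; rewrite coefficient_recurrence by lia.
    rewrite (lsum_ext (fun k => Binomial.C (d + k) k * Qc k * coefficient Qc n (d + k + 1) * mixed (S n) d t)
      (fun k => mixed (S n) d t * (Binomial.C (d + k) k * Qc k * coefficient Qc n (d + k + 1))))
      by (intros; ring).
    rewrite <- lsum_scal; ring. }
rewrite lsum_minus; f_equal.
- change (seq 0 (S (S n))) with (0%nat :: seq 1 (S n)); rewrite <- seq_shift, lsum_cons, lsum_map.
  rewrite Cmult_0_l, Cplus_0_l; apply lsum_ext; intros d _; ring.
- apply (lsum_lsum_bij _ _ _ _ (fun d j => (d - 1 - j, j)%nat) (fun e k => (e + k + 1, k)%nat)).
  + apply seq_NoDup.
  + intros; apply seq_NoDup.
  + apply seq_NoDup.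
  + intros; apply seq_NoDup.
  + intros d j Hd Hj; apply in_seq in Hd, Hj; cbn [fst snd].
    split; [apply in_seq; lia|split; [apply in_seq; lia|]].
    f_equal; lia.
  + intros e k He Hk; apply in_seq in He, Hk; cbn [fst snd].
    split; [apply in_seq; lia|split; [apply in_seq; lia|split]].
    * f_equal; lia.
    * replace (e + k + 1 - 1)%nat with (e + k)%nat by lia.
      replace (e + k - k)%nat with e by lia; ring.
Qed.

Definition antidiagonal_derivative (n : nat) (t : R) : C := / 2 ^ n * scaled_derivative n t.

Lemma antidiagonal_derivative_derive (n : nat) (t : R) : Icc b t ->
  cder (antidiagonal_derivative n) t (antidiagonal_derivative (S n) t).
Proof.
intros It; eapply cder_eq; [apply cder_scal, scaled_derivative_derive, It|].
unfold antidiagonal_derivative; rewrite Cpow_S; field.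
apply Cpow_nz; intros E; apply RtoC_inj in E; lra.
Qed.

Lemma antidiagonal_derivative_0 (t : R) : antidiagonal_derivative 0 t = A 0%nat t.
Proof.
unfold antidiagonal_derivative, scaled_derivative, coefficient, mixed, lsum, weighted_lists, monomial; simpl.
rewrite HAB.
transitivity (RtoC (/ 2) * 2 * A 0%nat t); [|rewrite <- RtoC_mult, Rinv_l by lra; ring].
field; intros E; apply RtoC_inj in E; lra.
Qed.
End Antidiagonal.

Section Formula.
Context (b : R) (q : R -> C) (h : C) (A B : nat -> R -> C).
Notation Qc := (fun j => Derive_n_on (Icc b) q j 0).
Hypothesis HA00 : A 0%nat 0%R = h / 2.
Hypothesis HAB : forall t, B 0%nat t = A 0%nat t.
Hypothesis HA : forall d, A (S d) 0%R = / 2 * Qc d.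
Hypothesis HB : forall d, B (S d) 0%R = 0.

Lemma mixed_0 (n d : nat) :
  mixed A B n d 0 = / 2 * ((1 + (-1) ^ n * delta d) * q_shift b q h d).
Proof.
unfold mixed, delta; destruct d as [|d]; cbn [Nat.eqb q_shift].
- rewrite HAB, HA00; unfold Cdiv; ring.
- rewrite HA, HB; ring.
Qed.

(** The list of length 0 contributes only for d = n, where it gives the term in front of
    the sums of the formula. *)
Lemma leading_term (n : nat) :
  (-1) ^ 0 * Csum (fun d : nat =>
       (1 + (-1) ^ n * delta d) * q_shift b q h d *
       fold_right Cplus 0
         (map (fun L => S_ n d L * fold_right Cmult 1 (map Qc L))
              (tuples_from 0 0 (n - d - 2 * 0))))
       0 (n - 2 * 0) = q_shift b q h n.
Proof.
simpl (2 * 0)%nat; rewrite !Nat.sub_0_r; change ((-1) ^ 0) with (RtoC 1); rewrite Cmult_1_l.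
assert (T : forall m, tuples_from 0 0 m = if (m =? 0)%nat then [[]] else []) by reflexivity.
destruct n as [|n].
- rewrite Csum_00; unfold delta; simpl.
  transitivity (RtoC (/ 2) * 2 * h); [ring|rewrite <- RtoC_mult, Rinv_l by lra; ring].
- rewrite Csum_0S, (Csum_ext _ (fun _ => 0 * 0)).
  + rewrite <- Csum_mult_l, !Nat.sub_0_r, Nat.sub_diag, T; cbn [Nat.eqb map fold_right].
    replace (S_ (S n) (S n) []) with 1%R.
    2:{ change (S_ (S n) (S n) []) with (if admissible (S n) (S n) [] then 1 else 0)%R.
        rewrite admissible_true by (constructor || reflexivity); reflexivity. }
    unfold delta; cbn [Nat.eqb]; ring.
  + intros d Hd; rewrite Nat.sub_0_r, T; destruct (Nat.eqb_spec (S n - d) 0); [lia|].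
    cbn [map fold_right]; ring.
Qed.

(** The formula sums first over the length l and then over d, the coefficients first over d
    and then over l; both index sets are 2 l + d <= n. *)
Lemma antidiagonal_derivative_formula (n : nat) :
  antidiagonal_derivative Qc A B n 0 = dtK_formula b q h n.
Proof.
unfold dtK_formula; rewrite <- (leading_term n) at 1.
rewrite (Csum_1 (fun l : nat =>
     (-1) ^ l *
     Csum (fun d : nat =>
       (1 + (-1) ^ n * delta d) * q_shift b q h d *
       fold_right Cplus 0
         (map (fun L => S_ n d L * fold_right Cmult 1 (map Qc L))
              (tuples_from 0 l (n - d - 2 * l))))
       0 (n - 2 * l))).
unfold antidiagonal_derivative; rewrite Cpow_S.
assert (N2 : RtoC 2 <> 0) by (intros E; apply RtoC_inj in E; lra).
transitivity (/ (2 * 2 ^ n) * (2 * scaled_derivative Qc A B n 0)).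
{ field; apply Cpow_nz; exact N2. }
f_equal; rewrite Csum_lsum; unfold scaled_derivative; rewrite lsum_scal.
set (w := fun d => (1 + (-1) ^ n * delta d) * q_shift b q h d).
rewrite (lsum_ext _ (fun d => lsum (fun l => w d * lsum (fun L => (-1) ^ l * (S_ n d L * monomial Qc L))
   (tuples_from 0 l (n - d - 2 * l))) (seq 0 (S (Nat.div2 (n - d)))))).
2:{ intros d _; rewrite mixed_0; fold (w d).
    transitivity (w d * coefficient Qc n d); [field; exact N2|].
    unfold coefficient, weighted_lists; rewrite lsum_flat_map, lsum_scal.
    apply lsum_ext; intros l _; f_equal; apply lsum_ext; intros L HL.
    apply in_tuples_from in HL; destruct HL as [<- _]; ring. }
symmetry; rewrite (lsum_ext _ (fun l => lsum (fun d => w d * lsum (fun L => (-1) ^ l * (S_ n d L * monomial Qc L))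
   (tuples_from 0 l (n - d - 2 * l))) (seq 0 (S (n - 2 * l))))).
2:{ intros l _; rewrite Csum_lsum, lsum_scal; apply lsum_ext; intros d _.
    rewrite <- lsum_scal; unfold w, lsum, monomial; ring. }
apply (lsum_lsum_bij _ _ _ _ (fun l d => (d, l)) (fun d l => (l, d))).
- apply seq_NoDup.
- intros; apply seq_NoDup.
- apply seq_NoDup.
- intros; apply seq_NoDup.
- intros l d Hl Hd; apply in_seq in Hl, Hd; cbn [fst snd].
  assert (2 * l <= n)%nat by (apply div2_le_iff; lia).
  split; [apply in_seq; lia|split; [|reflexivity]].
  assert (l <= Nat.div2 (n - d))%nat by (apply div2_le_iff; lia).
  apply in_seq; lia.
- intros d l Hd Hl; apply in_seq in Hl, Hd; cbn [fst snd].
  assert (2 * l <= n - d)%nat by (apply div2_le_iff; lia).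
  assert (l <= Nat.div2 n)%nat by (apply div2_le_iff; lia).
  split; [apply in_seq; lia|split; [apply in_seq; lia|split; reflexivity]].
Qed.
End Formula.

Theorem kernel_time_derivatives (b : R) (q : R -> C) (h : C) (K : R -> R -> C) :
  (0 < b)%R ->
  (forall n x, (- b < x < b)%R ->
     cder (Derive_n_on (Icc b) q n) x (Derive_n_on (Icc b) q (S n) x)) ->
  transmutation_kernel b q h K ->
  C_infty_on (Icc b) (fun t : R => K 0%R t) /\
  (forall n t, (- b < t < b)%R -> cder (Derive_n_on (Icc b) (fun t => K 0%R t) n) t
     (Derive_n_on (Icc b) (fun t => K 0%R t) (S n) t)) /\
  (forall n, dtK b K n = dtK_formula b q h n).
Proof.
intros Hb HQ HK.
destruct (kernel_antidiagonal b q h K (Derive_n_on (Icc b) q) Hb ltac:(reflexivity) HQ HK)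
  as [A [B [H0 [HAB [HA0 [HA [HB [HA00 [HAz HBz]]]]]]]]].
set (Qc := fun j => Derive_n_on (Icc b) q j 0%R) in *.
set (Kn := antidiagonal_derivative Qc A B).
assert (KD : forall n t, Icc b t -> cder (Kn n) t (Kn (S n) t)).
{ intros n t It; apply (antidiagonal_derivative_derive b); assumption. }
assert (K0 : forall t, Icc b t -> Kn 0%nat t = K 0%R t).
{ intros t It; rewrite <- H0 by exact It; apply antidiagonal_derivative_0; exact HAB. }
assert (KDon : forall n t, Icc b t -> is_derive_on (Icc b) (Kn n) t (Kn (S n) t)).
{ intros n t It; apply cder_derive_on; [exact It|apply KD, It]. }
assert (CI : C_infty_on (Icc b) (fun t => K 0%R t)).
{ apply (C_infty_on_chain b _ Kn); assumption. }
split; [exact CI|split].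
- intros n t Ht; apply (C_n_on_cder b (S n)); [exact Hb|apply CI|lia|exact Ht].
- intros n; unfold dtK.
  assert (I0 : Icc b 0) by (unfold Icc; lra).
  transitivity (Kn n 0%R); [apply (Derive_n_on_chain b _ Kn); assumption|].
  apply antidiagonal_derivative_formula; assumption.
Qed.

(** * The theorem *)

Section SmoothUpTo.
Context (b : R) (Hb : (0 < b)%R).

(** Differentiability of order n on the open interval, with the derivatives left
    unspecified: in this form it is inherited by sums, products and quotients by a plain
    induction on n. *)
Fixpoint smooth_upto (n : nat) (g : R -> C) : Prop :=
  match n with
  | O => True
  | S m => exists g' : R -> C,
      (forall x, (- b < x < b)%R -> cder g x (g' x)) /\ smooth_upto m g'
  end.

Lemma smooth_upto_pred (n : nat) (g : R -> C) : smooth_upto (S n) g -> smooth_upto n g.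
Proof.
revert g; induction n as [|n IH]; intros g H; [exact I|].
destruct H as [g' [D S']]; exists g'; split; [exact D|apply IH, S'].
Qed.

Lemma smooth_upto_ext (n : nat) (g k : R -> C) :
  (forall x, (- b < x < b)%R -> g x = k x) -> smooth_upto n g -> smooth_upto n k.
Proof.
intros E; destruct n as [|n]; [trivial|]; intros [g' [D S']]; exists g'; split; [|exact S'].
intros x Hx; apply (cder_ext_loc g); [|apply D, Hx].
generalize (locally_Ioo _ _ _ Hx); apply filter_imp; intros y Hy; apply E, Hy.
Qed.

Lemma smooth_upto_const (n : nat) (a : C) : smooth_upto n (fun _ => a).
Proof.
revert a; induction n as [|n IH]; intros a; [exact I|].
exists (fun _ => 0); split; [intros x _; apply cder_const|apply IH].
Qed.

Lemma smooth_upto_plus (n : nat) (g k : R -> C) :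
  smooth_upto n g -> smooth_upto n k -> smooth_upto n (fun x => g x + k x).
Proof.
revert g k; induction n as [|n IH]; intros g k; [trivial|].
intros [g' [Dg Sg]] [k' [Dk Sk]]; exists (fun x => g' x + k' x); split; [|apply IH; assumption].
intros x Hx; apply cder_plus; [apply Dg|apply Dk]; exact Hx.
Qed.

Lemma smooth_upto_mult (n : nat) (g k : R -> C) :
  smooth_upto n g -> smooth_upto n k -> smooth_upto n (fun x => g x * k x).
Proof.
revert g k; induction n as [|n IH]; intros g k; [trivial|].
intros Hg Hk; assert (Hg' := smooth_upto_pred _ _ Hg); assert (Hk' := smooth_upto_pred _ _ Hk).
destruct Hg as [g' [Dg Sg]], Hk as [k' [Dk Sk]].
exists (fun x => g' x * k x + g x * k' x); split.
- intros x Hx; apply cder_mult; [apply Dg|apply Dk]; exact Hx.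
- apply smooth_upto_plus; apply IH; assumption.
Qed.

Lemma smooth_upto_inv (n : nat) (g : R -> C) :
  (forall x, (- b < x < b)%R -> g x <> 0) ->
  smooth_upto n g -> smooth_upto n (fun x => / g x).
Proof.
intros Hg; induction n as [|n IH]; [trivial|].
intros H; assert (Hp := smooth_upto_pred _ _ H); destruct H as [g' [D S']].
exists (fun x => - (1) * (g' x * (/ g x * / g x))); split.
- intros x Hx; eapply cder_eq; [apply cder_inv; [apply D, Hx|apply Hg, Hx]|].
  field; apply Hg, Hx.
- apply smooth_upto_mult; [apply smooth_upto_const|].
  apply smooth_upto_mult; [exact S'|apply smooth_upto_mult; apply IH, Hp].
Qed.

Lemma smooth_Derive_n_on (g : R -> C) :
  (forall n, smooth_upto n g) ->
  forall n x, (- b < x < b)%R ->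
    cder (Derive_n_on (Icc b) g n) x (Derive_n_on (Icc b) g (S n) x).
Proof.
intros Hg.
assert (Loc : forall (p k : R -> C) x l, (- b < x < b)%R ->
  (forall y, (- b < y < b)%R -> p y = k y) -> cder k x l ->
  cder p x l /\ Derive_on (Icc b) p x = l).
{ intros p k x l Hx E D.
  assert (D' : cder p x l).
  { apply (cder_ext_loc k); [|exact D].
    generalize (locally_Ioo _ _ _ Hx); apply filter_imp; intros y Hy; symmetry; apply E, Hy. }
  split; [exact D'|]; assert (Ix : Icc b x) by (unfold Icc; lra).
  apply Derive_on_unique; [exact Ix|apply Icc_limit_point; assumption|].
  apply cder_derive_on; assumption. }
assert (P : forall n k, exists G, smooth_upto k G /\
   forall x, (- b < x < b)%R -> Derive_n_on (Icc b) g n x = G x).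
{ induction n as [|n IH]; intros k; [exists g; split; [apply Hg|reflexivity]|].
  destruct (IH (S k)) as [G [[G' [D S']] E]]; exists G'; split; [exact S'|].
  intros x Hx; apply (Loc _ G x (G' x) Hx E), D, Hx. }
intros n x Hx; destruct (P n 1%nat) as [G [[G' [D _]] E]].
destruct (Loc _ G x (G' x) Hx E (D x Hx)) as [D' E'].
cbn [Derive_n_on]; rewrite E'; exact D'.
Qed.
End SmoothUpTo.

Lemma Csum_1_ext (a a' : nat -> C) (N : nat) :
  (forall n, (1 <= n)%nat -> a n = a' n) -> Csum a 1 N = Csum a' 1 N.
Proof. intros H; apply sum_n_m_ext_loc; intros n [Hn _]; apply H, Hn. Qed.

Lemma Cmod_small_eq (z w : C) :
  (forall e, (0 < e)%R -> (Cmod (z - w) < e)%R) -> z = w.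
Proof.
intros H; destruct (Rle_lt_or_eq_dec _ _ (Cmod_ge_0 (z - w))) as [P|P].
- specialize (H _ P); lra.
- symmetry in P; apply Cmod_eq_0 in P.
  replace z with (w + (z - w)) by ring; rewrite P; ring.
Qed.

Theorem theorem8p7 :
  forall (b : R) (q f : R -> C) (Kf K1f : R -> R -> C) (c_ b_ : nat -> C),
  (0 < b)%R ->
  C_infty_on (Icc b) q ->
  C_n_on (Icc b) 2 f ->
  (forall x : R, Icc b x -> Derive_n_on (Icc b) f 2 x - q x * f x = 0) ->
  (forall x : R, Icc b x -> f x <> 0) ->
  f 0%R = 1 ->
  let h := Derive_on (Icc b) f 0 in
  let q1f := q_inv b q f in
  transmutation_kernel b q h Kf ->
  transmutation_kernel b q1f (- h) K1f ->
  let g1 := fun x : R => / 2 * (Kf x x + Kf x (- x)%R) in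
  let g2 := fun x : R => / 2 * (Kf x x - Kf x (- x)%R) in
  converges_uniformly (Icc b)
    (fun (N : nat) (x : R) =>
       c_ 0%nat * u_ f 0 x x +
       Csum (fun n : nat => c_ n * u_ f (2 * n - 1) x x) 1 N)
    g1 ->
  converges_uniformly (Icc b)
    (fun (N : nat) (x : R) =>
       Csum (fun n : nat => b_ n * u_ f (2 * n) x x) 1 N)
    g2 ->
  (forall x : R, Icc b x ->
     g1 x = h / 2 + / 4 * CInt q 0 x /\ g2 x = / 4 * CInt q 0 x) /\
  (C_infty_on (Icc b) (fun t : R => Kf 0%R t) /\
   C_infty_on (Icc b) (fun t : R => K1f 0%R t)) /\
  (forall n : nat, Nat.Even n -> c_ n = dtK b Kf n / INR (fact n)) /\
  (forall n : nat, Nat.Odd n -> c_ n = - (dtK b K1f n / INR (fact n))) /\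
  (forall n : nat, (1 <= n)%nat -> Nat.Even n ->
     b_ n = - (dtK b K1f n / INR (fact n))) /\
  (forall n : nat, Nat.Odd n -> b_ n = dtK b Kf n / INR (fact n)) /\
  (forall n : nat,
     dtK b Kf n = dtK_formula b q h n /\
     dtK b K1f n = dtK_formula b q1f (- h) n) /\
  converges_uniformly (fun p : R * R => Icc b (fst p) /\ Icc b (snd p))
    (fun (N : nat) (p : R * R) =>
       let (x, t) := p in
       c_ 0%nat * u_ f 0 x t +
       Csum (fun n : nat =>
               c_ n * u_ f (2 * n - 1) x t + b_ n * u_ f (2 * n) x t) 1 N)
    (fun p : R * R => Kf (fst p) (snd p)).
Proof.
intros b q f Kf K1f c_ b_ Hb Hqs Hfs Hode Hfn Hf0 h q1f HKf HK1f g1 g2 Hg1 Hg2.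
assert (I0 : Icc b 0) by (unfold Icc; lra).
assert (Ho : forall x, (- b < x < b)%R -> Icc b x) by (intros; unfold Icc; lra).
(* The formal powers on [-b,b] involve f on [-b,b] only, and those of the extension
   of f are differentiable everywhere. *)
set (fb := fun x => f (clamp b x)).
set (f1 := Derive_on (Icc b) f) in *.
assert (Efb : forall x, Icc b x -> fb x = f x).
{ intros x Hx; unfold fb; rewrite clamp_id by exact Hx; reflexivity. }
assert (Cfb : forall x, ccont fb x).
{ intros x; apply clamp_continuous; [exact Hb|]; apply (C_n_on_continuous b 2 0 f Hfs); lia. }
assert (Nfb : forall x, fb x <> 0) by (intros x; apply Hfn, clamp_Icc, Hb).
assert (fb0 : fb 0%R = 1) by (rewrite Efb; assumption).
assert (Dfb : forall x, (- b < x < b)%R -> cder fb x (f1 x)).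
{ intros x Hx; apply (cder_ext_loc f).
  - generalize (locally_Icc _ _ Hx); apply filter_imp; intros y Hy; symmetry; apply Efb, Hy.
  - apply (C_n_on_cder b 2 0 f x Hb Hfs); [lia|exact Hx]. }
assert (Df1 : forall x, (- b < x < b)%R -> cder f1 x (q x * fb x)).
{ intros x Hx; eapply cder_eq; [apply (C_n_on_cder b 2 1 f x Hb Hfs); [lia|exact Hx]|].
  rewrite Efb by (apply Ho, Hx); specialize (Hode x (Ho x Hx)).
  replace (Derive_n_on (Icc b) f 2 x) with ((Derive_n_on (Icc b) f 2 x - q x * f x) + q x * f x) by ring.
  rewrite Hode; ring. }
destruct (continuous_on_bounded b f Hb) as [F HF].
{ apply (C_n_on_continuous b 2 0 f Hfs); lia. }
destruct (continuous_on_bounded b f1 Hb) as [F1 HF1].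
{ apply (C_n_on_continuous b 2 1 f Hfs); lia. }
destruct (continuous_on_bounded b q Hb) as [Q HQ].
{ apply (C_n_on_continuous b 0 0 q (Hqs 0%nat)); lia. }
destruct (ccont_bounded (fun x => / fb x) (- b) b) as [G HG].
{ intros x _; apply ccont_inv; auto. }
assert (BF : forall x, (- b < x < b)%R -> (Cmod (fb x) <= F)%R).
{ intros x Hx; rewrite Efb by auto; auto. }
assert (BF1 : forall x, (- b < x < b)%R -> (Cmod (f1 x) <= F1)%R) by auto.
assert (BG : forall x, (- b < x < b)%R -> (Cmod (/ fb x) <= G)%R) by (intros; apply HG; lra).
assert (BQ : forall x, (- b < x < b)%R -> (Cmod (q x) <= Q)%R) by auto.
assert (Dq : forall n x, (- b < x < b)%R ->
   cder (Derive_n_on (Icc b) q n) x (Derive_n_on (Icc b) q (S n) x)).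
{ intros n x Hx; apply (C_n_on_cder b (S n)); [exact Hb|apply Hqs|lia|exact Hx]. }
assert (Cq : forall x, (- b < x < b)%R -> ccont q x).
{ intros x Hx; eapply cder_continuous; exact (Dq 0%nat x Hx). }
assert (Eq1 : forall x, (- b < x < b)%R -> q1f x = - q x + 2 * (f1 x / fb x) ^ 2).
{ intros x Hx; unfold q1f, q_inv; fold f1; rewrite Efb by auto; reflexivity. }
assert (Sq : forall n, smooth_upto b n q).
{ assert (P : forall n k, smooth_upto b n (Derive_n_on (Icc b) q k)).
  { induction n as [|n IH]; intros k; [exact I|].
    exists (Derive_n_on (Icc b) q (S k)); split; [apply Dq|apply IH]. }
  intros n; apply (P n 0%nat). }
(* f'' = q f raises the order of smoothness of f and f' by induction. *)
assert (Sf : forall n, smooth_upto b n fb /\ smooth_upto b n f1).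
{ induction n as [|n [IH1 IH2]]; [split; exact I|]; split.
  - exists f1; split; assumption.
  - exists (fun x => q x * fb x); split; [exact Df1|apply smooth_upto_mult; auto]. }
assert (Sq1 : forall n, smooth_upto b n q1f).
{ intros n; apply (smooth_upto_ext b n (fun x => - (1) * q x +
     2 * ((f1 x * / fb x) * (f1 x * / fb x)))).
  { intros x Hx; rewrite Eq1 by exact Hx; simpl; field; apply Nfb. }
  assert (P : smooth_upto b n (fun x => f1 x * / fb x)).
  { apply smooth_upto_mult; [apply Sf|apply smooth_upto_inv; [auto|apply Sf]]. }
  apply smooth_upto_plus; apply smooth_upto_mult; try apply smooth_upto_const; [apply Sq|].
  apply smooth_upto_mult; exact P. }
assert (Dq1 := smooth_Derive_n_on b Hb q1f Sq1).
assert (BQ1 : forall x, (- b < x < b)%R -> (Cmod (q1f x) <= Q + 2 * (F1 * G) * (F1 * G))%R).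
{ intros x Hx; rewrite Eq1 by exact Hx.
  eapply Rle_trans; [apply Cmod_triangle|]; rewrite Cmod_opp; apply Rplus_le_compat; [auto|].
  assert (P : (Cmod (f1 x / fb x) <= F1 * G)%R).
  { unfold Cdiv; rewrite Cmod_mult; apply Rmult_le_compat; try apply Cmod_ge_0; auto. }
  simpl; rewrite Cmult_1_r, !Cmod_mult, Cmod_R, Rabs_pos_eq by lra.
  assert (P0 := Cmod_ge_0 (f1 x / fb x)). nra. }
destruct (kernel_time_derivatives b q h Kf Hb Dq HKf) as [CKf [DKf FKf]].
destruct (kernel_time_derivatives b q1f (- h) K1f Hb Dq1 HK1f) as [CK1f [DK1f FK1f]].
assert (Tr : forall x, Icc b x ->
  g1 x = h / 2 + / 4 * CInt q 0 x /\ g2 x = / 4 * CInt q 0 x).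
{ intros x Hx; destruct (kernel_traces b q h Kf x HKf Hx) as [E1 E2].
  unfold g1, g2; rewrite E1, E2; split; field; split; intros E; apply RtoC_inj in E; lra. }
assert (T1 : forall N x, Icc b x -> c_ 0%nat * u_ f 0 x x +
   Csum (fun n : nat => c_ n * u_ f (2 * n - 1) x x) 1 N = trace fb true c_ N x).
{ intros N x Hx; unfold trace; rewrite <- Csum_1; f_equal.
  - rewrite (u_ext f fb b) by (auto; intros; symmetry; auto); rewrite u_wave_0; reflexivity.
  - apply Csum_1_ext; intros n Hn.
    rewrite (u_ext f fb b) by (auto; intros; symmetry; auto); rewrite u_wave_true by exact Hn; reflexivity. }
(* The coefficient d_ 0 is used by the expansion for 1/f, where the constant term
   belongs to the other family. *)
set (d_ := fun n => match n with O => c_ 0%nat | S _ => b_ n end).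
assert (T2 : forall N x, Icc b x ->
   Csum (fun n : nat => b_ n * u_ f (2 * n) x x) 1 N = trace fb false d_ N x).
{ intros N x Hx; unfold trace; rewrite <- Csum_1, wave_false_0, Cmult_0_r, Cplus_0_l.
  apply Csum_1_ext; intros n Hn.
  rewrite (u_ext f fb b) by (auto; intros; symmetry; auto); rewrite u_wave_false by exact Hn.
  destruct n; [lia|reflexivity]. }
assert (L1 : forall e, (0 < e)%R -> exists N0, forall N, (N0 <= N)%nat -> forall x, Icc b x ->
   (Cmod (trace fb true c_ N x - (h / 2 + / 4 * CInt q 0 x)) < e)%R).
{ intros e He; destruct (Hg1 e He) as [N0 HN]; exists N0; intros N HNN x Hx.
  rewrite <- T1, <- (proj1 (Tr x Hx)) by exact Hx; apply HN; assumption. }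
assert (L2 : forall e, (0 < e)%R -> exists N0, forall N, (N0 <= N)%nat -> forall x, Icc b x ->
   (Cmod (trace fb false d_ N x - / 4 * CInt q 0 x) < e)%R).
{ intros e He; destruct (Hg2 e He) as [N0 HN]; exists N0; intros N HNN x Hx.
  rewrite <- T2, <- (proj2 (Tr x Hx)) by exact Hx; apply HN; assumption. }
(* At the origin only the term n = 0 of the expansion of g1 is not zero. *)
assert (c0 : c_ 0%nat = h / 2).
{ apply Cmod_small_eq; intros e He; destruct (L1 e He) as [N0 HN].
  specialize (HN N0 (le_n _) 0%R I0); rewrite trace_0, CInt_point in HN by exact fb0.
  cbv iota in HN; replace (h / 2 + / 4 * 0) with (h / 2) in HN by ring; exact HN. }
assert (Xf : converges_uniformly (fun p : R * R => Icc b (fst p) /\ Icc b (snd p))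
    (fun N p => partial_sum fb c_ d_ N (fst p) (snd p)) (fun p => Kf (fst p) (snd p))).
{ apply (expansion_converges b q fb f1 h Kf c_ d_ Q); try assumption.
  intros e He; assert (He2 : (0 < e / 2)%R) by lra.
  destruct (L1 _ He2) as [N1 H1], (L2 _ He2) as [N2 H2].
  exists (Nat.max N1 N2); intros N HN x Hx; assert (Ix := Ho x Hx).
  specialize (H1 N ltac:(lia) x Ix); specialize (H2 N ltac:(lia) x Ix).
  destruct (kernel_traces b q h Kf x HKf Ix) as [E1 E2].
  rewrite partial_sum_diag, partial_sum_antidiag, E1, E2.
  set (A1 := trace fb true c_ N x - (h / 2 + / 4 * CInt q 0 x)) in *.
  set (A2 := trace fb false d_ N x - / 4 * CInt q 0 x) in *.
  split.
  - replace (_ - _) with (A1 + A2).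
    + eapply Rle_lt_trans; [apply Cmod_triangle|lra].
    + unfold A1, A2; field; split; intros E; apply RtoC_inj in E; lra.
  - replace (_ - _) with (A1 - A2).
    + eapply Rle_lt_trans; [apply Cmod_minus_le|lra].
    + unfold A1, A2; field; split; intros E; apply RtoC_inj in E; lra. }
set (fi := fun y => / fb y).
assert (Xi : converges_uniformly (fun p : R * R => Icc b (fst p) /\ Icc b (snd p))
    (fun N p => partial_sum fi (fun n => - d_ n) (fun n => - c_ n) N (fst p) (snd p))
    (fun p => K1f (fst p) (snd p))).
{ apply (expansion_converges b q1f fi (fun x => - f1 x / fb x ^ 2) (- h) K1f _ _
     (Q + 2 * (F1 * G) * (F1 * G))); try assumption.
  - intros x; apply ccont_inv; auto.
  - intros x E; apply C1_nz; rewrite <- (Cinv_r (fb x) (Nfb x)).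
    change (/ fb x = 0) in E; rewrite E; ring.
  - intros x Hx; apply (inv_solution b q fb f1 Nfb Dfb Df1 q1f Eq1 x Hx).
  - intros x Hx; apply (inv_solution b q fb f1 Nfb Dfb Df1 q1f Eq1 x Hx).
  - intros x Hx; eapply cder_continuous; exact (Dq1 0%nat x Hx).
  - intros e He.
    assert (F0 : (0 <= F)%R) by (eapply Rle_trans; [apply Cmod_ge_0|apply (BF 0%R); lra]).
    assert (F10 : (0 <= F1)%R) by (eapply Rle_trans; [apply Cmod_ge_0|apply (BF1 0%R); lra]).
    assert (G0 : (0 <= G)%R) by (eapply Rle_trans; [apply Cmod_ge_0|apply (BG 0%R); lra]).
    set (A := (2 * G * (2 * F + 2 * F1 * b))%R).
    assert (A0 : (0 <= A)%R) by (unfold A; apply Rmult_le_pos; nra).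
    assert (He2 : (0 < e / (A + 1))%R) by (apply Rdiv_lt_0_compat; lra).
    destruct (L1 _ He2) as [N1 H1], (L2 _ He2) as [N2 H2].
    exists (Nat.max N1 N2); intros N HN x Hx.
    destruct (inv_traces_bound b q fb f1 F F1 G Hb Cfb Nfb fb0 Dfb Df1 Cq BF BF1 BG q1f Eq1
      h K1f c_ d_ eq_refl HK1f c0 N (e / (A + 1))) with (x := x) as [B1 B2].
    + intros y Hy; apply Rlt_le, H1; [lia|auto].
    + intros y Hy; apply Rlt_le, H2; [lia|auto].
    + exact Hx.
    + assert (Lt : (A * (e / (A + 1)) < e)%R).
      { apply Rmult_lt_reg_r with (A + 1)%R; [lra|].
        replace (A * (e / (A + 1)) * (A + 1))%R with (A * e)%R by (field; lra). nra. }
      split; (eapply Rle_lt_trans; [|exact Lt]); assumption. }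
assert (Coef : forall n, (if Nat.even n then c_ n else d_ n) = dtK b Kf n / INR (fact n)).
{ apply (power_series_coefficients b (fun n => if Nat.even n then c_ n else d_ n)
    (Derive_n_on (Icc b) (fun t => Kf 0%R t)) Hb); [|exact DKf].
  intros t Ht e He; destruct (Xf e He) as [N0 HN]; exists N0; intros N HNN.
  rewrite <- (partial_sum_x0 fb) by exact fb0.
  apply (HN N HNN (0%R, t)); split; [exact I0|apply Ho, Ht]. }
assert (fi0 : fi 0%R = 1).
{ unfold fi; rewrite fb0; field. }
assert (Coefi : forall n, (if Nat.even n then - d_ n else - c_ n) = dtK b K1f n / INR (fact n)).
{ apply (power_series_coefficients b (fun n => if Nat.even n then - d_ n else - c_ n)
    (Derive_n_on (Icc b) (fun t => K1f 0%R t)) Hb); [|exact DK1f].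
  intros t Ht e He; destruct (Xi e He) as [N0 HN]; exists N0; intros N HNN.
  rewrite <- (partial_sum_x0 fi (fun n => - d_ n) (fun n => - c_ n)) by exact fi0.
  apply (HN N HNN (0%R, t)); split; [exact I0|apply Ho, Ht]. }
assert (Ev : forall n, Nat.Even n -> Nat.even n = true) by (intros n; apply Nat.even_spec).
assert (Od : forall n, Nat.Odd n -> Nat.even n = false).
{ intros n Hn; rewrite <- Nat.negb_odd; apply Nat.odd_spec in Hn; rewrite Hn; reflexivity. }
split; [exact Tr|split; [split; assumption|split; [|split; [|split; [|split; [|split]]]]]].
- intros n Hn; rewrite <- Coef, Ev by exact Hn; reflexivity.
- intros n Hn; rewrite <- Coefi, Od by exact Hn; ring.
- intros n H1 Hn; rewrite <- Coefi, Ev by exact Hn; destruct n; [lia|]. unfold d_; ring.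
- intros n Hn; rewrite <- Coef, Od by exact Hn; destruct n; [destruct Hn; lia|reflexivity].
- intros n; split; [apply FKf|apply FK1f].
- intros e He; destruct (Xf e He) as [N0 HN]; exists N0; intros N HNN [x t] [Hx Ht].
  cbn [fst snd] in Hx, Ht.
  replace (c_ 0%nat * u_ f 0 x t + _) with (partial_sum fb c_ d_ N x t);
    [apply (HN N HNN (x, t)); split; assumption|].
  unfold partial_sum; rewrite <- Csum_1, wave_false_0, Cmult_0_r, Cplus_0_r; f_equal.
  + rewrite (u_ext f fb b) by (auto; intros; symmetry; auto); rewrite u_wave_0; reflexivity.
  + apply Csum_1_ext; intros n Hn.
    rewrite !(u_ext f fb b) by (auto; intros; symmetry; auto).
    rewrite u_wave_true, u_wave_false by exact Hn; destruct n; [lia|reflexivity].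
Qed.
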